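(* Let $G$ be a finite pseudoreflection group acting on $\mathbb{C}^n$ with basic polynomials $\theta_1,\dots,\theta_n$, where $\theta_i(\mathbf z)=\sum_{\mathbf u\in N_i}a^{(i)}_{\mathbf u}\mathbf z^{\mathbf u}$ is homogeneous of degree $\eta_i$, $N_i\subseteq\{\mathbf u\in\mathbb{N}_0^n:\sum_{j=1}^nu_j=\eta_i\}$, and the $a^{(i)}_{\mathbf u}$ are positive numbers. Let $D\subset\mathbb{C}^n$ be a bounded complete Reinhardt domain and $\mathbb{A}^2(D)$ its Bergman space. For each $i=1,\dots,n$, let $\Lambda_i:\ell^2(\mathbb{N}_0^n)\to\ell^2(\mathbb{N}_0^n)$ be the weighted shift on the generalized directed semi-tree $(\mathcal{G}_i,c_i')=(\mathbb{N}_0^n,E^{(i)}_n)$, $E^{(i)}_n=\{(\boldsymbol\alpha,\boldsymbol\alpha+\mathbf u):\boldsymbol\alpha\in\mathbb{N}_0^n,\ \mathbf u\in N_i\}$, given by $$\Lambda_i\chi_{\boldsymbol\alpha}=\sum_{\mathbf u\in N_i}a^{(i)}_{\mathbf u}\frac{\|\mathbf z^{\boldsymbol\alpha+\mathbf u}\|}{\|\mathbf z^{\boldsymbol\alpha}\|}\,\chi_{\boldsymbol\alpha+\mathbf u},\qquad\boldsymbol\alpha\in\mathbb{N}_0^n,$$ where norms are taken in $\mathbb{A}^2(D)$. Then for each $i=1,\dots,n$ the weighted shift $\Lambda_i$ is unitarily equivalent to the multiplication operator $M_{\theta_i}$ on $\mathbb{A}^2(D)$.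
   Context: A pseudoreflection on $\mathbb{C}^n$ is a linear map $\sigma:\mathbb{C}^n\to\mathbb{C}^n$ of finite order in $GL(n,\mathbb{C})$ such that $\mathrm{id}-\sigma$ has rank 1; a pseudoreflection group is a group generated by pseudoreflections. For a finite pseudoreflection group $G$, basic polynomials are algebraically independent homogeneous polynomials $\theta_1,\dots,\theta_n$ (of positive degree) with $\mathbb{C}[z_1,\dots,z_n]^G=\mathbb{C}[\theta_1,\dots,\theta_n]$, where $\mathbb{C}[z_1,\dots,z_n]^G$ is the ring of $G$-invariant polynomials. Notation: $\mathbf z^{\mathbf u}=\prod_jz_j^{u_j}$. A domain $U\subset\mathbb{C}^n$ containing $0$ is a complete Reinhardt domain (with center $0$) if for every $\mathbf z\in U$ it contains the closed polydisc $\{\mathbf w:|w_j|\le|z_j|,\ j=1,\dots,n\}$. $\mathbb{A}^2(D)$ is the Hilbert space of holomorphic functions in $L^2(D)$ with respect to Lebesgue measure; $M_{\theta_i}f=\theta_if$. The set $\{\mathbf z^{\boldsymbol\alpha}/\|\mathbf z^{\boldsymbol\alpha}\|\}_{\boldsymbol\alpha\in\mathbb{N}_0^n}$ is an orthonormal basis of $\mathbb{A}^2(D)$. $\chi_{\boldsymbol\alpha}\in\ell^2(\mathbb{N}_0^n)$ is the indicator function of $\{\boldsymbol\alpha\}$. A directed graph $(V,E)$, with $\mathrm{Chi}(u)=\{v:(u,v)\in E\}$, is a generalized directed semi-tree if it has no circuit (distinct vertices $v_1,\dots,v_r$, $r\ge2$, with $(v_j,v_{j+1})\in E$ for $j<r$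 and $(v_r,v_1)\in E$), has at most countably many connected components, and there is a non-negative integer $m$ with $\mathrm{card}(\mathrm{Chi}(u)\cap\mathrm{Chi}(v))\le m$ for all distinct $u,v\in V$; $c_i'$ denotes the least such integer for $(\mathbb{N}_0^n,E^{(i)}_n)$. A weighted shift on $(V,E)$ with weights $\lambda_{(u,v)}$, $(u,v)\in E$, acts on $\ell^2(V)$ by $\chi_u\mapsto\sum_{v\in\mathrm{Chi}(u)}\lambda_{(u,v)}\chi_v$. *)

(* Defs.v *)
From HB Require Import structures.
From Stdlib Require Import Relation_Operators.
From mathcomp Require Import all_boot all_order all_algebra finmap.
From mathcomp Require Import complex.
From mathcomp Require Import -(notations) mpoly.
From mathcomp Require Import all_classical all_reals all_analysis.

Set Implicit Arguments.
Unset Strict Implicit.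
Unset Printing Implicit Defensive.

Import Order.TTheory GRing.Theory Num.Theory.
Import numFieldNormedType.Exports.

Local Open Scope classical_set_scope.
Local Open Scope complex_scope.
Local Open Scope ring_scope.

(* C with its usual topology: the one every numFieldType has as R[i]^o. *)
HB.instance Definition _ (R : realType) := NormedModule.copy R[i] R[i]^o.

Section polynomials.
Context (R : realType) (n : nat).
Local Notation C := R[i].

Definition mxgroup (G : set 'M[C]_n) :=
  [/\ G `<=` [set A | A \in unitmx], G 1%:M,
      forall A B, G A -> G B -> G (A *m B) & forall A, G A -> G (invmx A)].

Definition pseudoreflection (s : 'M[C]_n) :=
  [/\ s \in unitmx, exists2 k, (0 < k)%N & s ^+ k = 1 &
      \rank (1%:M - s) = 1%N].

Definition pseudoreflection_group (G : set 'M[C]_n) :=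
  exists2 S : set 'M[C]_n, S `<=` [set s | pseudoreflection s] &
    G = smallest mxgroup S.

Definition peval (p : mpoly n C) (z : 'cV[C]_n) : C :=
  meval (fun j => z j 0) p.

Definition invariant_poly (G : set 'M[C]_n) (p : mpoly n C) :=
  forall s z, G s -> peval p (s *m z) = peval p z.

Definition basic_polynomials (G : set 'M[C]_n) (theta : n.-tuple (mpoly n C)) :=
  [/\ forall i, exists2 d, (0 < d)%N &
        tnth theta i \is ishomog1 d mdeg,
      forall q : mpoly n C, comp_mpoly theta q = 0 -> q = 0 &
      forall p, invariant_poly G p <-> exists q, p = comp_mpoly theta q].

Definition complete_reinhardt_domain (D : set 'cV[C]_n) :=
  [/\ open D, connected D, D 0 &
      forall z w : 'cV[C]_n, D z -> (forall j, `|w j 0| <= `|z j 0|) -> D w].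

End polynomials.

(* The library's instance making a product of sigma-finite measures
   sigma-finite is shadowed by the one for subprobability measures. *)
Lemma sigma_finite_prod d1 d2 (T1 : measurableType d1) (T2 : measurableType d2)
    (R : realType) (m1 : {sigma_finite_measure set T1 -> \bar R})
    (m2 : {sigma_finite_measure set T2 -> \bar R}) :
  sigma_finite setT (m1 \x m2)%E.
Proof.
have /sigma_finiteP[F [TF ndF Foo]] := sigma_finiteT m1.
have /sigma_finiteP[G [TG ndG Goo]] := sigma_finiteT m2.
exists (fun n => F n `*` G n).
  rewrite -setXTT TF TG predeqE => -[x y]; split.
    move=> [/= [n _ Fnx] [k _ Gky]]; exists (maxn n k) => //; split.
    - by move: x Fnx; exact/subsetPset/ndF/leq_maxl.
    - by move: y Gky; exact/subsetPset/ndG/leq_maxr.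
  by move=> [n _ []/= ? ?]; split; exists n.
move=> k; have [? ?] := Foo k; have [? ?] := Goo k.
split; first exact: measurableX.
by rewrite product_measure1E// lte_mul_pinfty// ge0_fin_numE.
Qed.

Section lebesgue.
Context (R : realType).
Local Notation RR := (measurableTypeR R * measurableTypeR R)%type.

Definition lebesgue2 : set RR -> \bar R :=
  (@lebesgue_measure R \x @lebesgue_measure R)%E.

HB.instance Definition _ := Measure.on lebesgue2.
HB.instance Definition _ := Measure_isSigmaFinite.Build _ _ _ lebesgue2
  (sigma_finite_prod lebesgue_measure lebesgue_measure).

Definition tcons n (p : RR * n.-tuple RR) : n.+1.-tuple RR :=
  [tuple of p.1 :: p.2].

Lemma measurable_tcons n : measurable_fun setT (@tcons n).
Proof. exact: measurable_cons. Qed.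

Section step.
Context (n : nat) (m : {sigma_finite_measure set (n.-tuple RR) -> \bar R}).

Definition lebesgue_step : set (n.+1.-tuple RR) -> \bar R :=
  pushforward (lebesgue2 \x m)%E (@tcons n).

Let step0 : lebesgue_step set0 = 0%E.
Proof. by rewrite /lebesgue_step /pushforward preimage_set0 measure0. Qed.

Let step_ge0 A : (0 <= lebesgue_step A)%E.
Proof. by rewrite /lebesgue_step /pushforward measure_ge0. Qed.

Let step_sigma_additive : semi_sigma_additive lebesgue_step.
Proof.
move=> F mF tF mUF; rewrite /lebesgue_step /pushforward preimage_bigcup.
have mt := @measurable_tcons n.
apply: measure_semi_sigma_additive.
- by move=> k; rewrite -[X in measurable X]setTI; exact: mt.
- apply/trivIsetP => /= i j _ _ ij; rewrite -preimage_setI.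
  by move/trivIsetP : tF => /(_ _ _ _ _ ij) ->//; rewrite preimage_set0.
- by rewrite -preimage_bigcup -[X in measurable X]setTI; exact: mt.
Qed.

HB.instance Definition _ := isMeasure.Build _ _ _ lebesgue_step
  step0 step_ge0 step_sigma_additive.

Let step_sigma_finite : sigma_finite setT lebesgue_step.
Proof.
pose u (t : n.+1.-tuple RR) := (thead t, [tuple of behead t]).
have mu_ : measurable_fun setT u.
  apply/measurable_fun_pairP; split; last exact: measurable_behead.
  exact: measurable_tnth.
have tconsK : cancel (@tcons n) u.
  by move=> [x t]; congr pair; apply/val_inj.
have [F TF Foo] := sigma_finite_prod lebesgue2 m.
exists (fun i => u @^-1` F i); first by rewrite -preimage_bigcup -TF.
move=> i; have [mF Foo_] := Foo i; split.
  by rewrite -[X in measurable X]setTI; exact: mu_.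
rewrite /lebesgue_step /pushforward -comp_preimage.
by rewrite (_ : u \o _ = id) //; apply/funext => p /=; rewrite tconsK.
Qed.

HB.instance Definition _ := Measure_isSigmaFinite.Build _ _ _ lebesgue_step
  step_sigma_finite.

End step.

(* Lebesgue measure on C^n = (R * R)^n, as an iterated product. *)
Fixpoint lebesgueC n : {sigma_finite_measure set (n.-tuple RR) -> \bar R} :=
  if n is n'.+1 then lebesgue_step (lebesgueC n') else \d_([tuple] : 0.-tuple RR).

Lemma lebesgueC_box n (A : 'I_n -> set RR) : (forall i, measurable (A i)) ->
  lebesgueC n [set t | forall i, A i (tnth t i)] =
  (\prod_(i < n) lebesgue2 (A i))%E.
Proof.
elim: n A => [|n IH] A mA.
  by rewrite big_ord0 /= diracE mem_set// => -[].
rewrite big_ord_recl -IH// -product_measure1E//; last first.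
  rewrite (_ : mkset _ =
      \bigcap_(i in [set: 'I_n]) ((@tnth n RR)^~ i @^-1` A (lift ord0 i))).
    apply: fin_bigcap_measurable => [|i _]; first exact: finite_finset.
    by rewrite -[X in measurable X]setTI; exact: measurable_tnth.
  by apply/seteqP; split => t /= h i; [move=> _; exact: h|exact: (h i)].
rewrite /= /lebesgue_step /pushforward; congr (_ _).
apply/seteqP; split => -[x t] /=.
  move=> h; split => [|i]; first exact: (h ord0).
  by have := h (lift ord0 i); rewrite tnthS.
move=> [/= h0 h] i; have [->//|i0] := eqVneq i ord0.
by case: (unliftP ord0 i) i0 => [j ->|->] //= _; rewrite tnthS; exact: h.
Qed.

Definition cvec n (t : n.-tuple RR) : 'cV[R[i]]_n :=
  \col_i ((tnth t i).1 +i* (tnth t i).2).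

Definition integralC n (D : set 'cV[R[i]]_n) (f : 'cV[R[i]]_n -> R[i]) : R[i] :=
  (\int[lebesgueC n]_(t in @cvec n @^-1` D) complex.Re (f (cvec t)))
  +i* (\int[lebesgueC n]_(t in @cvec n @^-1` D) complex.Im (f (cvec t))).

End lebesgue.

Section hilbert.
Context (R : realType).
Local Notation C := R[i].

(* A Hilbert space of complex functions on T; operators are represented by
   functions on T -> C, whose values outside the carrier are irrelevant. *)
Record fspace (T : Type) := FSpace {
  carrier : set (T -> C) ;
  inner : (T -> C) -> (T -> C) -> C }.

Definition hnorm T (H : fspace T) (f : T -> C) : R :=
  Num.sqrt (complex.Re (inner H f f)).

Definition linear_on T T' (H : fspace T) (U : (T -> C) -> T' -> C) :=
  forall (c : C) f g, carrier H f -> carrier H g ->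
    U (c *: f + g) = c *: U f + U g.

Definition bounded_operator T (H : fspace T) (S : (T -> C) -> T -> C) :=
  [/\ forall f, carrier H f -> carrier H (S f), linear_on H S &
      exists M : R, forall f, carrier H f -> hnorm H (S f) <= M * hnorm H f].

Definition unitary T T' (H : fspace T) (K : fspace T')
    (U : (T -> C) -> T' -> C) :=
  [/\ set_bij (carrier H) (carrier K) U, linear_on H U &
      forall f g, carrier H f -> carrier H g ->
        inner K (U f) (U g) = inner H f g].

Definition unitarily_equivalent T T' (H : fspace T) (K : fspace T')
    (S : (T -> C) -> T -> C) (S' : (T' -> C) -> T' -> C) :=
  exists2 U, unitary H K U & forall f, carrier H f -> U (S f) = S' (U f).

Section ell2.
Context (V : choiceType).

(* Sum of an absolutely summable family. *)
Definition real_sum (f : V -> R) : R :=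
  fine (\esum_(v in setT) (EFin \o f)^\+ v
        - \esum_(v in setT) (EFin \o f)^\- v)%E.

Definition complex_sum (f : V -> C) : C :=
  real_sum (fun v => complex.Re (f v)) +i* real_sum (fun v => complex.Im (f v)).

Definition ell2 : fspace V := FSpace
  [set x | (\esum_(v in setT) (complex.Re (`|x v| ^+ 2))%:E < +oo)%E]
  (fun x y => complex_sum (fun v => x v * (y v)^*)).

Definition chi (u : V) : V -> C := fun v => (v == u)%:R.

End ell2.

(* A function on D is represented by its extension by 0 outside D, so that
   equality in the carrier is equality on D; differentiability over C at the
   points of the open set D is holomorphy. *)
Definition bergman n (D : set 'cV[C]_n) : fspace 'cV[C]_n := FSpace
  [set f | [/\ forall z, D z -> differentiable (f : 'cV[C]_n -> C) z,
               forall z, ~ D z -> f z = 0 &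
               (\int[lebesgueC R n]_(t in @cvec R n @^-1` D)
                  (complex.Re (`|f (cvec t)| ^+ 2))%:E < +oo)%E]]
  (fun f g => integralC D (fun z => f z * (g z)^*)).

Definition mul_op n (p : mpoly n C) (f : 'cV[C]_n -> C) : 'cV[C]_n -> C :=
  fun z => peval p z * f z.

(* Not cut off outside D, which is harmless: inner only sees values on D. *)
Definition monomial_norm n (D : set 'cV[C]_n) (u : multinom n) : R :=
  hnorm (bergman D) (peval (mpolyX C u)).

End hilbert.

Section graphs.
Context (V : choiceType).
Implicit Types (E : rel V).

Definition chi_set E (u : V) : set V := [set v | E u v].

Definition circuit E (s : seq V) := [&& (2 <= size s)%N, uniq s & cycle E s].

Definition component E (u : V) : set V :=
  [set v | clos_refl_sym_trans V E u v].

Definition gen_directed_semitree E (m : nat) :=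
  [/\ forall s, ~~ circuit E s, countable (range (component E)) &
      forall u v, u != v -> (chi_set E u `&` chi_set E v #<= `I_m)%card].

Definition semitree_index E (c : nat) :=
  gen_directed_semitree E c /\
  forall m, gen_directed_semitree E m -> (c <= m)%N.

(* The second clause is S (chi u) = \sum_(v in Chi u) w u v *: chi v, read
   coordinatewise. *)
Definition weighted_shift (R : realType) E (w : V -> V -> R[i])
    (S : (V -> R[i]) -> V -> R[i]) :=
  bounded_operator (ell2 R V) S /\
  forall u v, S (chi R u) v = if E u v then w u v else 0.

End graphs.

Definition shift_edge n (N : {fset multinom n}) : rel (multinom n) :=
  fun alpha beta => beta \in [fset mnm_add alpha u | u in N]%fset.

(* Main.v *)
From HB Require Import structures.
Require Import Defs.
From mathcomp Require Import all_boot all_order all_algebra finmap.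
From mathcomp Require Import complex.
From mathcomp Require Import -(notations) mpoly.
From mathcomp Require Import all_classical all_reals all_analysis.
From mathcomp Require Import measurable_realfun.
From mathcomp Require Import ring lra.

Import Order.TTheory GRing.Theory Num.Theory.
Import numFieldNormedType.Exports.

Local Open Scope classical_set_scope.
Local Open Scope complex_scope.
Local Open Scope ring_scope.

(** The operator [M_theta] of multiplication by a polynomial
    [theta = \sum_u a u * z ^ u] sends the monomial [z ^ alpha] to
    [\sum_u a u * z ^ (alpha + u)].  Once the monomials are divided by their
    norms, this is exactly the formula that defines [Lambda] on the basis of
    [chi]'s.  Hence the map [U] sending [chi u] to [z ^ u / ||z ^ u||] intertwines
    the two operators on a basis, and everywhere as soon as [U] is unitary and
    both operators are bounded ([series_op_intertwines]).  The substance of the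
    proof is therefore that the normalized monomials form an orthonormal basis
    of the Bergman space of a bounded complete Reinhardt domain [D]
    ([series_op_unitary]).

    Orthonormality.  Rotating each coordinate by a number of modulus one
    preserves [D] and Lebesgue measure (a plane rotation is a product of shears),
    and distinct monomials are separated by such rotations, so they are
    orthogonal on every set invariant under rotations.  Applied to the sets where
    a power series is bounded by a constant, this gives Parseval's identity on
    [D] by exhaustion ([parseval]).  Coefficients of square-summable families
    grow slowly enough for the series to converge on all of [D], because the norm
    of [z ^ u] dominates [rho ^ u] for every polyradius [rho] inside [D]
    ([monomial_norm_ge]).

    Completeness.  A holomorphic function on [D] has to be the sum of a power
    series ([holo_power_series]), which requires Cauchy's formula.  In one
    variable it is proved with Riemann sums over roots of unity in place of
    integrals: Goursat's bisection shows that these sums are asymptotically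
    unchanged when the circle is contracted to the point ([cauchy_rootavg]).  In
    several variables the formula is iterated, with the limit of the Riemann
    sums replaced by an ultrafilter limit: the latter is a linear functional of
    norm one on all bounded functions on the circle, so no regularity has to be
    checked for the intermediate means ([cauchy_polydisc]).

    That the graph is a generalized directed semi-tree is a matter of degrees:
    since the coefficients are positive and [theta] is homogeneous of positive
    degree, every edge increases the degree, which excludes circuits; and a
    vertex has no more children than [theta] has terms. *)

Set Implicit Arguments.
Unset Strict Implicit.
Unset Printing Implicit Defensive.
Set SsrOldRewriteGoalsOrder.

(** * Real-valued modulus and convergence of complex sequences *)

Section modulus.
Context (R : realType).
Implicit Types (x y z : R[i]) (u v : nat -> R[i]).

(** The norm of [R[i]] has values in [R[i]]; its real part gives access to the
    order and the limits of [R]. *)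
Definition cabs z : R := complex.Re `|z|.

Lemma cabsE z : `|z| = (cabs z)%:C.
Proof. by rewrite /cabs normc_def. Qed.

Lemma cabs_ge0 z : 0 <= cabs z.
Proof. by rewrite -ler0c -cabsE. Qed.

Lemma cabsM x y : cabs (x * y) = cabs x * cabs y.
Proof. by apply: complexI; rewrite rmorphM/= -!cabsE normrM. Qed.

Lemma cabsD x y : cabs (x + y) <= cabs x + cabs y.
Proof. by rewrite -lecR rmorphD -!cabsE ler_normD. Qed.

Lemma cabsN x : cabs (- x) = cabs x.
Proof. by rewrite /cabs normrN. Qed.

Lemma cabsB x y : cabs (x - y) <= cabs x + cabs y.
Proof. by rewrite -(cabsN y) cabsD. Qed.

Lemma cabsC x y : cabs (x - y) = cabs (y - x).
Proof. by rewrite -cabsN opprB. Qed.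

Lemma cabs0 : cabs 0 = 0.
Proof. by rewrite /cabs normr0. Qed.

Lemma cabs1 : cabs 1 = 1.
Proof. by rewrite /cabs normr1. Qed.

Lemma cabs_eq0 x : (cabs x == 0) = (x == 0).
Proof. by rewrite -(normr_eq0 x) cabsE -(inj_eq (@complexI R)). Qed.

Lemma cabs_gt0 x : (0 < cabs x) = (x != 0).
Proof. by rewrite lt_neqAle cabs_ge0 andbT eq_sym cabs_eq0. Qed.

Lemma cabsX x k : cabs (x ^+ k) = cabs x ^+ k.
Proof. by elim: k => [|k IH]; rewrite ?expr0 ?cabs1// !exprS cabsM IH. Qed.

Lemma cabsV x : cabs x^-1 = (cabs x)^-1.
Proof.
have [->|x0] := eqVneq x 0; first by rewrite invr0 cabs0 invr0.
apply: (mulfI (x := cabs x)); first by rewrite cabs_eq0.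
by rewrite -cabsM !mulfV ?cabs1// cabs_eq0.
Qed.

Lemma cabs_real (a : R) : cabs a%:C = `|a|.
Proof. by rewrite /cabs normc_def/= expr0n addr0 sqrtr_sqr. Qed.

Lemma cabs_conj x : cabs x^*%C = cabs x.
Proof. by rewrite /cabs normcJ. Qed.

Lemma cabs_sum (I : Type) (r : seq I) (P : pred I) (F : I -> R[i]) :
  cabs (\sum_(i <- r | P i) F i) <= \sum_(i <- r | P i) cabs (F i).
Proof.
elim/big_rec2: _ => [|i y x _ h]; first by rewrite cabs0.
by apply: le_trans (cabsD _ _) _; rewrite lerD2l.
Qed.

Lemma cabs_prod (I : Type) (r : seq I) (P : pred I) (F : I -> R[i]) :
  cabs (\prod_(i <- r | P i) F i) = \prod_(i <- r | P i) cabs (F i).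
Proof. by elim/big_rec2: _ => [|i y x _ <-]; rewrite ?cabs1// cabsM. Qed.

Lemma sqr_cabs x : cabs x ^+ 2 = complex.Re x ^+ 2 + complex.Im x ^+ 2.
Proof. by rewrite /cabs normc_def/= sqr_sqrtr// addr_ge0 ?sqr_ge0. Qed.

Lemma sqr_cabsE x : (cabs x ^+ 2)%:C = x * x^*%C.
Proof. by rewrite rmorphXn/= -cabsE sqr_normc. Qed.

Lemma cabs_ge_Re x : `|complex.Re x| <= cabs x.
Proof. by rewrite -lecR -cabsE normc_ge_Re. Qed.

Lemma cabs_ge_Im x : `|complex.Im x| <= cabs x.
Proof.
rewrite -ler_sqr ?nnegrE ?cabs_ge0// sqr_cabs real_normK ?num_real//.
by rewrite lerDr sqr_ge0.
Qed.

Lemma cabs_le_ReIm x : cabs x <= `|complex.Re x| + `|complex.Im x|.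
Proof.
rewrite -ler_sqr ?nnegrE ?cabs_ge0 ?addr_ge0// sqr_cabs sqrrD.
rewrite !real_normK ?num_real// -addrA lerD2l lerDr.
by rewrite mulrn_wge0// mulr_ge0.
Qed.

Definition ccvg u l := (fun N => cabs (u N - l)) @ \oo --> (0 : R).

Lemma ccvgP u l : ccvg u l <->
  forall e : R, 0 < e -> exists N0, forall N, (N0 <= N)%N -> cabs (u N - l) <= e.
Proof.
split=> [h e e0|h].
  have /cvgrPdist_le/(_ e e0)[N0 _ hN] := h.
  exists N0 => N /hN /=; rewrite sub0r normrN.
  by apply: le_trans; rewrite ler_norm.
apply/cvgrPdist_le => e /h[N0 hN]; exists N0 => // N /hN.
by rewrite /= sub0r normrN ger0_norm ?cabs_ge0.
Qed.

Lemma ccvg_cst x : ccvg (fun=> x) x.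
Proof. by apply/ccvgP => e e0; exists 0 => N _; rewrite subrr cabs0 ltW. Qed.

Lemma ccvgD u v l m : ccvg u l -> ccvg v m -> ccvg (fun N => u N + v N) (l + m).
Proof.
move=> /ccvgP hu /ccvgP hv; apply/ccvgP => e e0.
have [M hM] := hu _ (divr_gt0 e0 (ltr0n _ 2)).
have [N hN] := hv _ (divr_gt0 e0 (ltr0n _ 2)).
exists (maxn M N) => k; rewrite geq_max => /andP[/hM h1 /hN h2].
rewrite opprD addrACA (le_trans (cabsD _ _))// [leRHS](splitr e).
exact: lerD.
Qed.

Lemma ccvgZ c u l : ccvg u l -> ccvg (fun N => c * u N) (c * l).
Proof.
move=> /ccvgP hu; apply/ccvgP => e e0.
have c0 : 0 < cabs c + 1 by rewrite ltr_wpDl// cabs_ge0.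
have [M hM] := hu _ (divr_gt0 e0 c0).
exists M => k /hM h; rewrite -mulrBr cabsM.
have := ler_wpM2l (ltW c0) h; rewrite mulrCA divff ?gt_eqF// mulr1.
by apply: le_trans; rewrite ler_wpM2r ?cabs_ge0// lerDl.
Qed.

Lemma ccvg_sum (I : Type) (r : seq I) (F : I -> nat -> R[i]) (l : I -> R[i]) :
  (forall i, ccvg (F i) (l i)) ->
  ccvg (fun N => \sum_(i <- r) F i N) (\sum_(i <- r) l i).
Proof.
move=> h; elim: r => [|i r IH].
  by rewrite big_nil; under [X in ccvg X]eq_fun do rewrite big_nil; exact: ccvg_cst.
by rewrite big_cons; under [X in ccvg X]eq_fun do rewrite big_cons; exact: ccvgD.
Qed.

Lemma ccvgB u v l m : ccvg u l -> ccvg v m -> ccvg (fun N => u N - v N) (l - m).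
Proof.
move=> hu /(ccvgZ (-1)) hv; have := ccvgD hu hv.
by rewrite mulN1r; under [X in ccvg X]eq_fun do rewrite mulN1r.
Qed.

Lemma ccvg_le u l (M : R) : ccvg u l -> (forall N, cabs (u N) <= M) -> cabs l <= M.
Proof.
move=> /ccvgP hu hM; apply/ler_addgt0Pr => e /hu[N /(_ N (leqnn _))].
move=> hN; rewrite -(subrK (u N) l) (le_trans (cabsD _ _))// addrC lerD//.
by rewrite cabsC.
Qed.

Lemma ccvg_unique u l m : ccvg u l -> ccvg u m -> l = m.
Proof.
move=> hl hm.
have h0 : ccvg (fun=> 0) (l - m).
  by move: (ccvgB hl hm); under eq_fun do rewrite subrr.
apply/subr0_eq/eqP; rewrite -cabs_eq0 eq_le cabs_ge0 andbT.
by apply: (ccvg_le h0) => N; rewrite cabs0.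
Qed.

Lemma ler_dist_cabs x y : `|cabs x - cabs y| <= cabs (x - y).
Proof.
rewrite ler_norml; apply/andP; split.
  by rewrite lerNl opprB lerBlDr cabsC -{1}(subrK x y) cabsD.
by rewrite lerBlDr -{1}(subrK y x) cabsD.
Qed.

Lemma ccvg_cabs u l : ccvg u l -> (fun N => cabs (u N)) @ \oo --> cabs l.
Proof.
move=> /ccvgP hu; apply/cvgrPdist_le => e /hu[N hN]; exists N => // k /hN /=.
by apply: le_trans; rewrite (cabsC (u k)) ler_dist_cabs.
Qed.

Lemma ccvg_ReIm u (a b : R) : (fun N => complex.Re (u N)) @ \oo --> a ->
  (fun N => complex.Im (u N)) @ \oo --> b -> ccvg u (a +i* b).
Proof.
move=> /cvgrPdist_le ha /cvgrPdist_le hb; apply/ccvgP => e e0.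
have [M _ hM] := ha _ (divr_gt0 e0 (ltr0n _ 2)).
have [N _ hN] := hb _ (divr_gt0 e0 (ltr0n _ 2)).
exists (maxn M N) => k; rewrite geq_max => /andP[/hM/= h1 /hN/= h2].
apply: le_trans (cabs_le_ReIm _) _; rewrite [leRHS](splitr e).
by move: h1 h2; case: (u k) => x y /= h1 h2; rewrite lerD// distrC.
Qed.

End modulus.

(** * Unconditional sums along an exhaustion *)

Section sums.
Context (R : realType) (V : choiceType).
Implicit Types (f g : V -> R) (F G : V -> R[i]).

Lemma sum_le_esum f (A : {fset V}) : (forall v, 0 <= f v) ->
  ((\sum_(v <- A) f v)%:E <= \esum_(v in setT) (f v)%:E)%E.
Proof.
move=> f0; apply: esum_ge; exists [set` A]; first by split.
by rewrite fsbig_finite//= set_fsetK sumEFin.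
Qed.

Lemma esum_approx f (M : R) : (M%:E < \esum_(v in setT) (f v)%:E)%E ->
  exists A : {fset V}, M < \sum_(v <- A) f v.
Proof.
move=> /ereal_sup_gt[_ [X [finX _] <-]]; rewrite fsbig_finite//= sumEFin lte_fin.
by exists (fset_set X).
Qed.

Lemma esum_le f (M : R) : (forall A : {fset V}, \sum_(v <- A) f v <= M) ->
  (\esum_(v in setT) (f v)%:E <= M%:E)%E.
Proof.
move=> h; rewrite leNgt; apply/negP => /esum_approx[A].
by rewrite ltNge h.
Qed.

Definition csummable F := (\esum_(v in setT) (cabs (F v))%:E < +oo)%E.

Definition exhaustion (B : nat -> {fset V}) :=
  (forall m p, (m <= p)%N -> (B m `<=` B p)%fset) /\ forall v, exists m, v \in B m.

Context (B : nat -> {fset V}) (exB : exhaustion B).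

Lemma exhaustion_fset (A : {fset V}) : exists m, (A `<=` B m)%fset.
Proof.
have [ndB coB] := exB.
elim/finSet_rect: A => A IH; have [->|[a aA]] := fset_0Vmem A.
  by exists 0; rewrite fsub0set.
have [m hm] := IH _ (fproperD1 aA); have [p hp] := coB a.
exists (maxn m p); rewrite -(fsetD1K aA) fsubUset fsub1set.
apply/andP; split; first by apply: (fsubsetP (ndB _ _ (leq_maxr m p))).
by apply: fsubset_trans hm (ndB _ _ (leq_maxl m p)).
Qed.

Lemma psum_le f (A A' : {fset V}) : (forall v, 0 <= f v) -> (A `<=` A')%fset ->
  \sum_(v <- A) f v <= \sum_(v <- A') f v.
Proof.
move=> f0 AA'.
rewrite [leLHS](_ : _ = \sum_(v <- A') if v \in A then f v else 0).
  by apply: ler_sum => v _; case: ifP.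
rewrite -(big_fset_incl _ AA') => [|v _ /negbTE -> //].
by apply: eq_big_seq => v ->.
Qed.

(** A finite set whose sum is close to the supremum is contained in the sets of the
    exhaustion from some rank on. *)
Lemma esum_cvg f : (forall v, 0 <= f v) ->
  (\esum_(v in setT) (f v)%:E < +oo)%E ->
  (fun m => \sum_(v <- B m) f v) @ \oo --> fine (\esum_(v in setT) (f v)%:E).
Proof.
move=> f0 foo; set S := esum _ _ in foo *.
have S0 : (0 <= S)%E by apply: esum_ge0 => v _; rewrite lee_fin.
have SE : (fine S)%:E = S by rewrite fineK// ge0_fin_numE.
apply/cvgrPdist_le => e e0.
have [|A hA] := @esum_approx f (fine S - e).
  by rewrite EFinB SE -/S lteBlDr// lteDl ?lte_fin// ge0_fin_numE.
have [m Am] := exhaustion_fset A; exists m => //= p /= mp.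
have h1 : \sum_(v <- B p) f v <= fine S.
  by rewrite -lee_fin SE; exact: sum_le_esum.
have h2 : \sum_(v <- A) f v <= \sum_(v <- B p) f v.
  by apply: psum_le => //; apply: fsubset_trans Am _; apply: (exB.1).
by rewrite ger0_norm; lra.
Qed.

Lemma funr_pos f : (fun v => (EFin \o f)^\+ v)%E = (fun v => (Num.max (f v) 0)%:E).
Proof. by apply/funext => v; rewrite funeposE/= -EFin_max. Qed.

Lemma funr_neg f : (fun v => (EFin \o f)^\- v)%E = (fun v => (Num.max (- f v) 0)%:E).
Proof. by apply/funext => v; rewrite funenegE/= -EFin_max. Qed.

Lemma real_sum_cvg f (b : V -> R) : (forall v, `|f v| <= b v) ->
  (\esum_(v in setT) (b v)%:E < +oo)%E ->
  (fun m => \sum_(v <- B m) f v) @ \oo --> real_sum f.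
Proof.
move=> fb boo.
have ppos : (\esum_(v in setT) (Num.max (f v) 0)%:E < +oo)%E.
  apply: le_lt_trans boo; apply: le_esum => v _; rewrite lee_fin.
  by rewrite ge_max (le_trans (ler_norm _) (fb v)) (le_trans _ (fb v)).
have pneg : (\esum_(v in setT) (Num.max (- f v) 0)%:E < +oo)%E.
  apply: le_lt_trans boo; apply: le_esum => v _; rewrite lee_fin.
  by rewrite ge_max (le_trans (ler_norm _)) ?normrN ?fb// (le_trans _ (fb v)).
rewrite /real_sum funr_pos funr_neg fineB ?ge0_fin_numE//; last 2 first.
- by apply: esum_ge0 => v _; rewrite lee_fin le_max lexx orbT.
- by apply: esum_ge0 => v _; rewrite lee_fin le_max lexx orbT.
have -> : (fun m => \sum_(v <- B m) f v) = (fun m =>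
    \sum_(v <- B m) Num.max (f v) 0 - \sum_(v <- B m) Num.max (- f v) 0).
  apply/funext => m; rewrite -sumrB; apply: eq_bigr => v _.
  by rewrite /Num.max; case: ifPn => h1; case: ifPn => h2; lra.
by apply: cvgB; apply: esum_cvg => // v; rewrite le_max lexx orbT.
Qed.

(** Absolutely summable families are limits of partial sums, and inherit linearity
    and bounds from them. *)
Lemma csum_cvg F : csummable F ->
  ccvg (fun m => \sum_(v <- B m) F v) (complex_sum F).
Proof.
move=> sF; apply: ccvg_ReIm.
- under eq_fun do rewrite raddf_sum.
  by apply: (real_sum_cvg _ sF) => v; exact: cabs_ge_Re.
- under eq_fun do rewrite raddf_sum.
  by apply: (real_sum_cvg _ sF) => v; exact: cabs_ge_Im.
Qed.

Lemma csummableD F G : csummable F -> csummable G ->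
  csummable (fun v => F v + G v).
Proof.
move=> sF sG; have : (\esum_(v in setT) ((cabs (F v))%:E + (cabs (G v))%:E) < +oo)%E.
  by rewrite esumD ?lte_add_pinfty// => v _; rewrite lee_fin cabs_ge0.
by apply: le_lt_trans; apply: le_esum => v _; rewrite -EFinD lee_fin cabsD.
Qed.

Lemma csummableP F : csummable F <->
  exists M, forall A : {fset V}, \sum_(v <- A) cabs (F v) <= M.
Proof.
split=> [sF|[M hM]]; last by apply: le_lt_trans (esum_le hM) (ltry _).
exists (fine (\esum_(v in setT) (cabs (F v))%:E)) => A.
rewrite -lee_fin fineK; last first.
  by rewrite ge0_fin_numE//; apply: esum_ge0 => v _; rewrite lee_fin cabs_ge0.
by apply: sum_le_esum => v; rewrite cabs_ge0.
Qed.

Lemma csummable_exh F (M : R) :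
  (forall m, \sum_(v <- B m) cabs (F v) <= M) -> csummable F.
Proof.
move=> hM; apply/csummableP; exists M => A.
have [m Am] := exhaustion_fset A; apply: le_trans (hM m).
by apply: psum_le => // v; rewrite cabs_ge0.
Qed.

Lemma csummable_le F G (c : R) : csummable F ->
  (forall v, cabs (G v) <= c * cabs (F v)) -> csummable G.
Proof.
move=> /csummableP[M hM] h; apply/csummableP; exists (`|c| * M) => A.
apply: le_trans (ler_wpM2l (normr_ge0 c) (hM A)); rewrite mulr_sumr.
apply: ler_sum => v _; apply: le_trans (h v) _.
by rewrite ler_wpM2r ?cabs_ge0 ?ler_norm.
Qed.

Lemma csummableZ (c : R[i]) F : csummable F -> csummable (fun v => c * F v).
Proof. by move=> /csummable_le; apply; move=> v; rewrite cabsM. Qed.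

Lemma csumD F G : csummable F -> csummable G ->
  complex_sum (fun v => F v + G v) = complex_sum F + complex_sum G.
Proof.
move=> sF sG; apply: ccvg_unique (csum_cvg (csummableD sF sG)) _.
under [X in ccvg X]eq_fun do rewrite big_split.
by apply: ccvgD; exact: csum_cvg.
Qed.

Lemma csumZ (c : R[i]) F : csummable F ->
  complex_sum (fun v => c * F v) = c * complex_sum F.
Proof.
move=> sF; apply: ccvg_unique (csum_cvg (csummableZ c sF)) _.
under [X in ccvg X]eq_fun do rewrite -mulr_sumr.
by apply: ccvgZ; exact: csum_cvg.
Qed.

Lemma csum_le F (M : R) : (forall m, \sum_(v <- B m) cabs (F v) <= M) ->
  cabs (complex_sum F) <= M.
Proof.
move=> hM; apply: (ccvg_le (csum_cvg (csummable_exh hM))) => m.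
exact: le_trans (cabs_sum _ _ _) (hM m).
Qed.

End sums.

(** * Multi-indices and monomials *)

Section multiindex.
Context (n : nat).

Definition boxmn N (g : {ffun 'I_n -> 'I_N}) : multinom n :=
  Multinom (mktuple (fun j => g j : nat)).

Lemma boxmnE N (g : {ffun 'I_n -> 'I_N}) j : boxmn g j = g j.
Proof. by rewrite /boxmn mnmE. Qed.

Lemma boxmn_inj N : injective (@boxmn N).
Proof.
move=> g h e; apply/ffunP => j; apply/val_inj.
by rewrite /= -!boxmnE e.
Qed.

Definition box N : {fset multinom n} := [fset boxmn g | g : {ffun 'I_n -> 'I_N}]%fset.

Lemma in_box N (u : multinom n) : (u \in box N) = [forall j, (u j < N)%N].
Proof.
apply/imfsetP/forallP => [[g _ ->] j|h]; first by rewrite boxmnE.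
exists [ffun j => Ordinal (h j)] => //.
by apply/mnmP => j; rewrite boxmnE ffunE.
Qed.

Lemma big_box (A : nmodType) N (F : multinom n -> A) :
  \sum_(u <- box N) F u = \sum_(g : {ffun 'I_n -> 'I_N}) F (boxmn g).
Proof.
by rewrite /box big_imfset/= ?big_enum// => g h _ _; exact: boxmn_inj.
Qed.

Lemma box_exhaustion : exhaustion box.
Proof.
split=> [m p mp|u].
  apply/fsubsetP => u; rewrite !in_box => /forallP h.
  by apply/forallP => j; apply: leq_trans (h j) mp.
exists (\max_j u j).+1; rewrite in_box; apply/forallP => j.
by rewrite ltnS leq_bigmax.
Qed.

Definition mon (A : comNzSemiRingType) (x : 'I_n -> A) (u : multinom n) : A :=
  \prod_(j < n) x j ^+ u j.

(** Sums of monomials over a box factor into one-variable sums; this is why boxes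
    are the exhaustion used for multi-indices. *)
Lemma sum_box_mon (A : comNzSemiRingType) (x : 'I_n -> A) N :
  \sum_(u <- box N) mon x u = \prod_(j < n) \sum_(k < N) x j ^+ k.
Proof.
rewrite big_box (bigA_distr_bigA (fun j (k : 'I_N) => x j ^+ k)).
by apply: eq_bigr => g _; apply: eq_bigr => j _; rewrite boxmnE.
Qed.

Lemma monM (A : comNzSemiRingType) (x y : 'I_n -> A) u :
  mon (fun j => x j * y j) u = mon x u * mon y u.
Proof. by rewrite /mon -big_split; apply: eq_bigr => j _; rewrite exprMn. Qed.

Lemma monD (A : comNzSemiRingType) (x : 'I_n -> A) u v :
  mon x (mnm_add u v) = mon x u * mon x v.
Proof. by rewrite /mon -big_split; apply: eq_bigr => j _; rewrite mnmDE exprD. Qed.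

Context (R : realType).
Implicit Types (r q : 'I_n -> R).

Lemma mon_ge0 r u : (forall j, 0 <= r j) -> 0 <= mon r u.
Proof. by move=> r0; apply: prodr_ge0 => j _; rewrite exprn_ge0. Qed.

Lemma mon_gt0 r u : (forall j, 0 < r j) -> 0 < mon r u.
Proof. by move=> r0; apply: prodr_gt0 => j _; rewrite exprn_gt0. Qed.

Lemma ler_mon r q u : (forall j, 0 <= r j <= q j) -> mon r u <= mon q u.
Proof.
move=> rq; apply: ler_prod => j _; have /andP[r0 h] := rq j.
by rewrite exprn_ge0// lerXn2r ?nnegrE//; apply: le_trans h.
Qed.

Lemma cabs_mon (z : 'I_n -> R[i]) u : cabs (mon z u) = mon (fun j => cabs (z j)) u.
Proof. by rewrite /mon cabs_prod; apply: eq_bigr => j _; rewrite cabsX. Qed.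

Lemma geometric_psum_le (q : R) N : 0 <= q < 1 ->
  \sum_(k < N) q ^+ k <= (1 - q)^-1.
Proof.
move=> /andP[q0 q1]; rewrite -[leRHS]mul1r ler_pdivlMr ?subr_gt0//.
rewrite mulrC -opprB mulNr -subrX1 opprB lerBlDr lerDl exprn_ge0//.
Qed.

Lemma sum_mon_le q N : (forall j, 0 <= q j < 1) ->
  \sum_(u <- box N) mon q u <= \prod_(j < n) (1 - q j)^-1.
Proof.
move=> hq; rewrite sum_box_mon; apply: ler_prod => j _.
rewrite geometric_psum_le// andbT sumr_ge0// => k _.
by rewrite exprn_ge0//; case/andP: (hq j).
Qed.

Lemma peval_mon (u : multinom n) (z : 'cV[R[i]]_n) :
  peval (mpolyX R[i] u) z = mon (fun j => z j 0) u.
Proof. by rewrite /peval mevalX. Qed.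

(** Abel's lemma: the terms are dominated by those of a product of geometric series
    of ratios [t j / rho j]. *)
Lemma power_series_bound (c : multinom n -> R[i]) (M : R) (rho t : 'I_n -> R) (z : 'I_n -> R[i]) :
  (forall j, 0 < rho j) -> (forall u, cabs (c u) * mon rho u <= M) ->
  (forall j, cabs (z j) <= t j < rho j) ->
  forall N, \sum_(u <- box N) cabs (c u * mon z u) <=
    M * \prod_(j < n) (1 - t j / rho j)^-1.
Proof.
move=> rho0 cM zt N.
have M0 : 0 <= M.
  by apply: le_trans (cM mnm0); rewrite mulr_ge0 ?cabs_ge0// ltW// mon_gt0.
have hq j : 0 <= t j / rho j < 1.
  have /andP[h1 h2] := zt j; rewrite divr_ge0 ?(ltW (rho0 j))//=; last first.
    exact: le_trans (cabs_ge0 _) h1.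
  by rewrite ltr_pdivrMr// mul1r.
apply: le_trans (ler_wpM2l M0 (sum_mon_le N hq)); rewrite mulr_sumr.
apply: ler_sum => u _; rewrite cabsM cabs_mon.
have -> : mon (fun j => cabs (z j)) u =
    mon rho u * mon (fun j => cabs (z j) / rho j) u.
  by rewrite -monM; apply: eq_bigr => j _; rewrite mulrC divfK ?gt_eqF.
rewrite mulrA; apply: ler_pM => //.
- by rewrite mulr_ge0 ?cabs_ge0// ltW// mon_gt0.
- by apply: mon_ge0 => j; rewrite divr_ge0 ?cabs_ge0// ltW.
apply: ler_mon => j; rewrite divr_ge0 ?cabs_ge0 ?(ltW (rho0 j))//=.
by rewrite ler_wpM2r// ?invr_ge0 ?(ltW (rho0 j))//; case/andP: (zt j).
Qed.

End multiindex.

(** * Complex differentiability in coordinates *)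

Section differentiability.
Context (R : realType) (n : nat).
Local Notation C := R[i].
Implicit Types (z h : 'cV[C]_n) (f : 'cV[C]_n -> C).

Definition vnorm h : R := complex.Re `|h|.

Lemma vnormE h : `|h| = (vnorm h)%:C.
Proof. by rewrite /vnorm RRe_real// normr_real. Qed.

Lemma vnorm_ge0 h : 0 <= vnorm h.
Proof. by rewrite -ler0c -vnormE. Qed.

Lemma vnorm_le h (s : R) : 0 <= s ->
  (vnorm h <= s) <-> (forall j, cabs (h j 0) <= s).
Proof.
move=> s0; have s0' : 0 <= s%:C :> C by rewrite ler0c.
rewrite -lecR -vnormE /Num.norm/= mx_normE.
rewrite (_ : s%:C = (NngNum s0')%:num)// num_le; split.
  move=> /bigmax_leP[_ h1] j; have := h1 (j, 0) isT.
  by rewrite -num_le/= cabsE lecR.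
move=> h1; apply/bigmax_leP; split; first by rewrite -num_le/=.
by move=> [j k] _; rewrite -num_le/= (ord1 k) cabsE lecR.
Qed.

Lemma cabs_le_vnorm h j : cabs (h j 0) <= vnorm h.
Proof. by move: j; apply/vnorm_le; rewrite ?vnorm_ge0. Qed.

Lemma nbhs_vnorm z (P : set 'cV[C]_n) : nbhs z P <->
  exists2 e : R, 0 < e & forall h, vnorm h < e -> P (z + h).
Proof.
split=> [/nbhs_ballP[e e0 he]|[e e0 he]].
  have eE : e = (complex.Re e)%:C by rewrite RRe_real// gtr0_real.
  exists (complex.Re e); first by rewrite -ltcR -eE.
  move=> h he'; apply: he; rewrite -ball_normE /ball_/= opprD addrA subrr.
  by rewrite sub0r normrN vnormE eE ltcR.
apply/nbhs_ballP; exists e%:C; first by rewrite /= ltcR.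
move=> y; rewrite -ball_normE /ball_/= distrC vnormE ltcR => /he.
by rewrite addrC subrK.
Qed.

Definition has_gradient f z (d : 'I_n -> C) := forall e : R, 0 < e ->
  exists2 r : R, 0 < r & forall h, vnorm h < r ->
    cabs (f (z + h) - f z - \sum_j d j * h j 0) <= e * vnorm h.

Definition dotmap (d : 'I_n -> C) h : C := \sum_j d j * h j 0.

Lemma dotmap_linear d : linear (dotmap d).
Proof.
move=> a x y; rewrite /dotmap scaler_sumr -big_split/=; apply: eq_bigr => j _.
by rewrite !mxE mulrDr; congr (_ + _); rewrite mulrCA.
Qed.

Lemma dotmap_continuous d : continuous (dotmap d).
Proof.
move=> z; apply: (@differentiable_continuous _ _ _ z (dotmap d)).
rewrite (_ : dotmap d = \sum_j (fun h : 'cV[C]_n => d j *: (h j 0 : C^o))).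
  by apply: differentiable_sum => j; apply: differentiableZ; exact: differentiable_coord.
by apply/funext => h; rewrite /dotmap fct_sumE.
Qed.

(** A linear map on [C ^ n] is given by its values on the basis vectors, so
    differentials can be replaced by vectors of partial derivatives. *)
Lemma differentiableP_gradient f z :
  differentiable (f : 'cV[C]_n -> C) z <-> exists d, has_gradient f z d.
Proof.
split=> [/diff_locallyP[_ fz]|[d hd]].
  exists (fun j => 'd f z (delta_mx j 0)) => e e0.
  have e0' : 0 < e%:C :> C by rewrite ltcR.
  move: fz => /eqaddoP/(_ _ e0')/nbhs_vnorm[r r0 hr].
  exists r => // h /hr; rewrite add0r /= vnormE -rmorphM/= -lecR -cabsE.
  rewrite -[_ h]/(f (h + z) - (f z + 'd f z h)) opprD addrA (addrC h z).
  rewrite (_ : 'd f z h = \sum_j 'd f z (delta_mx j 0) * h j 0)//.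
  rewrite {1}(matrix_sum_delta h) linear_sum; apply: eq_bigr => j _.
  by rewrite big_ord1 linearZ mulrC.
pose LF := GRing.isLinear.Build _ _ _ _ (dotmap d) (dotmap_linear d).
pose df : {linear 'cV[C]_n -> C} := HB.pack (dotmap d) LF.
have cdf : continuous df by exact: dotmap_continuous.
have := @diff_unique C 'cV[C]_n C f df z cdf.
match goal with |- (?P -> _) -> _ => suff e : P end.
  by move=> /(_ e) ef; apply/diff_locallyP; rewrite ef.
apply/eqaddoP => e e0; have eE : e = (complex.Re e)%:C.
    by rewrite RRe_real// gtr0_real.
  have {}e0 : 0 < complex.Re e by rewrite -ltcR -eE.
  have [r r0 hr] := hd _ e0; apply/nbhs_vnorm; exists r => // h /hr hh.
rewrite add0r vnormE eE -rmorphM cabsE lecR; move: hh; congr (cabs _ <= _).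
by rewrite -[RHS]/(f (h + z) - (f z + dotmap d h)) opprD addrA (addrC h z).
Qed.

End differentiability.

(** * Power series are complex differentiable *)

Section power_series.
Context (R : realType) (n : nat).
Local Notation C := R[i].
Implicit Types (z h : 'I_n -> C) (s : seq 'I_n).

(** Partial derivatives of [\prod_(j <- s) z j] by the product rule.  Monomials are
    treated as products along lists with repetitions (see [flat]), on which
    induction removes one factor at a time. *)
Fixpoint list_grad z s (i : 'I_n) : C :=
  if s is j :: s' then (i == j)%:R * \prod_(k <- s') z k + z j * list_grad z s' i
  else 0.

(** Expansion of [\prod (z j + h j)] to first order.  When [h] is at most [sigma]
    times a margin [t], the majorant [B] of the product on the enlarged polydisc
    controls the increment with a factor [sigma] and the remainder with a factor
    [sigma ^ 2].  The three bounds are proved together, since each feeds the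
    next. *)
Lemma prod_expansion z h (t sigma : R) s : 0 <= t -> 0 <= sigma <= 1 ->
  (forall j, cabs (h j) <= sigma * t) ->
  let B := \prod_(j <- s) (cabs (z j) + t) in
  [/\ cabs (\prod_(j <- s) (z j + h j) - \prod_(j <- s) z j) <= sigma * B,
      cabs (\prod_(j <- s) (z j + h j) - \prod_(j <- s) z j
        - \sum_i list_grad z s i * h i) <= sigma ^+ 2 * B &
      cabs (\prod_(j <- s) (z j + h j)) <= B].
Proof.
move=> t0 /andP[s0 s1] ht; elim: s => [|j s [IH1 IH2 IH3]] /=.
  rewrite !big_nil subrr big1 => [|i _]; last by rewrite mul0r.
  by rewrite subr0 cabs0 cabs1 !mulr1 sqr_ge0.
rewrite !big_cons.
set P := \prod_(j <- s) (z j + h j) in IH1 IH2 IH3 *.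
set p := \prod_(j <- s) z j in IH1 IH2 *.
set B := \prod_(j <- s) _ in IH1 IH2 IH3 *.
have B0 : 0 <= B by apply: prodr_ge0 => k _; rewrite addr_ge0 ?cabs_ge0.
have z0 := cabs_ge0 (z j); have h0 := cabs_ge0 (h j); have hj := ht j.
split.
- have -> : (z j + h j) * P - z j * p = z j * (P - p) + h j * P by ring.
  apply: le_trans (cabsD _ _) _; rewrite !cabsM.
  have H1 := ler_wpM2l z0 IH1.
  have H2 := ler_pM h0 (cabs_ge0 _) hj IH3.
  apply: le_trans (lerD H1 H2) _; rewrite le_eqVlt; apply/orP; left; apply/eqP; ring.
- have -> : \sum_i ((i == j)%:R * p + z j * list_grad z s i) * h i =
    h j * p + z j * \sum_i list_grad z s i * h i.
    under eq_bigr do rewrite mulrDl -mulrA.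
    rewrite big_split/= mulr_sumr; congr (_ + _); last first.
      by apply: eq_bigr => i _; rewrite mulrA.
    rewrite (bigD1 j)//= eqxx mul1r big1 ?addr0 1?mulrC// => i /negbTE ->.
    by rewrite mul0r.
  set L := \sum_i _ in IH2 *.
  have -> : (z j + h j) * P - z j * p - (h j * p + z j * L) =
    z j * (P - p - L) + h j * (P - p) by ring.
  apply: le_trans (cabsD _ _) _; rewrite !cabsM.
  have H1 := ler_wpM2l z0 IH2.
  have H2 := ler_pM h0 (cabs_ge0 _) hj IH1.
  apply: le_trans (lerD H1 H2) _; rewrite le_eqVlt; apply/orP; left; apply/eqP; ring.
- rewrite cabsM; apply: ler_pM => //; rewrite ?cabs_ge0//.
  apply: le_trans (cabsD _ _) _; rewrite lerD2l (le_trans hj)//.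
  by rewrite ler_piMl.
Qed.

Lemma list_grad_bound z (t : R) s i : 0 <= t ->
  cabs (list_grad z s i) * t <= \prod_(j <- s) (cabs (z j) + t).
Proof.
move=> t0; elim: s => [|j s IH] /=; first by rewrite cabs0 mul0r big_nil.
rewrite big_cons; set B := \prod_(j <- s) _ in IH *.
have pB : cabs (\prod_(k <- s) z k) <= B.
  rewrite cabs_prod; apply: ler_prod => k _.
  by rewrite cabs_ge0 lerDl.
have B0 : 0 <= B by apply: le_trans pB; exact: cabs_ge0.
apply: le_trans (ler_wpM2r t0 (cabsD _ _)) _; rewrite !cabsM mulrDl addrC.
rewrite -mulrA (mulrDl _ _ B) lerD ?ler_wpM2l ?cabs_ge0//.
rewrite mulrC ler_wpM2l// (le_trans _ pB)//.
by case: eqP; rewrite ?cabs1 ?mul1r// cabs0 mul0r cabs_ge0.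
Qed.

Definition flat (u : multinom n) : seq 'I_n :=
  flatten [seq nseq (u j) j | j <- enum 'I_n].

Lemma mon_flat (A : comNzSemiRingType) (x : 'I_n -> A) u :
  mon x u = \prod_(j <- flat u) x j.
Proof.
rewrite /flat big_flatten/= big_map big_enum/=; apply: eq_bigr => j _.
by rewrite big_nseq iter_mulr mulr1.
Qed.

(** The gradient of a power series is the termwise gradient: the expansion of
    monomials bounds the remainders of all terms by a convergent series. *)
Lemma power_series_gradient (c : multinom n -> C) (M : R) (rho : 'I_n -> R)
    (z : 'cV[C]_n) : (forall j, 0 < rho j) ->
  (forall u, cabs (c u) * mon rho u <= M) ->
  (forall j, cabs (z j 0) < rho j) ->
  exists d, has_gradient
    (fun w => complex_sum (fun u => c u * mon (fun j => w j 0) u)) z d.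
Proof.
move=> rho0 cM zrho.
have [t t0 tP] : exists2 t : R, 0 < t & forall j, cabs (z j 0) + t < rho j.
  exists (\big[Num.min/1]_j ((rho j - cabs (z j 0)) / 2)).
    by apply: lt_bigmin => // j _; rewrite divr_gt0// subr_gt0.
  move=> j; have : \big[Num.min/1]_j ((rho j - cabs (z j 0)) / 2) <=
    (rho j - cabs (z j 0)) / 2 by exact: bigmin_le_cond.
  have := zrho j; lra.
pose K := M * \prod_(j < n) (1 - (cabs (z j 0) + t) / rho j)^-1.
have sumB N : \sum_(u <- box n N) cabs (c u) *
    \prod_(j <- flat u) (cabs (z j 0) + t) <= K.
  have := @power_series_bound n R c M rho (fun j => cabs (z j 0) + t)
    (fun j => (cabs (z j 0) + t)%:C) rho0 cM _ N.
  move=> /(_ _)/(le_trans _); apply => [|j]; last first.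
    by rewrite tP cabs_real ger0_norm ?lexx// addr_ge0 ?cabs_ge0// ltW.
  apply: ler_sum => u _; rewrite cabsM ler_wpM2l ?cabs_ge0//.
  rewrite -mon_flat cabs_mon; apply: ler_mon => j.
  have h0 : 0 <= cabs (z j 0) + t by rewrite addr_ge0 ?cabs_ge0// ltW.
  by rewrite h0 cabs_real ler_norm.
have K0 : 0 <= K.
  apply: le_trans (sumB 0%N); apply: sumr_ge0 => u _.
  rewrite mulr_ge0 ?cabs_ge0//; apply: prodr_ge0 => j _.
  by rewrite addr_ge0 ?cabs_ge0// ltW.
pose g u i := list_grad (fun j => z j 0) (flat u) i.
have exB := box_exhaustion n.
have sg i : csummable (fun u => c u * g u i).
  apply: (csummable_exh exB (M := K / t)) => N.
  rewrite ler_pdivlMr// mulr_suml; apply: le_trans (sumB N).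
  apply: ler_sum => u _; rewrite cabsM -mulrA ler_wpM2l ?cabs_ge0//.
  exact: list_grad_bound (ltW t0).
have sz (w : 'cV[C]_n) : (forall j, cabs (w j 0) <= cabs (z j 0) + t) ->
    csummable (fun u => c u * mon (fun j => w j 0) u).
  move=> hw; apply: (csummable_exh exB (M := K)) => N.
  apply: le_trans (sumB N); apply: ler_sum => u _.
  rewrite cabsM ler_wpM2l ?cabs_ge0// cabs_mon -mon_flat; apply: ler_mon => j.
  by rewrite cabs_ge0 hw.
exists (fun i => complex_sum (fun u => c u * g u i)) => e e0.
exists (Num.min t (e * t ^+ 2 / (K + 1))).
  by rewrite lt_min t0 divr_gt0 ?mulr_gt0 ?exprn_gt0// ltr_wpDl.
move=> h; rewrite lt_min => /andP[ht hK].
set sigma := vnorm h / t.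
have sig0 : 0 <= sigma by rewrite divr_ge0 ?vnorm_ge0// ltW.
have sig1 : 0 <= sigma <= 1 by rewrite sig0 ler_pdivrMr ?mul1r ?ltW.
have hsig j : cabs (h j 0) <= sigma * t.
  by rewrite divfK ?gt_eqF// cabs_le_vnorm.
have cv1 : ccvg (fun N => \sum_(u <- box n N) c u * mon (fun j => (z + h) j 0) u)
    (complex_sum (fun u => c u * mon (fun j => (z + h) j 0) u)).
  apply: csum_cvg => //; apply: sz => j; rewrite mxE.
  apply: le_trans (cabsD _ _) _; rewrite lerD2l.
  by apply: le_trans (cabs_le_vnorm _ _) (ltW ht).
have cv2 : ccvg (fun N => \sum_(u <- box n N) c u * mon (fun j => z j 0) u)
    (complex_sum (fun u => c u * mon (fun j => z j 0) u)).
  by apply: csum_cvg => //; apply: sz => j; rewrite lerDl ltW.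
have cv3 i : ccvg (fun N => h i 0 * \sum_(u <- box n N) c u * g u i)
    (complex_sum (fun u => c u * g u i) * h i 0).
  by rewrite mulrC; apply: ccvgZ; exact: csum_cvg.
have cv := ccvgB (ccvgB cv1 cv2) (ccvg_sum (index_enum 'I_n) cv3).
have bnd : cabs (complex_sum (fun u => c u * mon (fun j => (z + h) j 0) u)
    - complex_sum (fun u => c u * mon (fun j => z j 0) u)
    - \sum_j complex_sum (fun u => c u * g u j) * h j 0) <= sigma ^+ 2 * K.
  apply: (ccvg_le cv) => N; under [X in _ - X]eq_bigr do rewrite mulr_sumr.
  rewrite exchange_big/= -!sumrB.
  apply: le_trans (cabs_sum _ _ _) _.
  apply: le_trans (ler_wpM2l (sqr_ge0 sigma) (sumB N)); rewrite mulr_sumr.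
  apply: ler_sum => u _.
  rewrite (_ : _ - _ = c u * (mon (fun j => (z + h) j 0) u
    - mon (fun j => z j 0) u - \sum_i g u i * h i 0)); last first.
    rewrite !mulrBr mulr_sumr; congr (_ - _); apply: eq_bigr => i _.
    by rewrite mulrC mulrA.
  rewrite cabsM mulrCA ler_wpM2l ?cabs_ge0//.
  have [_ + _] := @prod_expansion (fun j => z j 0) (fun j => h j 0) t sigma
    (flat u) (ltW t0) sig1 hsig.
  rewrite !mon_flat; congr (cabs (_ - _ - _) <= _).
  by apply: eq_bigr => j _; rewrite mxE.
apply: le_trans bnd _; rewrite /sigma.
have v0 := vnorm_ge0 h.
have -> : (vnorm h / t) ^+ 2 * K = vnorm h * K / t ^+ 2 * vnorm h.
  by field; rewrite gt_eqF.
apply: ler_wpM2r => //; rewrite ler_pdivrMr ?exprn_gt0//.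
have K1 : 0 < K + 1 by rewrite ltr_wpDl.
move: hK; rewrite ltr_pdivlMr// => /ltW; apply: le_trans.
by rewrite ler_wpM2l// lerDl.
Qed.

End power_series.

(** * The unit circle *)

Section circle.
Context (R : realType).
Local Notation C := R[i].

Definition cis (x : R) : C := cos x +i* sin x.

Lemma cisD x y : cis (x + y) = cis x * cis y.
Proof. by apply/eqP; rewrite eq_complex/= cosD sinD (addrC (sin x * _)) !eqxx. Qed.

Lemma cis0 : cis 0 = 1.
Proof. by rewrite /cis cos0 sin0. Qed.

Lemma cabs_cis x : cabs (cis x) = 1.
Proof. by rewrite /cabs normc_def/= cos2Dsin2 sqrtr1. Qed.

Lemma cis2pi : cis (pi *+ 2) = 1.
Proof. by rewrite /cis cos2pi sin2pi. Qed.

Lemma cisMn x k : cis (x *+ k) = cis x ^+ k.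
Proof. by elim: k => [|k IH]; rewrite ?mulr0n ?cis0 ?expr0// mulrS cisD IH exprS. Qed.

Lemma cis_neq1 x : 0 < x < pi *+ 2 -> cis x != 1.
Proof.
move=> /andP[x0 x2]; apply/negP => /eqP[cx _].
have : 0 < sin (x / 2).
  apply: sin_gt0_pi; rewrite divr_gt0//= ltr_pdivrMr//.
  by rewrite mulr_natr.
move: cx; rewrite {1}(splitr x) cosD -!expr2 => cx s0.
have := cos2Dsin2 (x / 2); have : 0 < sin (x / 2) ^+ 2 by rewrite exprn_gt0.
by move: cx; set c := cos _ ^+ 2; set s := sin _ ^+ 2; lra.
Qed.

Lemma sin_lip (a b : R) : `|sin a - sin b| <= `|a - b|.
Proof.
wlog ab : a b / a < b.
  move=> H; have [/H//|/H|->] := ltgtP a b; last by rewrite !subrr.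
  by rewrite (distrC (sin a)) (distrC a).
have [c _] := @MVT R sin cos a b ab (fun x _ => is_derive_sin x)
  (continuous_subspaceT (@continuous_sin R)).
rewrite (distrC (sin a)) (distrC a) => ->.
by rewrite normrM ler_piMl// ler_norml cos_geN1 cos_le1.
Qed.

Lemma cos_lip (a b : R) : `|cos a - cos b| <= `|a - b|.
Proof.
wlog ab : a b / a < b.
  move=> H; have [/H//|/H|->] := ltgtP a b; last by rewrite !subrr.
  by rewrite (distrC (cos a)) (distrC a).
have [c _] := @MVT R cos (fun x => - sin x) a b ab (fun x _ => is_derive_cos x)
  (continuous_subspaceT (@continuous_cos R)).
rewrite (distrC (cos a)) (distrC a) => ->.
by rewrite normrM normrN ler_piMl// ler_norml sin_geN1 sin_le1.
Qed.

Lemma cis_lip a b : cabs (cis a - cis b) <= 2 * `|a - b|.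
Proof.
apply: le_trans (cabs_le_ReIm _) _; rewrite mulrDl mul1r.
by rewrite /cis/= lerD ?cos_lip ?sin_lip.
Qed.

Lemma cis_diff h : cabs (cis h - 1 - 'i * h%:C) <= 2 * h ^+ 2.
Proof.
have key (f df : R -> R) : (forall x : R, is_derive x 1 f (df x)) ->
    continuous f -> (forall x, `|df x - df 0| <= `|x|) ->
    `|f h - f 0 - df 0 * h| <= h ^+ 2.
  move=> fd fc dlip.
  have [c ch ->] : exists2 c, `|c| <= `|h| & f h - f 0 = df c * h.
    have [h0|h0|->] := ltgtP h 0; last by exists 0; rewrite // !subrr mulr0.
    - have [c /[!in_itv]/= /andP[c1 c2] e] :=
        @MVT R f df h 0 h0 (fun x _ => fd x) (continuous_subspaceT fc).
      by exists c; [rewrite !ltr0_norm// lerN2 ltW|rewrite -opprB e sub0r mulrN opprK].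
    - have [c /[!in_itv]/= /andP[c1 c2] e] :=
        @MVT R f df 0 h h0 (fun x _ => fd x) (continuous_subspaceT fc).
      by exists c; [rewrite !gtr0_norm// ltW|rewrite e subr0].
  rewrite -mulrBl normrM -real_normK ?num_real// expr2 ler_wpM2r//.
  exact: le_trans (dlip c) ch.
apply: le_trans (cabs_le_ReIm _) _; rewrite mulrDl mul1r /=.
apply: lerD.
  have := key cos (fun x => - sin x) (fun x => is_derive_cos x) (@continuous_cos R).
  rewrite cos0 sin0 !(oppr0, mul0r, mulr0, mul1r, subr0, addr0, add0r); apply => x.
  by have := sin_lip x 0; rewrite addr0 sin0 !subr0 normrN.
have := key sin cos (fun x => is_derive_sin x) (@continuous_sin R).
rewrite cos0 sin0 !(mul0r, mul1r, add0r) !subr0; apply => x.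
by have := cos_lip x 0; rewrite cos0 subr0.
Qed.

(** Riemann sum for the mean over the circle.  The number of nodes is a power of two
    so that these sums are compatible with bisection. *)
Definition rootavg m (G : C -> C) : C :=
  ((2 ^ m)%:R)^-1 * \sum_(j < 2 ^ m) G (cis (pi *+ 2 * (j%:R / (2 ^ m)%:R))).

Lemma rootavgD m G H : rootavg m (fun x => G x + H x) = rootavg m G + rootavg m H.
Proof. by rewrite /rootavg big_split mulrDr. Qed.

Lemma rootavgZ m c G : rootavg m (fun x => c * G x) = c * rootavg m G.
Proof. by rewrite /rootavg -mulr_sumr mulrCA. Qed.

Lemma rootavg_le m G M : (forall x, cabs x = 1 -> cabs (G x) <= M) ->
  cabs (rootavg m G) <= M.
Proof.
move=> h; rewrite /rootavg cabsM cabsV -(rmorph_nat (real_complex R)) cabs_real.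
rewrite normr_nat ler_pdivrMl ?ltr0n ?expn_gt0//.
apply: le_trans (cabs_sum _ _ _) _.
rewrite [leRHS](_ : _ = \sum_(j < 2 ^ m) M); last first.
  by rewrite sumr_const card_ord mulr_natl.
by apply: ler_sum => j _; exact: h (cabs_cis _).
Qed.

Lemma eq_rootavg m G H : (forall x, cabs x = 1 -> x ^+ (2 ^ m) = 1 -> G x = H x) ->
  rootavg m G = rootavg m H.
Proof.
move=> h; rewrite /rootavg; congr (_ * _); apply: eq_bigr => j _; apply: h.
  exact: cabs_cis.
rewrite -cisMn -(mulr_natr (_ * _)) -mulrA divfK ?pnatr_eq0 -?lt0n ?expn_gt0//.
by rewrite mulr_natr cisMn cis2pi expr1n.
Qed.

Lemma rootavg_expr m k : (0 < k < 2 ^ m)%N -> rootavg m (fun x => x^-1 ^+ k) = 0.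
Proof.
move=> /andP[k0 kN]; set N := (2 ^ m)%N in kN.
have N0 : (N%:R : R) != 0 by rewrite pnatr_eq0 -lt0n expn_gt0.
have Ngt0 : 0 < N%:R :> R by rewrite lt0r N0 ler0n.
set w := cis (pi *+ 2 / N%:R).
have wE (j : nat) : cis (pi *+ 2 * (j%:R / N%:R)) = w ^+ j.
  by rewrite -cisMn -(mulr_natr (_ / _)); congr cis; rewrite mulrCA mulrC.
have wN : w ^+ N = 1 by rewrite -wE divff// mulr1 cis2pi.
have wk : w ^+ k != 1.
  have p0 : 0 < pi *+ 2 :> R by rewrite pmulrn_lgt0 ?pi_gt0.
  rewrite -wE; apply: cis_neq1; apply/andP; split.
    by rewrite mulr_gt0// divr_gt0// ltr0n.
  by rewrite -[ltRHS]mulr1 ltr_pM2l// ltr_pdivrMr// mul1r ltr_nat.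
rewrite /rootavg -/N; under eq_bigr => j _ do rewrite wE exprVn -exprM mulnC exprM -exprVn.
apply/eqP; rewrite mulf_eq0; apply/orP; right.
have := subrX1 (w ^+ k)^-1 N; rewrite exprVn -exprM mulnC exprM wN expr1n invr1 subrr.
move=> /esym/eqP; rewrite mulf_eq0 => /orP[|//].
by rewrite subr_eq0 invr_eq1 (negbTE wk).
Qed.

Lemma rootavg1 m : rootavg m (fun=> 1) = 1.
Proof.
by rewrite /rootavg sumr_const card_ord mulVf// pnatr_eq0 -lt0n expn_gt0.
Qed.

Lemma rootavg_sum m (N : nat) (G : nat -> C -> C) :
  rootavg m (fun x => \sum_(k < N) G k x) = \sum_(k < N) rootavg m (G k).
Proof. by rewrite /rootavg exchange_big/= mulr_sumr. Qed.

(** For a [2 ^ m]-th root of unity [x], the geometric sum of [2 ^ m] powers of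
    [b / x] is [(1 - b ^ (2 ^ m)) / (1 - b / x)], and all its terms but the first
    have mean zero. *)
Lemma rootavg_geometric m b : cabs b < 1 ->
  (1 - b ^+ (2 ^ m)) * rootavg m (fun x => (1 - b / x)^-1) = 1.
Proof.
move=> b1; rewrite -rootavgZ.
rewrite (@eq_rootavg _ _ (fun x => \sum_(k < 2 ^ m) b ^+ k * x^-1 ^+ k)).
  rewrite (rootavg_sum m _ (fun k x => b ^+ k * x^-1 ^+ k)).
  under eq_bigr do rewrite rootavgZ.
  have N0 : (0 < 2 ^ m)%N by rewrite expn_gt0.
  rewrite (bigD1 (Ordinal N0))//= big1 => [|k k0].
    by rewrite addr0 expr0 mul1r -[RHS](rootavg1 m).
  rewrite rootavg_expr ?mulr0// ltn_ord andbT lt0n.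
  by apply: contraNneq k0 => k0; apply/eqP/val_inj.
move=> x x1 xN.
have x0 : x != 0 by rewrite -cabs_eq0 x1 oner_neq0.
have bx : 1 - b / x != 0.
  rewrite subr_eq0; apply: contraTneq b1 => /(congr1 (@cabs R)).
  by rewrite cabs1 cabsM cabsV x1 invr1 mulr1 => <-; rewrite ltxx.
apply: (mulIf bx); rewrite mulfVK//.
under eq_bigr do rewrite -exprMn.
have := subrX1 (b / x) (2 ^ m); rewrite exprMn exprVn xN invr1 mulr1.
by move=> /(congr1 -%R); rewrite opprB -mulNr opprB mulrC => ->.
Qed.

End circle.

(** * Cauchy's formula through Riemann sums *)

Section bisection.
Context (R : realType).

(** Nested rectangles: the lower left corners of the successive quarters increase in
    each coordinate, and their supremum belongs to all the rectangles. *)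
Lemma bisection (P : nat -> R -> R -> Prop) (W H x0 y0 : R) :
  0 <= W -> 0 <= H -> P 0%N x0 y0 ->
  (forall k x y, P k x y -> exists i j : bool,
    P k.+1 (x + i%:R * (W / 2 ^+ k.+1)) (y + j%:R * (H / 2 ^+ k.+1))) ->
  exists x1 y1, forall k, exists x y,
    [/\ P k x y, x <= x1 <= x + W / 2 ^+ k & y <= y1 <= y + H / 2 ^+ k].
Proof.
move=> W0 H0 P0 step.
pose St := {q : nat * (R * R) | P q.1 q.2.1 q.2.2}.
have nxt (q : St) : {q' : St | (sval q').1 = (sval q).1.+1 /\
   ((sval q).2.1 <= (sval q').2.1 <= (sval q).2.1 + W / 2 ^+ (sval q).1.+1) /\
   ((sval q).2.2 <= (sval q').2.2 <= (sval q).2.2 + H / 2 ^+ (sval q).1.+1)}.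
  apply: cid; case: q => -[k [x y]] /= Pq.
  have [i [j Pij]] := step _ _ _ Pq.
  exists (exist _ (k.+1, (_, _)) Pij) => /=.
  have hW : 0 <= W / 2 ^+ k.+1 by rewrite divr_ge0 ?exprn_ge0.
  have hH : 0 <= H / 2 ^+ k.+1 by rewrite divr_ge0 ?exprn_ge0.
  by case: i {Pij}; case: j; rewrite ?mul0r ?mul1r; split => //; split; lra.
pose s k := iter k (fun q => sval (nxt q)) (exist _ (0%N, (x0, y0)) P0 : St).
pose X k := (sval (s k)).2.1; pose Y k := (sval (s k)).2.2.
have sk k : (sval (s k)).1 = k.
  by elim: k => [//|k IH]; rewrite /s iterS -/(s k); have [-> _] := svalP (nxt (s k)); rewrite IH.
have Xk k : X k <= X k.+1 <= X k + W / 2 ^+ k.+1.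
  rewrite /X [s k.+1]iterS -/(s k); case: (nxt (s k)) => q' /= [_ [+ _]].
  by rewrite sk.
have Yk k : Y k <= Y k.+1 <= Y k + H / 2 ^+ k.+1.
  rewrite /Y [s k.+1]iterS -/(s k); case: (nxt (s k)) => q' /= [_ [_]].
  by rewrite sk.
have lim_pt (Z : nat -> R) (L : R) : 0 <= L ->
    (forall k, Z k <= Z k.+1 <= Z k + L / 2 ^+ k.+1) ->
    exists z, forall k, Z k <= z <= Z k + L / 2 ^+ k.
  move=> L0 Zk.
  have Zmono k p : Z k <= Z (k + p)%N.
    elim: p => [|p IH]; first by rewrite addn0.
    by rewrite addnS (le_trans IH)//; case/andP: (Zk (k + p)%N).
  have half k : L / 2 ^+ k = L / 2 ^+ k.+1 + L / 2 ^+ k.+1.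
    by rewrite exprS; field; rewrite expf_neq0.
  have Zub k p : Z (k + p)%N + L / 2 ^+ (k + p) <= Z k + L / 2 ^+ k.
    elim: p => [|p IH]; first by rewrite addn0.
    apply: le_trans IH; rewrite addnS (half (k + p)%N).
    by case/andP: (Zk (k + p)%N) => _ h; lra.
  have pos k : 0 <= L / 2 ^+ k by rewrite divr_ge0 ?exprn_ge0.
  have ub k p : Z p <= Z k + L / 2 ^+ k.
    have [pk|kp] := leqP p k.
      apply: (le_trans (y := Z k)); last by rewrite lerDl.
      by rewrite -(subnKC pk).
    have := Zub k (p - k)%N; rewrite subnKC ?(ltnW kp)//.
    by apply: le_trans; rewrite lerDl.
  exists (sup (range Z)) => k; apply/andP; split.
    apply: sup_upper_bound; last by exists k.
    split; first by exists (Z 0%N), 0%N.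
    by exists (Z 0%N + L / 2 ^+ 0) => _ [p _ <-].
  apply: ge_sup; first by exists (Z 0%N), 0%N.
  by move=> _ [p _ <-].
have [x1 hx] := lim_pt X W W0 Xk; have [y1 hy] := lim_pt Y H H0 Yk.
exists x1, y1 => k; exists (X k), (Y k); split => //.
by have := svalP (s k); rewrite sk.
Qed.

End bisection.

Section riemann_sums.
Context (R : realType).
Local Notation C := R[i].
Implicit Types (F : R -> C) (P Q : R -> R -> C).

(** Integrals are replaced by their Riemann sums and equalities of integrals by
    limits, so that complex differentiability is all that is asked of the
    integrands. *)
Definition rsum m F (a L : R) : C :=
  (L / (2 ^ m)%:R)%:C * \sum_(j < 2 ^ m) F (a + L * (j%:R / (2 ^ m)%:R)).

Lemma rsum_split m F a L :
  rsum m.+1 F a L = rsum m F a (L / 2) + rsum m F (a + L / 2) (L / 2).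
Proof.
have N0 : ((2 ^ m)%:R : R) != 0 by rewrite pnatr_eq0 -lt0n expn_gt0.
have N2 : (2 ^ m)%:R + (2 ^ m)%:R != 0 :> R by rewrite -mulr2n mulrn_eq0.
rewrite /rsum (_ : L / (2 ^ m.+1)%:R = L / 2 / (2 ^ m)%:R); last first.
  by rewrite expnS natrM; field.
rewrite -mulrDr; congr (_ * _).
rewrite expnS mul2n -addnn big_split_ord/=; congr (_ + _).
  apply: eq_bigr => j _; congr F; rewrite natrD; move: ((2 ^ m)%:R) N0 N2 => N N0 N2.
  by field; rewrite N0 N2.
apply: eq_bigr => j _; congr F; rewrite /= !natrD; move: ((2 ^ m)%:R) N0 N2 => N N0 N2.
by field; rewrite N0 N2.
Qed.

Lemma rsumD m F G a L : rsum m (fun x => F x + G x) a L = rsum m F a L + rsum m G a L.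
Proof. by rewrite /rsum big_split mulrDr. Qed.

Lemma rsumZ m c F a L : rsum m (fun x => c * F x) a L = c * rsum m F a L.
Proof. by rewrite /rsum -mulr_sumr mulrCA. Qed.

Lemma eq_rsum m F G a L : 0 <= L -> (forall x, a <= x <= a + L -> F x = G x) ->
  rsum m F a L = rsum m G a L.
Proof.
move=> L0 FG; congr (_ * _); apply: eq_bigr => j _; apply: FG.
have N0 : 0 < (2 ^ m)%:R :> R by rewrite ltr0n expn_gt0.
rewrite lerDl mulr_ge0 ?divr_ge0 ?ler0n//= lerD2l ler_piMr//.
by rewrite ler_pdivrMr// mul1r ler_nat ltnW.
Qed.

Lemma rsum_cst m c a L : rsum m (fun=> c) a L = L%:C * c.
Proof.
have N0 : ((2 ^ m)%:R : R) != 0 by rewrite pnatr_eq0 -lt0n expn_gt0.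
rewrite /rsum sumr_const card_ord -(mulr_natl c) mulrA; congr (_ * _).
by rewrite -(rmorph_nat (real_complex R)) -rmorphM/= divfK.
Qed.

Lemma rsum_le m F a L M : 0 <= L -> (forall x, a <= x <= a + L -> cabs (F x) <= M) ->
  cabs (rsum m F a L) <= L * M.
Proof.
move=> L0 FM; have N0 : 0 < (2 ^ m)%:R :> R by rewrite ltr0n expn_gt0.
rewrite /rsum cabsM cabs_real ger0_norm ?divr_ge0 ?ler0n//.
rewrite -mulrA ler_wpM2l// ler_pdivrMl//.
apply: le_trans (cabs_sum _ _ _) _.
rewrite [leRHS](_ : _ = \sum_(j < 2 ^ m) M); last first.
  by rewrite sumr_const card_ord mulr_natl.
apply: ler_sum => j _; apply: FM.
rewrite lerDl mulr_ge0 ?divr_ge0 ?ler0n//= lerD2l ler_piMr//.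
by rewrite ler_pdivrMr// mul1r ler_nat ltnW.
Qed.

(** Riemann sum for the integral of the form [P ds + Q dt] along the boundary of
    the rectangle [`[x, x + W] `*` `[y, y + H]]. *)
Definition contour m P Q (x y W H : R) : C :=
  rsum m (P ^~ y) x W - rsum m (P ^~ (y + H)) x W
  + rsum m (Q (x + W)) y H - rsum m (Q x) y H.

Lemma contour_split m P Q x y W H :
  contour m.+1 P Q x y W H =
  contour m P Q x y (W / 2) (H / 2) + contour m P Q (x + W / 2) y (W / 2) (H / 2)
  + (contour m P Q x (y + H / 2) (W / 2) (H / 2)
     + contour m P Q (x + W / 2) (y + H / 2) (W / 2) (H / 2)).
Proof.
have hW : x + W / 2 + W / 2 = x + W by field.
have hH : y + H / 2 + H / 2 = y + H by field.
by rewrite /contour !rsum_split hW hH; ring.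
Qed.

(** Goursat's argument: if the contour sums do not become small, neither do those
    of some quarter, relative to its area; at the limit point of the bisection this
    contradicts the local estimate. *)
Lemma goursat P Q (W H x0 y0 : R) : 0 <= W -> 0 <= H ->
  (forall x1 y1 : R, x0 <= x1 <= x0 + W -> y0 <= y1 <= y0 + H ->
   forall e : R, 0 < e -> exists2 k0 : nat, True & forall k, (k0 <= k)%N ->
    forall x y, x0 <= x -> x + W / 2 ^+ k <= x0 + W ->
      y0 <= y -> y + H / 2 ^+ k <= y0 + H ->
      x <= x1 <= x + W / 2 ^+ k -> y <= y1 <= y + H / 2 ^+ k ->
      exists m0, forall m, (m0 <= m)%N ->
        cabs (contour m P Q x y (W / 2 ^+ k) (H / 2 ^+ k)) <= e / 4 ^+ k) ->
  ccvg (fun m => contour m P Q x0 y0 W H) 0.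
Proof.
move=> W0 H0 loc; apply/ccvgP => e e0; apply: contrapT => /forallNP bad.
pose Bad k x y := [/\ x0 <= x, x + W / 2 ^+ k <= x0 + W,
  y0 <= y /\ y + H / 2 ^+ k <= y0 + H & forall M, exists2 m, (M <= m)%N &
    e / 4 ^+ k < cabs (contour m P Q x y (W / 2 ^+ k) (H / 2 ^+ k))].
have Bad0 : Bad 0%N x0 y0.
  rewrite /Bad !expr0 !divr1; split => // M.
  have /existsNP[m /not_implyP[Mm /negP]] := bad M.
  by rewrite -ltNge subr0 => h; exists m.
have step k x y : Bad k x y -> exists i j : bool,
    Bad k.+1 (x + i%:R * (W / 2 ^+ k.+1)) (y + j%:R * (H / 2 ^+ k.+1)).
  move=> [xx0 xW [yy0 yH] often]; apply: contrapT => no.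
  set W' := W / 2 ^+ k.+1 in no *; set H' := H / 2 ^+ k.+1 in no *.
  have eW : W / 2 ^+ k / 2 = W' by rewrite /W' exprS; field; rewrite expf_neq0.
  have eH : H / 2 ^+ k / 2 = H' by rewrite /H' exprS; field; rewrite expf_neq0.
  have W'0 : 0 <= W' by rewrite divr_ge0 ?exprn_ge0.
  have H'0 : 0 <= H' by rewrite divr_ge0 ?exprn_ge0.
  have good (i j : bool) : exists M, forall m, (M <= m)%N ->
      cabs (contour m P Q (x + i%:R * W') (y + j%:R * H') W' H') <= e / 4 ^+ k.+1.
    apply: contrapT => /forallNP nM; apply: no; exists i, j; split.
    - by rewrite (le_trans xx0)// lerDl mulr_ge0.
    - apply: le_trans xW; rewrite -/W' -addrA lerD2l.
      by case: i {nM}; rewrite ?mul1r ?mul0r; lra.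
    - split; first by rewrite (le_trans yy0)// lerDl mulr_ge0.
      apply: le_trans yH; rewrite -/H' -addrA lerD2l.
      by case: j {nM}; rewrite ?mul1r ?mul0r; lra.
    - move=> M; have /existsNP[m /not_implyP[Mm /negP]] := nM M.
      by rewrite -ltNge => h; exists m.
  have [M1 h1] := good false false; have [M2 h2] := good true false.
  have [M3 h3] := good false true; have [M4 h4] := good true true.
  have [[//|m]] := often (maxn (maxn M1 M2) (maxn M3 M4)).+1.
  rewrite ltnS !geq_max => /andP[/andP[m1 m2] /andP[m3 m4]].
  move: (h1 m m1) (h2 m m2) (h3 m m3) (h4 m m4).
  rewrite contour_split eW eH !mul1r !mul0r !addr0.
  set a := contour _ _ _ _ _ _ _; set b := contour _ _ _ _ _ _ _.
  set c := contour _ _ _ _ _ _ _; set d := contour _ _ _ _ _ _ _ => ha hb hc hd.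
  have := cabsD (a + b) (c + d); have := cabsD a b; have := cabsD c d.
  have -> : e / 4 ^+ k = 4 * (e / 4 ^+ k.+1) by rewrite exprS; field; rewrite expf_neq0.
  lra.
have [x1 [y1 pt]] := bisection W0 H0 Bad0 step.
have [x1P y1P] : x0 <= x1 <= x0 + W /\ y0 <= y1 <= y0 + H.
  have [x [y [[]]]] := pt 0%N; rewrite expr0 !divr1 => ? ? [? ?] _ ? ?.
  by split; lra.
have [k0 _ hk] := loc x1 y1 x1P y1P (e / 2) (divr_gt0 e0 (ltr0n _ 2)).
have [x [y [[xx0 xW [yy0 yH] often] hx hy]]] := pt k0.
have [m0 hm0] := hk k0 (leqnn _) x y xx0 xW yy0 yH hx hy.
have [m /hm0 h] := often m0; rewrite ltNge => /negP; apply; apply: le_trans h _.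
by rewrite ler_pM2r ?invr_gt0 ?exprn_gt0//; lra.
Qed.

End riemann_sums.

Section contours.
Context (R : realType).
Local Notation C := R[i].
Implicit Types (P Q : R -> R -> C).

Lemma contourD m P Q P' Q' x y W H :
  contour m (fun s t => P s t + P' s t) (fun s t => Q s t + Q' s t) x y W H =
  contour m P Q x y W H + contour m P' Q' x y W H.
Proof. by rewrite /contour !rsumD; ring. Qed.

Lemma contourZ m c P Q x y W H :
  contour m (fun s t => c * P s t) (fun s t => c * Q s t) x y W H =
  c * contour m P Q x y W H.
Proof. by rewrite /contour !rsumZ; ring. Qed.

Lemma eq_contour m P Q P' Q' x y W H : 0 <= W -> 0 <= H ->
  (forall s t, x <= s <= x + W -> y <= t <= y + H ->
     P s t = P' s t /\ Q s t = Q' s t) ->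
  contour m P Q x y W H = contour m P' Q' x y W H.
Proof.
move=> W0 H0 e; rewrite /contour; congr (_ - _ + _ - _).
- by apply: eq_rsum => // s hs; apply: (e _ _ hs _).1; lra.
- by apply: eq_rsum => // s hs; apply: (e _ _ hs _).1; lra.
- by apply: eq_rsum => // t ht; apply: (e _ _ _ ht).2; lra.
- by apply: eq_rsum => // t ht; apply: (e _ _ _ ht).2; lra.
Qed.

Lemma contour_le m P Q x y W H (p q : R) : 0 <= W -> 0 <= H ->
  (forall s t, x <= s <= x + W -> y <= t <= y + H ->
     cabs (P s t) <= p /\ cabs (Q s t) <= q) ->
  cabs (contour m P Q x y W H) <= 2 * (W * p) + 2 * (H * q).
Proof.
move=> W0 H0 e; rewrite /contour.
have h1 : cabs (rsum m (P ^~ y) x W) <= W * p.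
  by apply: rsum_le => // s hs; apply: (e _ _ hs _).1; lra.
have h2 : cabs (rsum m (P ^~ (y + H)) x W) <= W * p.
  by apply: rsum_le => // s hs; apply: (e _ _ hs _).1; lra.
have h3 : cabs (rsum m (Q (x + W)) y H) <= H * q.
  by apply: rsum_le => // t ht; apply: (e _ _ _ ht).2; lra.
have h4 : cabs (rsum m (Q x) y H) <= H * q.
  by apply: rsum_le => // t ht; apply: (e _ _ _ ht).2; lra.
set a := rsum _ _ _ _ in h1 *; set b := rsum _ _ _ _ in h2 *.
set c := rsum _ _ _ _ in h3 *; set d := rsum _ _ _ _ in h4 *.
have := cabsB (a - b + c) d; have := cabsD (a - b) c; have := cabsB a b.
by move: (cabs (a - b)) (cabs (a - b + c)) => u v; lra.
Qed.

Lemma pow2_small (c e : R) : 0 <= c -> 0 < e ->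
  exists m0, forall m, (m0 <= m)%N -> c / 2 ^+ m <= e.
Proof.
move=> c0 e0; exists (Num.Def.archi_bound (c / e)) => m hm.
rewrite ler_pdivrMr ?exprn_gt0// -ler_pdivrMl// mulrC.
apply: le_trans (ltW (archi_boundP (divr_ge0 c0 (ltW e0)))) _.
rewrite -natrX ler_nat (leq_trans hm)//.
exact: ltnW (ltn_expl _ _).
Qed.

Definition cderiv (g : C -> C) (x B : C) := forall e : R, 0 < e ->
  exists2 d : R, 0 < d & forall y, cabs (y - x) < d ->
    cabs (g y - g x - B * (y - x)) <= e * cabs (y - x).

Section cauchy.
Context (g : C -> C) (r : R) (w : C) (r0 : 0 < r) (wr : cabs w < r).
Context (gd : forall x, cabs x <= r -> exists B, cderiv g x B).

Let ray (t : R) : C := r%:C * cis t - w.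
Let dray (t : R) : C := r%:C * ('i * cis t).
Let gam (s t : R) : C := w + s%:C * ray t.

Let cabs_rcis t : cabs (r%:C * cis t) = r.
Proof. by rewrite cabsM cabs_real cabs_cis mulr1 gtr0_norm. Qed.

Let ray_ge t : r - cabs w <= cabs (ray t).
Proof. by rewrite lerBlDr -{1}(cabs_rcis t) -{1}(subrK w (_ * _)) cabsD. Qed.

Let ray_le t : cabs (ray t) <= 2 * r.
Proof.
by apply: le_trans (cabsB _ _) _; rewrite cabs_rcis mulr_natl mulr2n lerD2l ltW.
Qed.

Let ray_neq0 t : ray t != 0.
Proof. by rewrite -cabs_gt0 (lt_le_trans _ (ray_ge t))// subr_gt0. Qed.

Let cabs_dray t : cabs (dray t) = r.
Proof.
rewrite /dray cabsM cabs_real cabsM cabs_cis mulr1 gtr0_norm//.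
by rewrite /cabs normc_def/= expr0n expr1n add0r sqrtr1 mulr1.
Qed.

Let ray_lip t u : cabs (ray t - ray u) <= 2 * r * `|t - u|.
Proof.
have -> : ray t - ray u = r%:C * (cis t - cis u) by rewrite /ray; ring.
rewrite cabsM cabs_real gtr0_norm// (mulrC 2) -mulrA ler_wpM2l ?cis_lip//.
exact: ltW.
Qed.

(** Fundamental theorem of calculus for the circle, with an explicit error. *)
Let rsum_dray m y (L : R) : 0 <= L ->
  cabs (rsum m dray y L - (ray (y + L) - ray y)) <= 2 * r * L ^+ 2 / 2 ^+ m.
Proof.
move=> L0; rewrite -natrX; set N : R := (2 ^ m)%:R.
have N0 : 0 < N by rewrite ltr0n expn_gt0.
pose th (j : nat) := y + L * (j%:R / N).
have -> : ray (y + L) - ray y = \sum_(j < 2 ^ m) (ray (th j.+1) - ray (th j)).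
  rewrite -(big_mkord predT (fun j => ray (th j.+1) - ray (th j))) telescope_sumr//.
  by rewrite /th mul0r mulr0 addr0 divff ?mulr1// gt_eqF.
rewrite /rsum -/N mulr_sumr -sumrB.
apply: le_trans (cabs_sum _ _ _) _.
rewrite [leRHS](_ : _ = \sum_(j < 2 ^ m) 2 * r * (L / N) ^+ 2); last first.
  rewrite sumr_const card_ord -(mulr_natl (_ * _)) -/N; field.
  by rewrite gt_eqF.
apply: ler_sum => j _.
have -> : ray (th j.+1) = r%:C * (cis (th j) * cis (L / N)) - w.
  by rewrite -cisD /ray /th; congr (_ * cis _ - _); rewrite -natr1; field; rewrite gt_eqF.
have -> : (L / N)%:C * dray (y + L * (j%:R / N)) -
    (r%:C * (cis (th j) * cis (L / N)) - w - ray (th j)) =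
    - (r%:C * cis (th j)) * (cis (L / N) - 1 - 'i * (L / N)%:C).
  by rewrite /ray /dray -/(th j); ring.
rewrite cabsM cabsN cabs_rcis (mulrC 2) -mulrA ler_wpM2l ?(ltW r0)//.
exact: cis_diff.
Qed.

Let gam_in s t : 0 <= s <= 1 -> cabs (gam s t) <= r.
Proof.
move=> /andP[s0 s1].
have -> : gam s t = (1 - s)%:C * w + s%:C * (r%:C * cis t).
  by rewrite /gam /ray rmorphB rmorph1; ring.
apply: le_trans (cabsD _ _) _; rewrite !(cabsM _%:C) !cabs_real cabs_cis mulr1.
rewrite !ger0_norm ?subr_ge0 ?(ltW r0)//.
have : (1 - s) * cabs w <= (1 - s) * r by rewrite ler_wpM2l ?subr_ge0// ltW.
by lra.
Qed.

Let gam_lip s t s' t' : 0 <= s' <= 1 ->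
  cabs (gam s t - gam s' t') <= 2 * r * `|s - s'| + 2 * r * `|t - t'|.
Proof.
move=> /andP[s0 s1].
have -> : gam s t - gam s' t' = (s - s')%:C * ray t + s'%:C * (ray t - ray t').
  by rewrite /gam rmorphB; ring.
apply: le_trans (cabsD _ _) _; rewrite !(cabsM _%:C) !cabs_real; apply: lerD.
  by rewrite mulrC ler_wpM2r ?ray_le.
rewrite ger0_norm//; apply: le_trans (ray_lip _ _).
by rewrite ler_piMl ?cabs_ge0.
Qed.

Let kap t := dray t / ray t.

Let kap_le t : cabs (kap t) <= r / (r - cabs w).
Proof.
rewrite /kap cabsM cabsV cabs_dray ler_wpM2l ?(ltW r0)// lef_pV2 ?ray_ge//.
  by rewrite posrE cabs_gt0.
by rewrite posrE subr_gt0.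
Qed.

(** The integrand is [g dz / (z - w)] pulled back along the contraction [gam] of the
    circle to [w], which turns [dz / (z - w)] into [ds / s + kap t dt].  Near each
    point [g] is affine in [z] up to a small error.  The affine part contributes
    exact forms, whose contour sums vanish in the limit, and the error contributes
    little in proportion to the area. *)
Let contour_gam (s0 : R) : 0 < s0 < 1 ->
  ccvg (fun m => contour m (fun s t => g (gam s t) / s%:C)
    (fun s t => g (gam s t) * kap t) s0 0 (1 - s0) (pi *+ 2)) 0.
Proof.
move=> /andP[s00 s01].
set W := 1 - s0; set H : R := pi *+ 2.
have W0 : 0 <= W by rewrite subr_ge0 ltW.
have H0 : 0 <= H by rewrite mulrn_wge0// pi_ge0.
have hW : s0 + W = 1 by rewrite /W; ring.
apply: goursat => // x1 y1; rewrite hW add0r => hx1 hy1 e e0.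
have x101 : 0 <= x1 <= 1 by lra.
have [B hB] := gd (gam_in y1 x101).
set p := gam x1 y1 in hB.
set Kd := 2 * r * W + 2 * r * H.
set kmax := r / (r - cabs w).
have kmax0 : 0 <= kmax by rewrite divr_ge0 ?subr_ge0 ?(ltW r0) ?(ltW wr).
have Kd0 : 0 <= Kd by rewrite addr_ge0 ?mulr_ge0 ?(ltW r0).
set K := 2 * (W * (Kd / s0)) + 2 * (H * (Kd * kmax)).
have K0 : 0 <= K.
  have h1 : 0 <= Kd / s0 by rewrite divr_ge0// ltW.
  have h2 : 0 <= Kd * kmax by exact: mulr_ge0.
  by apply: addr_ge0; apply: mulr_ge0 => //; exact: mulr_ge0.
have K1 : 0 < 2 * (K + 1) by lra.
set eps := e / (2 * (K + 1)).
have eps0 : 0 < eps by rewrite divr_gt0.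
have [d d0 hd] := hB _ eps0.
have [k0 hk0] := pow2_small Kd0 (divr_gt0 d0 (ltr0n _ 2)).
exists k0 => // k /hk0 hk x y xs0 xW yge yH hx hy.
set Wk := W / 2 ^+ k in xW hx *; set Hk := H / 2 ^+ k in yH hy *.
have Wk0 : 0 <= Wk by rewrite divr_ge0 ?exprn_ge0.
have Hk0 : 0 <= Hk by rewrite divr_ge0 ?exprn_ge0.
set A := g p - B * (p - w).
pose Rm s t := g (gam s t) - g p - B * (gam s t - p).
have split_c m : contour m (fun s t => g (gam s t) / s%:C)
    (fun s t => g (gam s t) * kap t) x y Wk Hk =
    A * contour m (fun s t => s%:C^-1) (fun s t => kap t) x y Wk Hk +
    B * contour m (fun s t => ray t) (fun s t => s%:C * dray t) x y Wk Hk +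
    contour m (fun s t => Rm s t / s%:C) (fun s t => Rm s t * kap t) x y Wk Hk.
  rewrite -!contourZ -!contourD; apply: eq_contour => // s t hs ht.
  have sn0 : s%:C != 0 :> C by rewrite -cabs_eq0 cabs_real normr_eq0 gt_eqF//; lra.
  have rn0 := ray_neq0 t.
  rewrite /Rm /A /kap /gam; split; field; rewrite ?sn0 ?rn0//.
have c1 m : contour m (fun s t => s%:C^-1) (fun s t => kap t) x y Wk Hk = 0.
  by rewrite /contour; ring.
have c2 m : cabs (contour m (fun s t => ray t) (fun s t => s%:C * dray t) x y Wk Hk)
    <= Wk * (2 * r * Hk ^+ 2 / 2 ^+ m).
  rewrite /contour !rsum_cst (rsumZ _ (x + Wk)%:C) (rsumZ _ x%:C).
  have -> : forall a b c : C, Wk%:C * a - Wk%:C * b + (x + Wk)%:C * c - x%:C * c =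
      Wk%:C * (c - (b - a)) by move=> a b c; rewrite rmorphD; ring.
  by rewrite cabsM cabs_real ger0_norm// ler_wpM2l// rsum_dray.
have c3 m : cabs (contour m (fun s t => Rm s t / s%:C) (fun s t => Rm s t * kap t)
    x y Wk Hk) <= eps * K / 4 ^+ k.
  have Rb s t : x <= s <= x + Wk -> y <= t <= y + Hk ->
      cabs (Rm s t) <= eps * (Kd / 2 ^+ k).
    move=> hs ht; have gl := gam_lip s t y1 x101; rewrite -/p in gl.
    have {}gl : cabs (gam s t - p) <= Kd / 2 ^+ k.
      apply: le_trans gl _; have -> : Kd / 2 ^+ k = 2 * r * Wk + 2 * r * Hk.
        by rewrite /Kd /Wk /Hk; field; rewrite expf_neq0.
      have r2 : 0 <= 2 * r by rewrite mulr_ge0 ?(ltW r0).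
      by apply: lerD; rewrite ler_wpM2l// ler_norml; lra.
    rewrite /Rm; apply: le_trans (hd _ _) _; last by rewrite ler_wpM2l ?(ltW eps0).
    by apply: le_lt_trans gl _; lra.
  have -> : eps * K / 4 ^+ k = 2 * (Wk * (eps * (Kd / 2 ^+ k) / s0)) +
      2 * (Hk * (eps * (Kd / 2 ^+ k) * kmax)).
    have -> : (4 : R) = 2 * 2 by lra.
    rewrite /K /Wk /Hk exprMn; field.
    by rewrite ?expf_neq0 ?(gt_eqF s00).
  apply: contour_le => // s t hs ht; have h := Rb s t hs ht; split.
    rewrite cabsM cabsV cabs_real ger0_norm; last by lra.
    apply: ler_pM => //; rewrite ?cabs_ge0 ?invr_ge0//; first by lra.
    by rewrite lef_pV2 ?posrE//; lra.
  by rewrite cabsM; apply: ler_pM; rewrite ?cabs_ge0//; exact: kap_le.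
have c0 : 0 <= cabs B * (Wk * (2 * r * Hk ^+ 2)).
  by rewrite !mulr_ge0 ?cabs_ge0 ?exprn_ge0 ?(ltW r0).
have e4 : 0 < e / 2 / 4 ^+ k by rewrite !divr_gt0 ?exprn_gt0.
have [m0 hm0] := pow2_small c0 e4.
exists m0 => m /hm0 hm; rewrite split_c c1 mulr0 add0r.
apply: le_trans (cabsD _ _) _; rewrite cabsM.
have hB2 := ler_wpM2l (cabs_ge0 B) (c2 m).
apply: (le_trans (lerD hB2 (c3 m))).
have hK : eps * K / 4 ^+ k <= e / 2 / 4 ^+ k.
  rewrite ler_wpM2r ?invr_ge0 ?exprn_ge0// /eps.
  rewrite mulrAC ler_pdivrMr// (_ : e / 2 * _ = e * (K + 1)); last by field.
  by rewrite ler_wpM2l ?(ltW e0)// lerDl.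
move: hm; rewrite -!mulrA in hK * => hm.
have -> : e / 4 ^+ k = e / 2 / 4 ^+ k + e / 2 / 4 ^+ k by field; rewrite expf_neq0.
by rewrite !mulrA in hm hK *; apply: lerD.
Qed.

Let rsum_rootavg m (F : C -> C) : rsum m (fun t => F (cis t)) 0 (pi *+ 2) =
  (pi *+ 2)%:C * rootavg m F.
Proof.
rewrite /rsum /rootavg rmorphM/= fmorphV rmorph_nat -mulrA; congr (_ * (_ * _)).
by apply: eq_bigr => j _; rewrite add0r.
Qed.

Let kapE t : kap t = 'i * (1 - w / r%:C / cis t)^-1.
Proof.
have c0 : cis t != 0 by rewrite -cabs_eq0 cabs_cis oner_neq0.
have rc0 : r%:C != 0 :> C by rewrite -cabs_eq0 cabs_real normr_eq0 gt_eqF.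
have := ray_neq0 t; rewrite /kap /dray /ray => h.
by field; rewrite rc0 c0 h.
Qed.

(** Cauchy's formula.  By [contour_gam] the means do not change in the limit when
    the circle is contracted by a small factor [s0]; on the contracted circle [g] is
    close to [g w], and the kernel has mean one by [rootavg_geometric]. *)
Lemma cauchy_rootavg :
  ccvg (fun m => rootavg m (fun x => g (r%:C * x) * (1 - w / r%:C / x)^-1)) (g w).
Proof.
set Kn : C -> C := fun x => (1 - w / r%:C / x)^-1.
have rc0 : r%:C != 0 :> C by rewrite -cabs_eq0 cabs_real normr_eq0 gt_eqF.
have b1 : cabs (w / r%:C) < 1.
  by rewrite cabsM cabsV cabs_real gtr0_norm// ltr_pdivrMr// mul1r.
set kmax := r / (r - cabs w).
have kmax0 : 0 < kmax by rewrite divr_gt0 ?subr_gt0.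
have Kle x : cabs x = 1 -> cabs (Kn x) <= kmax.
  move=> x1; rewrite /Kn cabsV /kmax -[leRHS]invf_div lef_pV2 ?posrE; last 2 first.
  - rewrite cabs_gt0 subr_eq0; apply: contraTneq b1 => /(congr1 (@cabs R)).
    by rewrite cabs1 (cabsM _ x^-1) cabsV x1 invr1 mulr1 => <-; rewrite ltxx.
  - by rewrite divr_gt0// subr_gt0.
  rewrite mulrBl divff ?gt_eqF// lerBlDr.
  have -> : cabs w / r = cabs (w / r%:C / x).
    by rewrite !cabsM !cabsV x1 invr1 mulr1 cabs_real gtr0_norm.
  by rewrite -{1}(cabs1 R) -{1}(subrK (w / r%:C / x) 1) cabsD.
have avgK : ccvg (fun m => rootavg m Kn) 1.
  apply/ccvgP => e e0.
  have hb0 : 0 <= cabs (w / r%:C) * kmax by rewrite mulr_ge0 ?cabs_ge0 ?ltW.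
  have : (fun m => cabs (w / r%:C) ^+ m) @ \oo --> (0 : R).
    by apply: cvg_expr; rewrite ger0_norm ?cabs_ge0.
  move=> /cvgrPdist_le/(_ _ (divr_gt0 e0 kmax0))[m0 _ hm0].
  exists m0 => m mm; have := rootavg_geometric m b1; rewrite -/Kn => h.
  have -> : rootavg m Kn - 1 = (w / r%:C) ^+ (2 ^ m) * rootavg m Kn.
    by rewrite -[X in _ - X]h; ring.
  rewrite cabsM cabsX; apply: le_trans (ler_wpM2l _ (rootavg_le _ Kle)) _.
    by rewrite exprn_ge0// cabs_ge0.
  rewrite -ler_pdivlMr//; have /hm0 : (m0 <= 2 ^ m)%N.
    by apply: leq_trans mm (ltnW (ltn_expl _ _)).
  by rewrite /= sub0r normrN ger0_norm// exprn_ge0// cabs_ge0.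
have w_in : cabs w <= r by exact: ltW.
have [B hB] := gd w_in.
apply/ccvgP => e e0.
(* [kmax] bounds the kernel on the circle *)
have [s0 s0P close] : exists2 s0 : R, 0 < s0 < 1 &
    forall t, cabs (g (gam s0 t) - g w) <= e / 4 / kmax.
  have [d d0 hd] := hB 1 ltr01.
  set L := (1 + cabs B) * (2 * r) / (e / 4 / kmax).
  have e4 : 0 < e / 4 / kmax by rewrite divr_gt0// divr_gt0.
  have cB := cabs_ge0 B.
  have L0 : 0 < L by rewrite divr_gt0// mulr_gt0// ?mulr_gt0//; apply: ltr_pwDl.
  exists (Num.min (1 / 2) (Num.min (d / (4 * r)) L^-1)).
    rewrite !lt_min !gt_min divr_gt0//= divr_gt0 ?mulr_gt0//= invr_gt0 L0/=.
    by apply/orP; left; lra.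
  set s0 := Num.min _ _ => t.
  have s0ge : 0 <= s0 by rewrite !le_min !divr_ge0 ?mulr_ge0 ?invr_ge0 ?(ltW L0) ?(ltW d0) ?(ltW r0).
  have s1 : s0 <= d / (4 * r) by rewrite !ge_min lexx orbT.
  have s2 : s0 <= L^-1 by rewrite !ge_min lexx !orbT.
  have gw : gam s0 t - w = s0%:C * ray t by rewrite /gam; ring.
  have cg : cabs (gam s0 t - w) <= s0 * (2 * r).
    by rewrite gw cabsM cabs_real ger0_norm// ler_wpM2l.
  have /hd h : cabs (gam s0 t - w) < d.
    apply: le_lt_trans cg _; move: s1; rewrite ler_pdivlMr ?mulr_gt0//.
    by move: d0; lra.
  have -> : g (gam s0 t) - g w = (g (gam s0 t) - g w - B * (gam s0 t - w))
    + B * (gam s0 t - w) by ring.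
  apply: le_trans (cabsD _ _) _; rewrite (cabsM B).
  apply: (le_trans (y := (1 + cabs B) * cabs (gam s0 t - w))).
    by rewrite mulrDl lerD2r.
  apply: le_trans (ler_wpM2l _ cg) _; first by lra.
  rewrite (mulrCA _ s0) -ler_pdivlMr ?mulr_gt0//; last lra.
  by apply: le_trans s2 _; rewrite /L invf_div.
have /ccvgP/(_ ((pi *+ 2) * (e / 4))) [|m1 hm1] := contour_gam s0P.
  by rewrite mulr_gt0 ?divr_gt0// pmulrn_lgt0 ?pi_gt0.
have gw0 := cabs_ge0 (g w).
have e4 : 0 < e / 4 / (cabs (g w) + 1) by rewrite !divr_gt0//; lra.
have /ccvgP/(_ _ e4)[m2 hm2] := avgK.
exists (maxn m1 m2) => m; rewrite geq_max => /andP[/hm1 h1 /hm2 h2].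
set I1 := rootavg m _.
pose I0 := rootavg m (fun x => g (w + s0%:C * (r%:C * x - w)) * Kn x).
have d10 : cabs (I1 - I0) <= e / 4.
  move: h1; rewrite subr0 /contour.
  have -> : rsum m (fun s => g (gam s 0) / s%:C) s0 (1 - s0) =
      rsum m (fun s => g (gam s (0 + pi *+ 2)) / s%:C) s0 (1 - s0).
    by congr rsum; apply/funext => s; rewrite add0r /gam /ray cis2pi cis0.
  rewrite subrr add0r (_ : s0 + (1 - s0) = 1); last by ring.
  pose F1 x := 'i * (g (r%:C * x) * Kn x).
  pose F0 x := 'i * (g (w + s0%:C * (r%:C * x - w)) * Kn x).
  have -> : (fun t => g (gam 1 t) * kap t) =
      (fun t => F1 (cis t)).
    apply/funext => t; rewrite kapE -/(Kn (cis t)) /F1 /gam /ray rmorph1 mul1r.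
    by rewrite addrC subrK; ring.
  have -> : (fun t => g (gam s0 t) * kap t) =
      (fun t => F0 (cis t)).
    by apply/funext => t; rewrite kapE -/(Kn (cis t)) /F0 /gam /ray; ring.
  rewrite (rsum_rootavg m F1) (rsum_rootavg m F0) !rootavgZ -mulrBr -mulrBr !cabsM cabs_real.
  rewrite (_ : cabs 'i = 1) ?mul1r; last first.
    by rewrite /cabs normc_def/= expr0n expr1n add0r sqrtr1.
  have p0 : 0 < pi *+ 2 :> R by rewrite pmulrn_lgt0 ?pi_gt0.
  by rewrite gtr0_norm// ler_pM2l.
have d0 : cabs (I0 - g w * rootavg m Kn) <= e / 4.
  have -> : I0 - g w * rootavg m Kn = rootavg m
      (fun x => (g (w + s0%:C * (r%:C * x - w)) - g w) * Kn x).
    rewrite -mulN1r mulrA -rootavgZ -rootavgD; congr rootavg.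
    by apply/funext => x; ring.
  rewrite /rootavg cabsM cabsV -(rmorph_nat (real_complex R)) cabs_real.
  rewrite normr_nat ler_pdivrMl ?ltr0n ?expn_gt0//.
  apply: le_trans (cabs_sum _ _ _) _.
  rewrite [leRHS](_ : _ = \sum_(j < 2 ^ m) (e / 4)); last first.
    by rewrite sumr_const card_ord -(mulr_natl (_ / _)).
  apply: ler_sum => j _; rewrite cabsM.
  have := ler_pM (cabs_ge0 _) (cabs_ge0 _) (close (pi *+ 2 * (j%:R / (2 ^ m)%:R)))
    (Kle _ (cabs_cis (pi *+ 2 * (j%:R / (2 ^ m)%:R)))).
  by rewrite /gam /ray divfK ?gt_eqF.
have d2 : cabs (g w * rootavg m Kn - g w) <= e / 4.
  rewrite -{2}(mulr1 (g w)) -mulrBr cabsM.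
  apply: le_trans (ler_wpM2l gw0 h2) _.
  rewrite mulrA ler_pdivrMr; last lra.
  by rewrite mulrC ler_wpM2l; lra.
have := cabsD (I1 - I0) (I0 - g w * rootavg m Kn).
have := cabsD (I1 - g w * rootavg m Kn) (g w * rootavg m Kn - g w).
by rewrite !addrA !subrK; lra.
Qed.

End cauchy.
End contours.

(** * Limits along an ultrafilter *)

Section ultralimit.
Context (R : realType) (U : set_system nat) (UU : UltraFilter U) (Uoo : \oo `<=` U).
Local Notation C := R[i].
Implicit Types (u v : nat -> C).

Let UP : ProperFilter U := @ultra_proper _ _ UU.

Definition ucvg u l := forall e : R, 0 < e -> U [set N | cabs (u N - l) <= e].

Definition ulim u : C := xget 0 (ucvg u).

Lemma real_ucvg (a : nat -> R) (M : R) : (forall N, `|a N| <= M) ->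
  exists l, forall e : R, 0 < e -> U [set N | `|a N - l| <= e].
Proof.
move=> aM; pose F : set_system R := [set A | U (a @^-1` A)].
have FF : ProperFilter F by exact: fmap_proper_filter.
have FM : F `[- M, M]%classic.
  rewrite /F/=; apply: filterS filterT => N _ /=.
  by rewrite in_itv/= -ler_norml.
have [l [_ cl]] := @segment_compact R (- M) M F FF FM.
exists l => e e0; have [//|nU] := in_ultra_setVsetC [set N | `|a N - l| <= e] UU.
have [||x [/= Hx]] := cl [set x | ~ `|x - l| <= e] (ball l e).
- exact: nU.
- exact: nbhsx_ballx.
by rewrite /ball/= distrC => /ltW.
Qed.

Lemma ucvg_exists u (M : R) : (forall N, cabs (u N) <= M) -> exists l, ucvg u l.
Proof.
move=> uM.
have [a ha] : exists l, forall e : R, 0 < e ->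
    U [set N | `|complex.Re (u N) - l| <= e].
  by apply: (@real_ucvg _ M) => N; apply: le_trans (uM N); exact: cabs_ge_Re.
have [b hb] : exists l, forall e : R, 0 < e ->
    U [set N | `|complex.Im (u N) - l| <= e].
  by apply: (@real_ucvg _ M) => N; apply: le_trans (uM N); exact: cabs_ge_Im.
exists (a +i* b) => e e0.
have e2 : 0 < e / 2 by rewrite divr_gt0.
apply: filterS (filterI (ha _ e2) (hb _ e2)) => N [/= h1 h2].
apply: le_trans (cabs_le_ReIm _) _; rewrite [leRHS](splitr e).
by move: h1 h2; case: (u N) => x y /= h1 h2; exact: lerD.
Qed.

Lemma ucvg_unique u l l' : ucvg u l -> ucvg u l' -> l = l'.
Proof.
move=> h h'; apply/eqP; rewrite -subr_eq0 -cabs_eq0 eq_le cabs_ge0 andbT.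
apply/ler_addgt0Pr => e e0; rewrite add0r.
have e2 : 0 < e / 2 by rewrite divr_gt0.
have [N [/= h1 h2]] := filter_ex (filterI (h _ e2) (h' _ e2)).
rewrite -(subrK (u N) l) -addrA [leRHS](splitr e).
by apply: le_trans (cabsD _ _) _; rewrite lerD// cabsC.
Qed.

Lemma ulimE u l : ucvg u l -> ulim u = l.
Proof. by move=> h; apply: (ucvg_unique _ h); apply: xgetPex; exists l. Qed.

Lemma ulimP u (M : R) : (forall N, cabs (u N) <= M) -> ucvg u (ulim u).
Proof. by move=> /ucvg_exists h; exact: xgetPex. Qed.

Lemma ccvg_ulim u l : ccvg u l -> ulim u = l.
Proof.
move=> /ccvgP h; apply: ulimE => e /h[N0 hN]; apply: Uoo.
by exists N0 => // N /=; exact: hN.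
Qed.

Lemma ulimD u v (M M' : R) : (forall N, cabs (u N) <= M) ->
  (forall N, cabs (v N) <= M') -> ulim (fun N => u N + v N) = ulim u + ulim v.
Proof.
move=> /ulimP hu /ulimP hv; apply: ulimE => e e0.
have e2 : 0 < e / 2 by rewrite divr_gt0.
apply: filterS (filterI (hu _ e2) (hv _ e2)) => N [/= h1 h2].
rewrite opprD addrACA [leRHS](splitr e).
by apply: le_trans (cabsD _ _) _; exact: lerD.
Qed.

Lemma ulimZ c u (M : R) : (forall N, cabs (u N) <= M) ->
  ulim (fun N => c * u N) = c * ulim u.
Proof.
move=> /ulimP hu; apply: ulimE => e e0.
have c0 : 0 < cabs c + 1 by rewrite ltr_wpDl ?cabs_ge0.
apply: filterS (hu _ (divr_gt0 e0 c0)) => N /= h.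
rewrite -mulrBr cabsM; apply: le_trans (ler_wpM2l (cabs_ge0 c) h) _.
by rewrite mulrCA ger_pMr// ler_pdivrMr// mul1r lerDl.
Qed.

Lemma ulim_le u (M : R) : (forall N, cabs (u N) <= M) -> cabs (ulim u) <= M.
Proof.
move=> uM; have h := ulimP uM; apply/ler_addgt0Pr => e /h/filter_ex[N /= hN].
rewrite -(subrK (u N) (ulim u)) addrC; apply: le_trans (cabsD _ _) _.
by rewrite lerD// cabsC.
Qed.

End ultralimit.

Lemma nat_ultrafilter : exists U : set_system nat, UltraFilter U /\ \oo `<=` U.
Proof. exact: ultraFilterLemma. Qed.

(** * Cauchy's formula on polydiscs *)

Section mean_functional.
Context (R : realType).
Local Notation C := R[i].

Definition circle_bounded (G : C -> C) :=
  exists M : R, forall x, cabs x = 1 -> cabs (G x) <= M.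

(** Extending the mean over the circle to all bounded functions makes iterated
    means meaningful without any regularity in the remaining variables. *)
Lemma mean_functional_exists : exists Phi : (C -> C) -> C,
  [/\ forall G H, circle_bounded G -> circle_bounded H ->
        Phi (fun x => G x + H x) = Phi G + Phi H,
      forall c G, circle_bounded G -> Phi (fun x => c * G x) = c * Phi G,
      forall G M, (forall x, cabs x = 1 -> cabs (G x) <= M) -> cabs (Phi G) <= M,
      forall G H, (forall x, cabs x = 1 -> G x = H x) -> Phi G = Phi H &
      forall G l, ccvg (fun m => rootavg m G) l -> Phi G = l].
Proof.
have [U [UU Uoo]] := nat_ultrafilter.
exists (fun G => ulim U (fun m => rootavg m G)); split.
- move=> G H [M hM] [M' hM'].
  rewrite -(@ulimD _ _ UU _ _ M M'); last 2 first.
  + by move=> m; exact: rootavg_le.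
  + by move=> m; exact: rootavg_le.
  by congr ulim; apply/funext => m; rewrite rootavgD.
- move=> c G [M hM]; rewrite -(@ulimZ _ _ UU c _ M) => [|m]; last exact: rootavg_le.
  by congr ulim; apply/funext => m; rewrite rootavgZ.
- by move=> G M hM; apply: (ulim_le UU) => m; exact: rootavg_le.
- move=> G H e; congr ulim; apply/funext => m; apply: eq_rootavg => x x1 _.
  exact: e.
- by move=> G l; exact: (ccvg_ulim UU Uoo).
Qed.

End mean_functional.

Section polydisc.
Context (R : realType) (n : nat).
Local Notation C := R[i].
Implicit Types (x y z : 'I_n -> C) (s : seq 'I_n) (F G : ('I_n -> C) -> C).

Definition upd z j (t : C) : 'I_n -> C := fun k => if k == j then t else z k.

Lemma upd_upd z j t t' : upd (upd z j t) j t' = upd z j t'.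
Proof. by apply/funext => k; rewrite /upd; case: eqP. Qed.

Lemma upd_id z j : upd z j (z j) = z.
Proof. by apply/funext => k; rewrite /upd; case: eqP => [->|]. Qed.

Lemma updE z j t : upd z j t j = t.
Proof. by rewrite /upd eqxx. Qed.

Definition torus x := forall j, cabs (x j) = 1.

Lemma torus_upd x j t : torus x -> cabs t = 1 -> torus (upd x j t).
Proof. by move=> hx t1 k; rewrite /upd; case: eqP. Qed.

Definition torus_le G (M : R) := forall x, torus x -> cabs (G x) <= M.

Context (Phi : (C -> C) -> C)
  (PhiD : forall (G H : C -> C), circle_bounded G -> circle_bounded H ->
     Phi (fun t => G t + H t) = Phi G + Phi H)
  (PhiZ : forall c (G : C -> C), circle_bounded G -> Phi (fun t => c * G t) = c * Phi G)
  (Phi_le : forall (G : C -> C) M, (forall t, cabs t = 1 -> cabs (G t) <= M) -> cabs (Phi G) <= M)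
  (eq_Phi : forall (G H : C -> C), (forall t, cabs t = 1 -> G t = H t) -> Phi G = Phi H)
  (Phi_cvg : forall (G : C -> C) l, ccvg (fun m => rootavg m G) l -> Phi G = l).

(** The mean over the torus in the coordinates of [s]: the values of [x] at these
    coordinates are overwritten, those at the others are parameters. *)
Fixpoint mean s G x : C :=
  if s is j :: s' then Phi (fun t => mean s' G (upd x j t)) else G x.

Lemma mean_le s G M : torus_le G M -> torus_le (mean s G) M.
Proof.
move=> GM; elim: s => [//|j s IH] x hx /=; apply: Phi_le => t t1.
by apply: IH; exact: torus_upd.
Qed.

Lemma eq_mean s G H x : torus x -> (forall y, torus y -> G y = H y) ->
  mean s G x = mean s H x.
Proof.
move=> hx e; elim: s x hx => [|j s IH] x hx /=; first exact: e.
by apply: eq_Phi => t t1; apply: IH; exact: torus_upd.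
Qed.

Lemma mean_circle_bounded s G M x j : torus_le G M -> torus x ->
  circle_bounded (fun t => mean s G (upd x j t)).
Proof.
by move=> GM hx; exists M => t t1; apply: mean_le GM _ _; exact: torus_upd.
Qed.

Lemma meanD s G H M M' x : torus x -> torus_le G M -> torus_le H M' ->
  mean s (fun y => G y + H y) x = mean s G x + mean s H x.
Proof.
move=> hx hG hH; elim: s x hx => [//|j s IH] x hx /=.
rewrite -PhiD; last 2 first.
- exact: mean_circle_bounded hG hx.
- exact: mean_circle_bounded hH hx.
by apply: eq_Phi => t t1; apply: IH; exact: torus_upd.
Qed.

Lemma meanZ s c G M x : torus x -> torus_le G M ->
  mean s (fun y => c * G y) x = c * mean s G x.
Proof.
move=> hx hG; elim: s x hx => [//|j s IH] x hx /=.
rewrite -PhiZ; last exact: mean_circle_bounded hG hx.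
by apply: eq_Phi => t t1; apply: IH; exact: torus_upd.
Qed.

(** For taking the kernel of one coordinate out of the means over the others. *)
Lemma mean_factor s (h : C -> C) G M x j : torus x -> torus_le G M -> j \notin s ->
  mean s (fun y => h (y j) * G y) x = h (x j) * mean s G x.
Proof.
move=> hx hG; elim: s x hx => [//|k s IH] x hx /=.
rewrite inE negb_or => /andP[jk js].
rewrite -PhiZ; last exact: mean_circle_bounded hG hx.
apply: eq_Phi => t t1; rewrite IH//; last exact: torus_upd.
by rewrite /upd (negbTE jk).
Qed.

Lemma mean_sum s (I : Type) (r : seq I) (c : I -> C) (G : I -> ('I_n -> C) -> C)
    (M : R) x : torus x -> (forall i, torus_le (G i) M) ->
  mean s (fun y => \sum_(i <- r) c i * G i y) x = \sum_(i <- r) c i * mean s (G i) x.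
Proof.
move=> hx hG; elim: r => [|i r IH].
  rewrite big_nil -[RHS](mul0r (mean s (fun=> 0) x)) -(@meanZ _ _ _ 0 x hx).
    by apply: eq_mean => // y _; rewrite big_nil mul0r.
  by move=> y _; rewrite cabs0.
rewrite big_cons -IH -(@meanZ _ _ _ M x hx (hG i)).
rewrite -(@meanD _ _ _ (cabs (c i) * M) (\sum_(i <- r) cabs (c i) * M) x hx).
- by apply: eq_mean => // y _; rewrite big_cons.
- by move=> y hy; rewrite cabsM ler_wpM2l ?cabs_ge0//; exact: hG.
- move=> y hy; apply: le_trans (cabs_sum _ _ _) _; apply: ler_sum => k _.
  by rewrite cabsM ler_wpM2l ?cabs_ge0//; exact: hG.
Qed.

Context (f : ('I_n -> C) -> C) (r : 'I_n -> R) (M : R) (r0 : forall j, 0 < r j).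
Context (fM : forall z, (forall j, cabs (z j) <= r j) -> cabs (f z) <= M).
Context (fd : forall z j, (forall k, cabs (z k) <= r k) ->
  exists B, cderiv (fun t => f (upd z j t)) (z j) B).

Let rx x : 'I_n -> C := fun j => (r j)%:C * x j.

Let cabs_rx x j : torus x -> cabs (rx x j) = r j.
Proof. by move=> hx; rewrite cabsM cabs_real gtr0_norm// hx mulr1. Qed.

Section formula.
Context (z : 'I_n -> C) (zr : forall j, cabs (z j) < r j).

Let ker j (t : C) : C := (1 - z j / (r j)%:C / t)^-1.

(** The point of the polydisc reached when the coordinates in [s] have been
    averaged. *)
Let mix s x : 'I_n -> C := fun j => if j \in s then z j else rx x j.

Let mix_in s x : torus x -> forall j, cabs (mix s x j) <= r j.
Proof. by move=> hx j; rewrite /mix; case: ifP => _; rewrite ?(ltW (zr j)) ?cabs_rx. Qed.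

Let slice_cauchy y j : (forall k, cabs (y k) <= r k) -> y j = z j ->
  Phi (fun t => f (upd y j ((r j)%:C * t)) * ker j t) = f y.
Proof.
move=> hy yz; have h t : cabs t <= r j -> forall k, cabs (upd y j t k) <= r k.
  by move=> ht k; rewrite /upd; case: eqP => [->|].
have := @cauchy_rootavg R (fun t => f (upd y j t)) (r j) (z j) (r0 j) (zr j) _.
rewrite -yz upd_id yz => H; apply: Phi_cvg; apply: H => t ht.
have [B hB] := fd j (h t ht); exists B; rewrite updE in hB.
by move: hB; rewrite (_ : (fun _ => _) = (fun t => f (upd y j t)))//;
  apply/funext => t'; rewrite upd_upd.
Qed.

Let A := \prod_j (1 - cabs (z j) / r j)^-1.

Let q01 j : 0 <= cabs (z j) / r j < 1.
Proof.
by rewrite divr_ge0 ?cabs_ge0 ?(ltW (r0 j))//= ltr_pdivrMr// mul1r.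
Qed.

Let zt_lt1 j t : cabs t = 1 -> cabs (z j / (r j)%:C / t) = cabs (z j) / r j.
Proof. by move=> t1; rewrite !cabsM !cabsV t1 invr1 mulr1 cabs_real gtr0_norm. Qed.

Let ker_le j t : cabs t = 1 -> cabs (ker j t) <= (1 - cabs (z j) / r j)^-1.
Proof.
move=> t1; have /andP[q0 q1] := q01 j.
have h : 1 - cabs (z j) / r j <= cabs (1 - z j / (r j)%:C / t).
  rewrite lerBlDr -(zt_lt1 j t1) -{1}(cabs1 R).
  by rewrite -{1}(subrK (z j / (r j)%:C / t) 1) cabsD.
rewrite /ker cabsV lef_pV2// posrE ?subr_gt0//.
by apply: lt_le_trans h; rewrite subr_gt0.
Qed.

Let prod_ker_le s : torus_le (fun y => f (rx y) * \prod_(j <- s) ker j (y j))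
  (M * \prod_(j <- s) (1 - cabs (z j) / r j)^-1).
Proof.
move=> y hy; rewrite cabsM; apply: ler_pM; rewrite ?cabs_ge0//.
  by apply: fM => j; rewrite cabs_rx.
by rewrite cabs_prod; apply: ler_prod => j _; rewrite cabs_ge0 ker_le.
Qed.

(** Cauchy's formula for the coordinates of [s]: averaging over one more coordinate
    [j] moves the argument of [f] from the circle to [z j]. *)
Let mean_ker s x : uniq s -> torus x ->
  mean s (fun y => f (rx y) * \prod_(j <- s) ker j (y j)) x = f (mix s x).
Proof.
elim: s x => [|j s IH] x /=.
  by move=> _ _; rewrite big_nil mulr1.
move=> /andP[js us] hx.
rewrite -(@slice_cauchy (mix (j :: s) x) j); last 2 first.
- exact: mix_in.
- by rewrite /mix inE eqxx.
apply: eq_Phi => t t1; have ht := torus_upd j hx t1.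
rewrite (_ : upd (mix (j :: s) x) j ((r j)%:C * t) = mix s (upd x j t)); last first.
  apply/funext => k; rewrite /upd /mix /rx inE; case: eqP => [->|//].
  by rewrite (negbTE js).
rewrite -IH// mulrC; have := mean_factor (ker j) ht (prod_ker_le s) js; rewrite updE => <-.
by apply: eq_mean => // y _; rewrite big_cons mulrCA.
Qed.

Lemma cauchy_polydisc_formula x : torus x ->
  mean (enum 'I_n) (fun y => f (rx y) * \prod_j ker j (y j)) x = f z.
Proof.
move=> hx; have := mean_ker (enum_uniq 'I_n) hx.
rewrite (_ : mix _ x = z); last first.
  by apply/funext => j; rewrite /mix mem_enum.
by move=> <-; apply: eq_mean => // y _; rewrite big_enum.
Qed.

(** Replacing the kernels by partial geometric series costs at most the tail of
    the corresponding product of geometric series. *)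
Let ker_trunc N y : torus y ->
  cabs (\prod_j ker j (y j) -
    \sum_(u <- box n N) mon (fun j => z j / (r j)%:C / y j) u) <=
  A * (\prod_j (1 + (cabs (z j) / r j) ^+ N) - 1).
Proof.
move=> hy; rewrite sum_box_mon.
pose p j := z j / (r j)%:C / y j.
have geo j : \sum_(k < N) p j ^+ k = ker j (y j) * (1 - p j ^+ N).
  have h : 1 - p j != 0.
    rewrite subr_eq0; apply: contraTneq (q01 j) => /(congr1 (@cabs R)).
    by rewrite cabs1 (zt_lt1 j (hy j)) => <-; rewrite ltxx andbF.
  apply: (mulfI h); rewrite mulrA /ker -/(p j) mulfV// mul1r.
  have -> : 1 - p j ^+ N = - (p j ^+ N - 1) by ring.
  by rewrite subrX1; ring.
rewrite (eq_bigr _ (fun j _ => geo j)) big_split/= -{1}(mulr1 (\prod_j ker j _)).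
rewrite -mulrBr cabsM; apply: ler_pM; rewrite ?cabs_ge0//.
  by rewrite cabs_prod; apply: ler_prod => j _; rewrite cabs_ge0 ker_le.
elim/big_rec2: _ => [|j a b _ h]; first by rewrite !subrr cabs0.
have -> : 1 - (1 - p j ^+ N) * b = (1 - b) + p j ^+ N * b by ring.
apply: le_trans (cabsD _ _) _; rewrite cabsM cabsX (zt_lt1 j (hy j)).
set Q := _ ^+ N; have Q0 : 0 <= Q by rewrite exprn_ge0//; case/andP: (q01 j).
have hb : cabs b <= a.
  have -> : b = 1 - (1 - b) by ring.
  by apply: le_trans (cabsB _ _) _; rewrite cabs1; lra.
have := ler_wpM2l Q0 hb; lra.
Qed.

Let coef u x := mean (enum 'I_n) (fun y => f (rx y) * (mon y u)^-1) x / (mon r u)%:C.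

Lemma cauchy_polydisc_cvg x : torus x ->
  ccvg (fun N => \sum_(u <- box n N) coef u x * mon z u) (f z).
Proof.
move=> hx; have M0 : 0 <= M.
  by apply: le_trans (fM (z := rx x) _); rewrite ?cabs_ge0// => j; rewrite cabs_rx.
have A0 : 0 <= A.
  by apply: prodr_ge0 => j _; rewrite invr_ge0 subr_ge0; case/andP: (q01 j) => _ /ltW.
have tail0 : (fun N => M * (A * (\prod_j (1 + (cabs (z j) / r j) ^+ N) - 1))) @ \oo
    --> (0 : R).
  have pr : (fun N => \prod_j (1 + (cabs (z j) / r j) ^+ N)) @ \oo --> (1 : R).
    elim: (index_enum 'I_n) => [|j s IH].
      by under eq_fun do rewrite big_nil; exact: cvg_cst.
    under eq_fun do rewrite big_cons.
    have qj : (fun N => (cabs (z j) / r j) ^+ N) @ \oo --> (0 : R).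
      by apply: cvg_expr; case/andP: (q01 j) => ? ?; rewrite ger0_norm.
    suff : (fun N => (1 + (cabs (z j) / r j) ^+ N) *
        \prod_(i <- s) (1 + (cabs (z i) / r i) ^+ N)) @ \oo --> ((1 + 0) * 1 : R).
      by rewrite addr0 mulr1.
    by apply: cvgM IH; apply: cvgD qj; exact: cvg_cst.
  suff : (fun N => M * (A * (\prod_j (1 + (cabs (z j) / r j) ^+ N) - 1))) @ \oo
      --> (M * (A * (1 - 1)) : R) by rewrite subrr !mulr0.
  apply: cvgM; first exact: cvg_cst.
  apply: cvgM; first exact: cvg_cst.
  by apply: cvgB pr _; exact: cvg_cst.
have mon1 y u : torus y -> cabs (mon y u) = 1.
  by move=> hy; rewrite cabs_mon /mon big1// => j _; rewrite hy expr1n.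
have GM u : torus_le (fun y => f (rx y) * (mon y u)^-1) M.
  move=> y hy; rewrite cabsM cabsV mon1// invr1 mulr1.
  by apply: fM => j; rewrite cabs_rx.
apply/ccvgP => e e0.
have [N0 _ hN0] : \forall N \near \oo, M * (A * (\prod_j (1 + (cabs (z j) / r j) ^+ N) - 1)) <= e.
  move/cvgrPdist_le/(_ _ e0) : tail0; apply: filterS => N /=.
  by rewrite sub0r normrN; apply: le_trans; rewrite ler_norm.
exists N0 => N /hN0 /= hN; apply: le_trans hN.
rewrite -(cauchy_polydisc_formula hx).
have -> : \sum_(u <- box n N) coef u x * mon z u =
    mean (enum 'I_n) (fun y => \sum_(u <- box n N)
      (mon (fun j => z j / (r j)%:C) u) * (f (rx y) * (mon y u)^-1)) x.
  rewrite (mean_sum _ _ _ hx GM); apply: eq_bigr => u _; rewrite /coef.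
  rewrite mulrC mulrA mulrAC; congr (_ * _).
  rewrite /mon rmorph_prod/= -prodfV -big_split/=; apply: eq_bigr => j _.
  by rewrite exprMn rmorphXn/= exprVn.
have subE (a b : C) : a - b = a + -1 * b by rewrite mulN1r.
rewrite cabsC [X in cabs X]subE -(@meanZ _ _ _ (\sum_(u <- box n N)
   cabs (mon (fun j => z j / (r j)%:C) u) * M) x hx); last first.
  move=> y hy; apply: le_trans (cabs_sum _ _ _) _; apply: ler_sum => u _.
  by rewrite cabsM ler_wpM2l ?cabs_ge0//; exact: GM.
rewrite -(@meanD _ _ _ (M * A) (\sum_(u <- box n N)
   cabs (mon (fun j => z j / (r j)%:C) u) * M) x hx).
- apply: mean_le hx => y hy.
  rewrite mulN1r; under [X in _ - X]eq_bigr => u _ do rewrite mulrCA.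
  rewrite -mulr_sumr -mulrBr cabsM; apply: ler_pM; rewrite ?cabs_ge0//.
    by apply: fM => j; rewrite cabs_rx.
  rewrite (eq_bigr (fun u => mon (fun j => z j / (r j)%:C / y j) u)) ?ker_trunc// => u _.
  rewrite /mon -prodfV -big_split/=; apply: eq_bigr => j _.
  by rewrite !exprMn !exprVn.
- by move=> y hy; have := prod_ker_le (index_enum 'I_n) hy.
- move=> y hy; rewrite mulN1r cabsN; apply: le_trans (cabs_sum _ _ _) _.
  apply: ler_sum => u _.
  by rewrite cabsM ler_wpM2l ?cabs_ge0//; exact: GM.
Qed.

End formula.

End polydisc.

(** In Cauchy's formula the kernels are geometric series in [z j / (r j * y j)], and
    the mean over the torus, being linear and bounded, can be taken term by term up
    to the uniform tail estimate [ker_trunc].  The coefficients are the means of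
    [f (r y) / y ^ u] divided by [r ^ u]. *)
Lemma cauchy_polydisc (R : realType) (n : nat) (f : ('I_n -> R[i]) -> R[i])
    (r : 'I_n -> R) (M : R) : (forall j, 0 < r j) ->
  (forall z, (forall j, cabs (z j) <= r j) -> cabs (f z) <= M) ->
  (forall z j, (forall k, cabs (z k) <= r k) ->
     exists B, cderiv (fun t => f (upd z j t)) (z j) B) ->
  exists c : multinom n -> R[i], (forall u, cabs (c u) * mon r u <= M) /\
    forall z, (forall j, cabs (z j) < r j) ->
      ccvg (fun N => \sum_(u <- box n N) c u * mon z u) (f z).
Proof.
move=> r0 fM fd; have [Phi [PD PZ Ple Peq Pcvg]] := mean_functional_exists R.
have t1 : torus (fun _ : 'I_n => 1 : R[i]) by move=> j; rewrite cabs1.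
exists (fun u => mean Phi (enum 'I_n)
  (fun y => f (fun j => (r j)%:C * y j) * (mon y u)^-1) (fun=> 1) / (mon r u)%:C).
split=> [u|z zr]; last exact: (cauchy_polydisc_cvg PD PZ Ple Peq Pcvg r0 fM fd zr t1).
have m0 := mon_gt0 u r0.
rewrite cabsM cabsV cabs_real gtr0_norm// divfK ?gt_eqF//.
apply: (@mean_le R n Phi Ple _ _ M) t1 => y hy; rewrite cabsM cabsV.
rewrite (_ : cabs (mon y u) = 1) ?invr1 ?mulr1; last first.
  by rewrite cabs_mon /mon big1// => j _; rewrite hy expr1n.
by apply: fM => j; rewrite cabsM cabs_real gtr0_norm// hy mulr1.
Qed.

(** * Holomorphic functions on Reinhardt domains *)

Section reinhardt.
Context (R : realType) (n : nat).
Local Notation C := R[i].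
Implicit Types (f : 'cV[C]_n -> C) (D : set 'cV[C]_n) (r : 'I_n -> R).

Definition vec (x : 'I_n -> C) : 'cV[C]_n := \col_j x j.

Lemma vecE x j : vec x j 0 = x j.
Proof. by rewrite mxE. Qed.

Lemma has_gradient_slice f (z : 'I_n -> C) d j : has_gradient f (vec z) d ->
  cderiv (fun t => f (vec (upd z j t))) (z j) (d j).
Proof.
move=> fd e e0; have [s s0 hs] := fd e e0; exists s => // t ht.
pose h : 'cV[C]_n := \col_k (if k == j then t - z j else 0).
have hh : vnorm h <= cabs (t - z j).
  apply/vnorm_le; first exact: cabs_ge0.
  by move=> k; rewrite mxE; case: eqP => _; rewrite ?cabs0 ?cabs_ge0.
have := hs h (le_lt_trans hh ht).
have -> : vec z + h = vec (upd z j t).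
  apply/matrixP => k l; rewrite !mxE /upd; case: eqP => [->|_]; last by rewrite addr0.
  by rewrite addrC subrK.
rewrite (bigD1 j)//= big1 => [|k /negbTE kj]; last by rewrite mxE kj mulr0.
rewrite addr0 mxE eqxx upd_id => /le_trans; apply.
by rewrite ler_wpM2l// ltW.
Qed.

Lemma has_gradient_bounded f z d : has_gradient f z d ->
  exists2 s : R, 0 < s & exists M, forall h, vnorm h < s -> cabs (f (z + h)) <= M.
Proof.
move=> fd; have [s s0 hs] := fd 1 ltr01; exists s => //.
exists (s + \sum_j cabs (d j) * s + cabs (f z)) => h hh.
have -> : f (z + h) = (f (z + h) - f z - \sum_j d j * h j 0)
   + \sum_j d j * h j 0 + f z by ring.
apply: le_trans (cabsD _ _) _; rewrite lerD2r.
apply: le_trans (cabsD _ _) _; apply: lerD.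
  by apply: le_trans (hs h hh) _; rewrite mul1r ltW.
apply: le_trans (cabs_sum _ _ _) _; apply: ler_sum => j _; rewrite cabsM.
by rewrite ler_wpM2l ?cabs_ge0// (le_trans (cabs_le_vnorm _ _) (ltW hh)).
Qed.

(** Closed polydiscs are compact: a sequence of points at which [f] blows up has
    a coordinatewise limit along an ultrafilter, where [f] is locally bounded. *)
Lemma holo_bounded f r :
  (forall z : 'I_n -> C, (forall j, cabs (z j) <= r j) -> exists d, has_gradient f (vec z) d) ->
  exists M, forall z : 'I_n -> C, (forall j, cabs (z j) <= r j) -> cabs (f (vec z)) <= M.
Proof.
move=> fd; apply: contrapT => /forallNP unb.
have /choice[z hz] : forall N : nat, exists z : 'I_n -> C,
    (forall j, cabs (z j) <= r j) /\ N%:R < cabs (f (vec z)).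
  move=> N; have /existsNP[z /not_implyP[h1 /negP]] := unb N%:R.
  by rewrite -ltNge => h2; exists z.
have [U [UU Uoo]] := nat_ultrafilter.
have UP : ProperFilter U := @ultra_proper _ _ UU.
pose y j := ulim U (fun N => z N j).
have yr j : cabs (y j) <= r j by apply: (ulim_le UU) => N; exact: (hz N).1.
have [d hd] := fd y yr; have [s s0 [M hM]] := has_gradient_bounded hd.
have near_y : U [set N | forall j, cabs (z N j - y j) <= s / 2].
  have h j : U [set N | cabs (z N j - y j) <= s / 2].
    have := @ulimP _ _ UU (fun N => z N j) (r j) (fun N => (hz N).1 j).
    by apply; rewrite divr_gt0.
  by apply: filter_forall => j; exact: h.
have big_N : U [set N | M <= N%:R].
  apply: Uoo; exists (Num.Def.archi_bound M) => // N /= hN.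
  have [M0|M0] := leP 0 M; last by rewrite (le_trans (ltW M0)).
  by rewrite (le_trans (ltW (archi_boundP M0)))// ler_nat.
have [N [/= h1 h2]] := filter_ex (filterI near_y big_N).
have := (hz N).2; apply/negP; rewrite -leNgt.
have -> : vec (z N) = vec y + (vec (z N) - vec y) by rewrite addrC subrK.
apply: le_trans h2; apply: hM; apply: (le_lt_trans (y := s / 2)); last by lra.
by apply/vnorm_le => [|j]; rewrite ?divr_ge0 ?(ltW s0)// !mxE.
Qed.

Definition reinhardt D := open D /\
  forall z w : 'cV[C]_n, D z -> (forall j, `|w j 0| <= `|z j 0|) -> D w.

Lemma reinhardt_polydisc D r (z : 'cV[C]_n) : reinhardt D ->
  D (vec (fun j => (r j)%:C)) -> (forall j, cabs (z j 0) <= r j) -> D z.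
Proof.
move=> [_ hD] Dr zr; apply: (hD _ z Dr) => j.
rewrite vecE !cabsE lecR cabs_real (le_trans (zr j))//.
exact: ler_norm.
Qed.

Lemma holo_power_series D f r : reinhardt D ->
  (forall z, D z -> differentiable (f : 'cV[C]_n -> C) z) ->
  (forall j, 0 < r j) -> D (vec (fun j => (r j)%:C)) ->
  exists c : multinom n -> C, (exists M, forall u, cabs (c u) * mon r u <= M) /\
    forall z : 'cV[C]_n, (forall j, cabs (z j 0) < r j) ->
      complex_sum (fun u => c u * mon (fun j => z j 0) u) = f z.
Proof.
move=> Dr fD r0 Drad.
have fd (z : 'I_n -> C) : (forall j, cabs (z j) <= r j) ->
    exists d, has_gradient f (vec z) d.
  move=> zr; apply/differentiableP_gradient/fD/(reinhardt_polydisc Dr Drad) => j.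
  by rewrite vecE.
have [M hM] := holo_bounded fd.
have [c [cM cz]] := @cauchy_polydisc R n (fun z => f (vec z)) r M r0 hM
  (fun z j zr => let: ex_intro d hd := fd z zr in
    ex_intro _ (d j) (has_gradient_slice j hd)).
exists c; split=> [|z zr]; first by exists M.
have sz : csummable (fun u => c u * mon (fun j => z j 0) u).
  apply: (csummable_exh (box_exhaustion n)).
  apply: (power_series_bound (t := fun j => cabs (z j 0)) r0 cM) => j.
  by rewrite lexx zr.
apply: ccvg_unique (csum_cvg (box_exhaustion n) sz) _.
rewrite [f z](_ : _ = f (vec (fun j => z j 0))); first exact: cz.
by congr f; apply/matrixP => j k; rewrite mxE (ord1 k).
Qed.

(** Openness at the point of coordinates [`|z j|] leaves room for larger radii. *)
Lemma reinhardt_radii D (z : 'cV[C]_n) : reinhardt D -> D z ->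
  exists r, [/\ forall j, cabs (z j 0) < r j, forall j, 0 < r j
    & D (vec (fun j => (r j)%:C))].
Proof.
move=> Dr Dz; have [oD hD] := Dr.
have Dm : D (vec (fun j => (cabs (z j 0))%:C)).
  by apply: (hD z) => // j; rewrite vecE !cabsE lecR cabs_real ger0_norm// cabs_ge0.
have /nbhs_vnorm[e e0 he] : nbhs (vec (fun j => (cabs (z j 0))%:C)) D.
  exact: open_nbhs_nbhs.
exists (fun j => cabs (z j 0) + e / 2); split=> [j|j|].
- by rewrite ltrDl divr_gt0.
- by rewrite ltr_wpDl ?cabs_ge0// divr_gt0.
have := he (vec (fun=> (e / 2)%:C)).
rewrite (_ : _ + _ = vec (fun j => (cabs (z j 0) + e / 2)%:C)); last first.
  by apply/matrixP => j k; rewrite !mxE -rmorphD.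
apply; apply: (le_lt_trans (y := e / 2)); last by lra.
apply/vnorm_le => [|j]; first by rewrite divr_ge0// ltW.
by rewrite vecE cabs_real ger0_norm// divr_ge0// ltW.
Qed.

End reinhardt.

(** * Rotations preserve Lebesgue measure *)

Section measure_preserving.
Local Open Scope ereal_scope.
Context d (T : measurableType d) (R : realType).
Implicit Types (f g : T -> T).

Definition preserves (mu : set T -> \bar R) f :=
  measurable_fun setT f /\ forall A, measurable A -> mu (f @^-1` A) = mu A.

Lemma preserves_comp mu f g : preserves mu f -> preserves mu g ->
  preserves mu (f \o g).
Proof.
move=> [mf hf] [mg hg]; split; first exact: measurableT_comp.
move=> A mA; rewrite comp_preimage hg ?hf//.
by rewrite -[X in measurable X]setTI; exact: mf.
Qed.

Lemma preserves_id mu : preserves mu id.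
Proof. by split. Qed.

Lemma preserves_integral (mu : {measure set T -> \bar R}) f E (h : T -> \bar R) :
  preserves mu f -> measurable E -> f @^-1` E = E ->
  measurable_fun E h -> (forall x, E x -> 0 <= h x) ->
  \int[mu]_(x in E) h (f x) = \int[mu]_(x in E) h x.
Proof.
move=> [mf hf] mE fE mh h0.
have := @ge0_integral_pushforward _ _ T T R f mf mu E h mE mh.
move=> /(_ _)/esym; rewrite fE => ->; last by move=> y; rewrite inE; exact: h0.
by apply: eq_measure_integral => A mA AE; exact: hf.
Qed.

End measure_preserving.

Section product_preserving.
Local Open Scope ereal_scope.
Context d1 d2 (T1 : measurableType d1) (T2 : measurableType d2) (R : realType).
Context (m1 : {sigma_finite_measure set T1 -> \bar R})
  (m2 : {sigma_finite_measure set T2 -> \bar R}).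

Lemma preserves_prod (f : T1 -> T1) (g : T2 -> T2) :
  preserves m1 f -> preserves m2 g ->
  preserves (m1 \x m2) (fun p : T1 * T2 => (f p.1, g p.2)).
Proof.
move=> [mf hf] [mg hg].
have mF : measurable_fun setT (fun p : T1 * T2 => (f p.1, g p.2)).
  apply/measurable_fun_pairP; split.
    by apply: (measurableT_comp mf); exact: measurable_fst.
  by apply: (measurableT_comp mg); exact: measurable_snd.
split=> // A mA; apply/esym.
rewrite (product_measure_unique (m' := pushforward (m1 \x m2)
  (fun p : T1 * T2 => (f p.1, g p.2)))) // => B C mB mC.
rewrite /pushforward -(hf B mB) -(hg C mC) -product_measure1E//.
- by rewrite -[X in measurable X]setTI; exact: mf.
- by rewrite -[X in measurable X]setTI; exact: mg.
Qed.

(** A shear translates each fibre; by Cavalieri it preserves the product measure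
    as soon as the translations preserve the measure on the fibres. *)
Lemma preserves_shear (s : T1 -> T2 -> T2) :
  measurable_fun setT (fun p : T1 * T2 => s p.1 p.2) ->
  (forall x, preserves m2 (s x)) ->
  preserves (m1 \x m2) (fun p : T1 * T2 => (p.1, s p.1 p.2)).
Proof.
move=> ms hs; split.
  by apply/measurable_fun_pairP; split => //; exact: measurable_fst.
move=> A mA; rewrite /product_measure1; apply: eq_integral => x _ /=.
rewrite -[RHS](hs x).2; last exact: measurable_xsection.
by congr (m2 _); apply/seteqP; split => y; rewrite /xsection/= !inE.
Qed.

Lemma preserves_shear_l (s : T2 -> T1 -> T1) :
  measurable_fun setT (fun p : T1 * T2 => s p.2 p.1) ->
  (forall x, preserves m1 (s x)) ->
  preserves (m1 \x m2) (fun p : T1 * T2 => (s p.2 p.1, p.2)).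
Proof.
move=> ms hs; set F := fun p : T1 * T2 => _.
have mF : measurable_fun setT F.
  by apply/measurable_fun_pairP; split => //; exact: measurable_snd.
have swapE A : measurable A -> (m1 \x m2) A = (m1 \x^ m2) A.
  move=> mA; apply: product_measure_unique => // B C mB mC.
  exact: product_measure2E.
split=> // A mA; rewrite !swapE//; last by rewrite -[X in measurable X]setTI; exact: mF.
rewrite /product_measure2; apply: eq_integral => y _ /=.
rewrite -[RHS](hs y).2; last exact: measurable_ysection.
by congr (m1 _); apply/seteqP; split => x; rewrite /ysection/= !inE.
Qed.

End product_preserving.

Section plane.
Context (R : realType).
Local Notation RR := (measurableTypeR R * measurableTypeR R)%type.
Local Notation C := R[i].

Lemma preserves_translation (a : R) :
  preserves (@lebesgue_measure R) (fun x : measurableTypeR R => x + a).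
Proof.
have mt : measurable_fun setT (fun x : measurableTypeR R => x + a).
  by apply: measurable_funD => //; exact: measurable_cst.
split=> // A mA; apply/esym.
rewrite (lebesgue_measure_unique (mu := pushforward lebesgue_measure
  ((fun x => x + a) : measurableTypeR R -> measurableTypeR R))) // => _ [[x y]] _ <-.
rewrite [RHS](_ : _ = lebesgue_measure `]x - a, y - a]%classic); last first.
  congr (lebesgue_measure _); apply/seteqP.
  by split => t /=; rewrite !in_itv/= ltrBlDr lerBrDr.
rewrite !lebesgue_measure_itv/= !lte_fin ltrD2r -!EFinB.
by case: ifP => // _; congr EFin; ring.
Qed.

Definition rot (w : C) (p : RR) : RR :=
  (complex.Re w * p.1 - complex.Im w * p.2, complex.Im w * p.1 + complex.Re w * p.2).

Definition c_of (p : RR) : C := p.1 +i* p.2.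

Lemma c_of_rot w p : c_of (rot w p) = w * c_of p.
Proof. by case: w => a b; apply/eqP; rewrite eq_complex/= addrC (addrC (b * _)) !eqxx. Qed.

Lemma preserves_vshear (a : R) :
  preserves (@lebesgue2 R) (fun p : RR => (p.1, p.2 + a * p.1 : measurableTypeR R)).
Proof.
apply: (@preserves_shear _ _ _ _ R lebesgue_measure lebesgue_measure
  (fun x y : measurableTypeR R => y + a * x)) => [|x]; last exact: preserves_translation.
by apply: measurable_funD => //; apply: measurable_funM => //; exact: measurable_cst.
Qed.

Lemma preserves_hshear (a : R) :
  preserves (@lebesgue2 R) (fun p : RR => (p.1 + a * p.2 : measurableTypeR R, p.2)).
Proof.
apply: (@preserves_shear_l _ _ _ _ R lebesgue_measure lebesgue_measure
  (fun x y : measurableTypeR R => y + a * x)) => [|x]; last exact: preserves_translation.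
by apply: measurable_funD => //; apply: measurable_funM => //; exact: measurable_cst.
Qed.

(** A rotation with nonzero sine is a product of three shears; the half-turn is
    the square of a quarter-turn. *)
Lemma preserves_rot (w : C) : cabs w = 1 -> preserves (@lebesgue2 R) (rot w).
Proof.
have gen (v : C) : cabs v = 1 -> complex.Im v != 0 -> preserves (@lebesgue2 R) (rot v).
  case: v => c s /=; rewrite -[cabs _ = 1]/(_ = _) => v1 s0.
  have cs : c ^+ 2 + s ^+ 2 = 1 by have := sqr_cabs (c +i* s); rewrite v1 expr1n.
  pose a := (c - 1) / s.
  have := preserves_comp (preserves_hshear a)
    (preserves_comp (preserves_vshear s) (preserves_hshear a)).
  congr preserves; apply/funext => -[x y] /=; rewrite /rot /=.
  have as_ : a * s = c - 1 by rewrite /a divfK.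
  congr (_, _); last first.
    rewrite mulrDr addrCA; congr (_ + _).
    by rewrite mulrA (mulrC s) as_; ring.
  have a2 : a * (1 + c) = - s.
    apply: (mulIf s0); rewrite mulrAC as_ mulNr -expr2.
    have -> : s ^+ 2 = 1 - c ^+ 2 by rewrite -cs; ring.
    ring.
  have -> : x + a * y + a * (y + s * (x + a * y)) =
    x + (a * s) * x + (a + a * (1 + a * s)) * y by ring.
  rewrite as_ (_ : a + a * (1 + (c - 1)) = a * (1 + c)); last by ring.
  by rewrite a2; ring.
move=> w1; have [w0|] := eqVneq (complex.Im w) 0; last exact: gen.
have : complex.Re w ^+ 2 = 1 by have := sqr_cabs w; rewrite w1 w0 expr1n expr0n addr0.
move/eqP; rewrite sqrf_eq1 => /orP[] /eqP wr.
  rewrite (_ : rot w = id); first exact: preserves_id.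
  by apply/funext => -[x y]; rewrite /rot w0 wr /=; congr (_, _); ring.
have hi : preserves (@lebesgue2 R) (rot 'i).
  by apply: gen; rewrite ?oner_neq0//= /cabs normc_def/= expr0n expr1n add0r sqrtr1.
have := preserves_comp hi hi; congr preserves; apply/funext => -[x y].
by rewrite /rot /= w0 wr; congr (_, _); ring.
Qed.

Context (n : nat).

Definition tmap (w : 'I_n -> C) (t : n.-tuple RR) : n.-tuple RR :=
  mktuple (fun j => rot (w j) (tnth t j)).

End plane.

Section space.
Context (R : realType).
Local Notation RR := (measurableTypeR R * measurableTypeR R)%type.
Local Notation C := R[i].

Lemma preserves_tmap n (w : 'I_n -> C) : (forall j, cabs (w j) = 1) ->
  preserves (lebesgueC R n) (tmap w).
Proof.
elim: n w => [|n IH] w w1.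
  rewrite (_ : tmap w = id); first exact: preserves_id.
  by apply/funext => t; apply/eq_from_tnth => -[].
have mT : measurable_fun setT (tmap w).
  apply/measurable_fun_tnthP => j.
  rewrite (_ : _ \o _ = rot (w j) \o (@tnth n.+1 RR)^~ j); last first.
    by apply/funext => t /=; rewrite tnth_mktuple.
  by apply: measurableT_comp; [exact: (preserves_rot (w1 j)).1|exact: measurable_tnth].
split=> // A mA.
have [_ h] := preserves_prod (preserves_rot (w1 ord0))
  (IH (fun j => w (lift ord0 j)) (fun j => w1 _)).
have mtA : measurable (@tcons R n @^-1` A).
  by rewrite -[X in measurable X]setTI; exact: measurable_tcons.
pose F (p : RR * n.-tuple RR) :=
  (rot (w ord0) p.1, tmap (fun j => w (lift ord0 j)) p.2).
have key p : tmap w (tcons p) = tcons (F p).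
  case: p => x t; apply/eq_from_tnth => j; rewrite tnth_mktuple.
  by case: (unliftP ord0 j) => [k ->|->] //=; rewrite !tnthS tnth_mktuple.
have E : @tcons R n @^-1` (tmap w @^-1` A) = F @^-1` (@tcons R n @^-1` A).
  by apply/funext => p; rewrite -[LHS]/(A (tmap w (tcons p))) key.
rewrite /= /lebesgue_step /pushforward -[RHS](h _ mtA).
by rewrite E.
Qed.

Lemma cvec_tmap n (w : 'I_n -> C) t j :
  cvec (tmap w t) j 0 = w j * cvec t j 0.
Proof. by rewrite !mxE tnth_mktuple; exact: c_of_rot. Qed.

End space.

(** * Measurability and size of sets of complex vectors *)

Section measurability.
Context (R : realType) (n : nat).
Local Notation RR := (measurableTypeR R * measurableTypeR R)%type.
Local Notation C := R[i].
Local Notation mu := (lebesgueC R n).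
Local Notation cv := (@cvec R n).

Lemma measurable_box (A : 'I_n -> set RR) : (forall j, measurable (A j)) ->
  measurable [set t : n.-tuple RR | forall j, A j (tnth t j)].
Proof.
move=> mA.
rewrite (_ : mkset _ = \bigcap_(j in [set: 'I_n]) ((@tnth n RR)^~ j @^-1` A j)).
  apply: fin_bigcap_measurable => [|i _]; first exact: finite_finset.
  by rewrite -[X in measurable X]setTI; exact: measurable_tnth.
by apply/seteqP; split => t /= h j; [move=> _; exact: h|exact: (h j)].
Qed.

Lemma measurable_open (D : set 'cV[C]_n) : open D -> measurable (cv @^-1` D).
Proof.
move=> oD.
pose side (q : {ffun 'I_n -> rat * rat} * nat) (x : rat) : set (measurableTypeR R) :=
  `]ratr x - q.2.+1%:R^-1, ratr x + q.2.+1%:R^-1[%classic.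
pose box q := [set t : n.-tuple RR | forall j,
  (side q (q.1 j).1 `*` side q (q.1 j).2) (tnth t j)].
have mbox q : measurable (box q).
  apply: (@measurable_box (fun j => side q (q.1 j).1 `*` side q (q.1 j).2)) => j.
  by apply: measurableX; exact: measurable_itv.
rewrite (_ : _ @^-1` _ =
  \bigcup_q (if pselect (box q `<=` cv @^-1` D) then box q else set0)); last first.
  apply/seteqP; split => t /=; last first.
    by move=> [q _]; case: pselect => // h; exact: h.
  move=> Dt; have /nbhs_vnorm[e e0 he] : nbhs (cv t) D by exact: open_nbhs_nbhs.
  have [k ke] : exists k, 4 / k.+1%:R < e.
    exists (Num.Def.archi_bound (4 / e)).
    rewrite ltr_pdivrMr ?ltr0n// mulrC -ltr_pdivrMr//.
    have e4 : 0 <= 4 / e by rewrite divr_ge0// ltW.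
    by apply: lt_le_trans (archi_boundP e4) _; rewrite ler_nat.
  have k0 : 0 < k.+1%:R :> R by rewrite ltr0n.
  have i0 : 0 < k.+1%:R^-1 :> R by rewrite invr_gt0.
  have approx (x : R) : exists q : rat, ratr q - k.+1%:R^-1 < x < ratr q + k.+1%:R^-1.
    have [|q] := @rat_in_itvoo R (x - k.+1%:R^-1) (x + k.+1%:R^-1).
      by rewrite ltrBlDr -addrA ltrDl addr_gt0.
    by rewrite in_itv/= => /andP[h1 h2]; exists q; rewrite ltrBlDr h2 -ltrBlDr h1.
  have [q1 hq1] := choice (fun j : 'I_n => approx (tnth t j).1).
  have [q2 hq2] := choice (fun j : 'I_n => approx (tnth t j).2).
  pose q := ([ffun j => (q1 j, q2 j)], k).
  have tq : box q t by move=> j; split; rewrite /side/= in_itv/= !ffunE/=; [exact: hq1|exact: hq2].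
  exists q => //; case: pselect => // -[] s sq /=.
  have -> : cv s = cv t + (cv s - cv t) by rewrite addrC subrK.
  apply: he; apply: le_lt_trans ke; apply/vnorm_le => [|j].
    by rewrite divr_ge0 ?ler0n.
  rewrite !mxE; apply: le_trans (cabs_le_ReIm _) _ => /=.
  have [] := sq j; have [] := tq j; rewrite /side/= !in_itv/= !ffunE/=.
  set d := k.+1%:R^-1 => /andP[a1 a2] /andP[a3 a4] /andP[b1 b2] /andP[b3 b4].
  have -> : 4 / k.+1%:R = 2 * d + 2 * d by rewrite /d; field; rewrite gt_eqF.
  by apply: lerD; rewrite ler_norml; apply/andP; split; lra.
apply: countable_bigcupT_measurable => [|q]; first exact: countableP.
by case: (pselect _) => ?; [exact: mbox|exact: measurable0].
Qed.

(** Continuity at the points of [D], in terms of real-valued moduli, so that it passes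
    directly to real and imaginary parts. *)
Definition cont_on (D : set 'cV[C]_n) (f : 'cV[C]_n -> C) := forall z, D z ->
  forall e : R, 0 < e -> exists2 s : R, 0 < s &
    forall h, vnorm h < s -> cabs (f (z + h) - f z) <= e.

Lemma differentiable_cont_on D (f : 'cV[C]_n -> C) :
  (forall z, D z -> differentiable (f : 'cV[C]_n -> C) z) -> cont_on D f.
Proof.
move=> fD z /fD/differentiableP_gradient[d hd] e e0.
have [s s0 hs] := hd 1 ltr01.
pose K := 1 + \sum_j cabs (d j).
have K0 : 0 < K by apply: ltr_pwDl => //; apply: sumr_ge0 => j _; exact: cabs_ge0.
exists (Num.min s (e / K)); first by rewrite lt_min s0 divr_gt0.
move=> h; rewrite lt_min => /andP[/hs h1 h2].
have -> : f (z + h) - f z = (f (z + h) - f z - \sum_j d j * h j 0)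
   + \sum_j d j * h j 0 by ring.
apply: le_trans (cabsD _ _) _; apply: (le_trans (y := K * vnorm h)); last first.
  by move: h2; rewrite ltr_pdivlMr// mulrC => /ltW.
rewrite mulrDl mul1r; apply: lerD; first by rewrite mul1r in h1.
apply: le_trans (cabs_sum _ _ _) _; rewrite mulr_suml; apply: ler_sum => j _.
by rewrite cabsM ler_wpM2l ?cabs_ge0// cabs_le_vnorm.
Qed.

Lemma measurable_cont (D : set 'cV[C]_n) (phi : 'cV[C]_n -> R) : open D ->
  (forall z, D z -> forall e : R, 0 < e -> exists2 s : R, 0 < s &
    forall h, vnorm h < s -> `|phi (z + h) - phi z| <= e) ->
  measurable_fun (cv @^-1` D) (fun t => phi (cv t)).
Proof.
move=> oD cphi; apply: (measurability _ (RGenOInfty.measurableE R)).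
move=> _ [_ [x ->] <-].
rewrite (_ : _ `&` _ = cv @^-1` (D `&` [set z | x < phi z])); last first.
  by apply/seteqP; split => t /= [Dt]; rewrite in_itv/= andbT.
apply: measurable_open; rewrite openE => z [Dz /= xz].
have : nbhs z D by exact: open_nbhs_nbhs.
move=> /nbhs_vnorm[e e0 he]; have e2 : 0 < (phi z - x) / 2 by lra.
have [s s0 hs] := cphi z Dz _ e2.
apply/nbhs_vnorm; exists (Num.min e s); first by rewrite lt_min e0.
move=> h; rewrite lt_min => /andP[/he h1 /hs]; rewrite ler_norml => h2.
by split => //=; lra.
Qed.

Lemma measurable_Re D (f : 'cV[C]_n -> C) : open D -> cont_on D f ->
  measurable_fun (cv @^-1` D) (fun t => complex.Re (f (cv t))).
Proof.
move=> oD cf; apply: (@measurable_cont _ (fun z => complex.Re (f z))) => //.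
move=> z Dz e e0; have [s s0 hs] := cf z Dz e e0; exists s => // h /hs.
by apply: le_trans; rewrite -raddfB; exact: cabs_ge_Re.
Qed.

Lemma measurable_Im D (f : 'cV[C]_n -> C) : open D -> cont_on D f ->
  measurable_fun (cv @^-1` D) (fun t => complex.Im (f (cv t))).
Proof.
move=> oD cf; apply: (@measurable_cont _ (fun z => complex.Im (f z))) => //.
move=> z Dz e e0; have [s s0 hs] := cf z Dz e e0; exists s => // h /hs.
by apply: le_trans; rewrite -raddfB; exact: cabs_ge_Im.
Qed.

Lemma measurable_cabs2 D (f : 'cV[C]_n -> C) : open D -> cont_on D f ->
  measurable_fun (cv @^-1` D) (fun t => cabs (f (cv t)) ^+ 2).
Proof.
move=> oD cf; under eq_fun do rewrite sqr_cabs.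
by apply: measurable_funD; apply: measurable_funX; [exact: measurable_Re|exact: measurable_Im].
Qed.

Lemma bounded_vnorm (D : set 'cV[C]_n) : bounded_set D ->
  exists2 B : R, 0 < B & forall z, D z -> vnorm z <= B.
Proof.
move=> [M [Mr hM]]; pose B := `|complex.Re M| + 1.
exists B => [|z Dz]; first by rewrite ltr_wpDl.
rewrite -lecR -vnormE; apply: (hM B%:C) => //.
have -> : M = (complex.Re M)%:C by rewrite RRe_real.
by rewrite ltcR (le_lt_trans (ler_norm _))// ltrDl.
Qed.

Lemma lebesgue2_rect (a b c d : R) : a < b -> c < d ->
  lebesgue2 (`[a, b]%classic `*` `[c, d]%classic) = ((b - a) * (d - c))%:E.
Proof.
move=> ab cd.
have h (x y : R) : x < y ->
    lebesgue_measure (`[x, y]%classic : set (measurableTypeR R)) = (y - x)%:E.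
  by move=> xy; rewrite lebesgue_measure_itv/= lte_fin xy.
rewrite /lebesgue2 product_measure1E; try exact: measurable_itv.
by rewrite -[LHS]/(lebesgue_measure _ * lebesgue_measure _)%E !h.
Qed.

Lemma bounded_finite_measure (D : set 'cV[C]_n) : open D -> bounded_set D ->
  (mu (cv @^-1` D) < +oo)%E.
Proof.
move=> oD /bounded_vnorm[B B0 hB].
pose I : set RR := `[- B, B]%classic `*` `[- B, B]%classic.
have mI : measurable I by apply: measurableX; exact: measurable_itv.
have IE : lebesgue2 I = ((B + B) * (B + B))%:E.
  by rewrite /I lebesgue2_rect ?gtrN// opprK.
apply: (@le_lt_trans _ _ (mu [set t | forall j : 'I_n, I (tnth t j)])).
  apply: le_measure; rewrite ?inE; [exact: measurable_open|exact: (@measurable_box (fun=> I))|].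
  move=> t /= /hB ht j; have := le_trans (cabs_le_vnorm (cv t) j) ht.
  rewrite mxE => h; split; rewrite /= in_itv/= -ler_norml.
    exact: le_trans (cabs_ge_Re _) h.
  exact: le_trans (cabs_ge_Im _) h.
rewrite (@lebesgueC_box _ n (fun=> I))// (eq_bigr (fun=> ((B + B) * (B + B))%:E)) => [|j _]; last exact: IE.
by rewrite prodEFin ltry.
Qed.

(** A set on which every monomial is at least as large as on the torus of radii
    [rho]; its measure enters the lower bound for the norms of monomials. *)
Lemma polyannulus (D : set 'cV[C]_n) (rho r : 'I_n -> R) :
  reinhardt D -> D (vec (fun j => (r j)%:C)) ->
  (forall j, 0 <= rho j < r j) ->
  exists B : set (n.-tuple RR), [/\ measurable B, B `<=` cv @^-1` D,
    exists2 m : R, 0 < m & mu B = m%:E &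
    forall t, B t -> forall j, rho j <= cabs (cv t j 0)].
Proof.
move=> Dr Dvec rr.
pose d j := (r j - rho j) / 2.
have d0 j : 0 < d j by rewrite /d; have := rr j; lra.
pose I j : set RR := `[rho j, rho j + d j]%classic `*` `[0, d j]%classic.
have mI j : measurable (I j) by apply: measurableX; exact: measurable_itv.
have IE j : lebesgue2 (I j) = (d j * d j)%:E.
  by rewrite /I lebesgue2_rect ?ltrDl//; congr EFin; ring.
exists [set t | forall j, I j (tnth t j)]; split.
- exact: (@measurable_box I).
- move=> t ht; apply: (reinhardt_polydisc Dr Dvec) => j; rewrite mxE.
  apply: le_trans (cabs_le_ReIm _) _ => /=.
  have [/=] := ht j; rewrite !in_itv/= => /andP[h1 h2] /andP[h3 h4].
  have /andP[r0 _] := rr j.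
  by rewrite !ger0_norm//; [rewrite /d in h2 h4; lra|exact: le_trans h1].
- exists (\prod_j (d j * d j)); first by apply: prodr_gt0 => j _; rewrite mulr_gt0.
  by rewrite (@lebesgueC_box _ n I)// (eq_bigr _ (fun j _ => IE j)) prodEFin.
- move=> t ht j; rewrite mxE; apply: le_trans (cabs_ge_Re _) => /=.
  by have [/=] := ht j; rewrite !in_itv/= => /andP[h1 _] _; apply: le_trans h1 (ler_norm _).
Qed.

End measurability.

(** * Parseval's identity *)

Section parseval.
Context (R : realType) (n : nat).
Local Notation RR := (measurableTypeR R * measurableTypeR R)%type.
Local Notation C := R[i].
Local Notation mu := (lebesgueC R n).
Local Notation cv := (@cvec R n).
Implicit Types (E : set (n.-tuple RR)) (u v : multinom n) (c : multinom n -> C).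

Definition monc u (t : n.-tuple RR) : C := mon (fun j => cv t j 0) u.

Definition torus_invariant E := forall w : 'I_n -> C, (forall j, cabs (w j) = 1) ->
  tmap w @^-1` E = E.

Lemma monc_tmap (w : 'I_n -> C) u t : monc u (tmap w t) = mon w u * monc u t.
Proof.
rewrite /monc -monM; congr (mon _ _); apply/funext => j.
exact: cvec_tmap.
Qed.

Lemma cabs_monc_tmap (w : 'I_n -> C) u t : (forall j, cabs (w j) = 1) ->
  cabs (monc u (tmap w t)) = cabs (monc u t).
Proof.
move=> w1; rewrite monc_tmap cabsM cabs_mon.
by rewrite /mon big1 ?mul1r// => j _; rewrite w1 expr1n.
Qed.

(** A rotation that changes the sign of [z ^ u] times the conjugate of [z ^ v] forces
    the integral of this product to vanish.  It acts on a coordinate where the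
    exponents differ, by a root of [-1] of order the difference. *)
Lemma rotation_separates u v : u != v -> exists w : 'I_n -> C,
  (forall j, cabs (w j) = 1) /\ mon w u * (mon w v)^*%C = -1.
Proof.
have sym a b : (exists w : 'I_n -> C, (forall j, cabs (w j) = 1) /\
    mon w a * (mon w b)^*%C = -1) -> exists w : 'I_n -> C,
    (forall j, cabs (w j) = 1) /\ mon w b * (mon w a)^*%C = -1.
  move=> [w [w1 h]]; exists w; split => //.
  have := congr1 (@conjc R) h; rewrite rmorphM/= conjcK mulrC => ->.
  by apply/eqP; rewrite eq_complex /= !oppr0 !eqxx.
have key (a b : multinom n) (j : 'I_n) : (b j < a j)%N -> exists w : 'I_n -> C,
    (forall j, cabs (w j) = 1) /\ mon w a * (mon w b)^*%C = -1.
  move=> ba; pose k := (a j - b j)%N.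
  have k0 : (0 < k)%N by rewrite subn_gt0.
  have [z zk] : exists z : C, z ^+ k = -1.
    have /closed_rootP[z] : size ('X^k + 1%:P : {poly C}) != 1.
      by rewrite size_polyDl size_polyXn ?size_polyC ?oner_neq0 ?ltnS// eqSS -lt0n.
    by rewrite rootE hornerD hornerXn hornerC addr_eq0 => /eqP; exists z.
  have z1 : cabs z = 1.
    apply/eqP; rewrite -(@eqrXn2 _ k)// ?cabs_ge0// expr1n -cabsX zk.
    by rewrite cabsN cabs1.
  exists (fun i => if i == j then z else 1); split.
    by move=> i; case: ifP => _; rewrite ?cabs1.
  have monj (q : multinom n) : mon (fun i => if i == j then z else 1 : C) q = z ^+ q j.
    rewrite /mon (bigD1 j)//= eqxx big1 ?mulr1// => i /negbTE ->.
    by rewrite expr1n.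
  rewrite !monj -(subnK (ltnW ba)) exprD -/k zk -mulrA rmorphXn/= -exprMn.
  by rewrite -sqr_cabsE z1 expr1n expr1n mulr1.
move=> uv; have [j jP] : exists j, u j != v j.
  by apply: contrapT => /forallNP h; move/eqP: uv; apply; apply/mnmP => j;
    apply/eqP/negPn/negP/h.
move: jP; rewrite neq_ltn => /orP[h|h]; [apply: sym|]; exact: key h.
Qed.

Lemma preserves_integralE f E (h : n.-tuple RR -> \bar R) : preserves mu f ->
  measurable E -> f @^-1` E = E -> measurable_fun E h ->
  (\int[mu]_(x in E) h (f x) = \int[mu]_(x in E) h x)%E.
Proof.
move=> pf mE fE mh; rewrite integralE [RHS]integralE; congr (_ - _)%E.
- have := preserves_integral pf mE fE (measurable_funepos mh) (fun x _ => funepos_ge0 h x).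
  by move=> <-; apply: eq_integral => x _; rewrite !funeposE.
- have := preserves_integral pf mE fE (measurable_funeneg mh) (fun x _ => funeneg_ge0 h x).
  by move=> <-; apply: eq_integral => x _; rewrite !funenegE.
Qed.

Lemma differentiable_mon u (z : 'cV[C]_n) :
  differentiable ((fun z => mon (fun j => z j 0) u) : 'cV[C]_n -> C) z.
Proof.
rewrite (_ : (fun _ => _) =
  \prod_(j <- flat u) (fun z : 'cV[C]_n => z j 0 : C)); last first.
  by apply/funext => x; rewrite mon_flat fct_prodE.
elim/big_ind: _ => [|f g|j _]; first exact: differentiable_cst.
  exact: differentiableM.
exact: differentiable_coord.
Qed.

Lemma differentiable_mon_sum (s : seq (multinom n)) c (z : 'cV[C]_n) :
  differentiable
    ((fun z => \sum_(u <- s) c u * mon (fun j => z j 0) u) : 'cV[C]_n -> C) z.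
Proof.
rewrite (_ : (fun _ => _) = \sum_(u <- s)
  (fun z : 'cV[C]_n => c u *: (mon (fun j => z j 0) u : C^o))); last first.
  by apply/funext => x; rewrite fct_sumE.
elim/big_ind: _ => [|f g|u _]; first exact: differentiable_cst.
  exact: differentiableD.
by apply: differentiableZ; exact: differentiable_mon.
Qed.

Lemma cont_mon u : cont_on setT (fun z : 'cV[C]_n => mon (fun j => z j 0) u).
Proof. by apply: differentiable_cont_on => z _; exact: differentiable_mon. Qed.

Lemma measurable_monc_Re d u v E : measurable_fun E (fun t =>
  complex.Re (d * (monc u t * (monc v t)^*%C))).
Proof.
apply: (measurable_funS (E := setT)) => //.
have mr w : measurable_fun setT (fun t => complex.Re (monc w t)).
  exact: (@measurable_Re R n setT _ openT (cont_mon w)).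
have mi w : measurable_fun setT (fun t => complex.Im (monc w t)).
  exact: (@measurable_Im R n setT _ openT (cont_mon w)).
have -> : (fun t => complex.Re (d * (monc u t * (monc v t)^*%C))) = (fun t =>
  complex.Re d * (complex.Re (monc u t) * complex.Re (monc v t)
     + complex.Im (monc u t) * complex.Im (monc v t))
  - complex.Im d * (complex.Im (monc u t) * complex.Re (monc v t)
     - complex.Re (monc u t) * complex.Im (monc v t))).
  apply/funext => t; case: d (monc u t) (monc v t) => a b [x y] [x' y'] /=; ring.
apply: measurable_funB; apply: measurable_funM; try exact: measurable_cst.
  by apply: measurable_funD; apply: measurable_funM.
by apply: measurable_funB; apply: measurable_funM.
Qed.

Section fixed_set.
Context E (mE : measurable E) (tE : torus_invariant E) (Eoo : (mu E < +oo)%E).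
Context (B : R) (B1 : 1 <= B) (EB : forall t, E t -> forall j, cabs (cv t j 0) <= B).

Lemma monc_le u t : E t -> cabs (monc u t) <= B ^+ mdeg u.
Proof.
move=> Et; rewrite cabs_mon mdegE expr_sum.
apply: ler_prod => j _; rewrite exprn_ge0 ?cabs_ge0//=.
by rewrite lerXn2r ?nnegrE ?cabs_ge0 ?EB// (le_trans ler01).
Qed.

Lemma bounded_integrable (h : n.-tuple RR -> R) (M : R) : measurable_fun E h ->
  (forall t, E t -> `|h t| <= M) -> mu.-integrable E (EFin \o h).
Proof.
move=> mh hM; apply: measurable_bounded_integrable => //.
exists M; split; first exact: num_real.
by move=> x Mx t Et; rewrite /= (le_trans (hM t Et))// ltW.
Qed.

Definition msq E u : \bar R := (\int[mu]_(t in E) (cabs (monc u t) ^+ 2)%:E)%E.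

Lemma integrable_monc d u v : mu.-integrable E
  (EFin \o (fun t => complex.Re (d * (monc u t * (monc v t)^*%C)))).
Proof.
apply: (@bounded_integrable _ (cabs d * (B ^+ mdeg u * B ^+ mdeg v))).
  exact: measurable_monc_Re.
move=> t Et; apply: le_trans (cabs_ge_Re _) _; rewrite !cabsM cabs_conj.
by rewrite ler_wpM2l ?cabs_ge0// ler_pM ?cabs_ge0 ?monc_le.
Qed.

(** The scalar [d] makes real parts sufficient for complex orthogonality. *)
Lemma monc_orthogonal d u v : u != v ->
  (\int[mu]_(t in E) (complex.Re (d * (monc u t * (monc v t)^*%C)))%:E = 0)%E.
Proof.
move=> /rotation_separates[w [w1 hw]].
pose h t := complex.Re (d * (monc u t * (monc v t)^*%C)).
have ih : mu.-integrable E (EFin \o h) := integrable_monc d u v.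
have := preserves_integralE (preserves_tmap w1) mE (tE w1) (measurable_int mu ih).
have -> : (\int[mu]_(t in E) (EFin \o h) (tmap w t) =
    \int[mu]_(t in E) (- (EFin \o h) t))%E.
  apply: eq_integral => t _.
  rewrite -[LHS]/((h (tmap w t))%:E) -[RHS]/((- h t)%:E); congr EFin; rewrite /h.
  rewrite !monc_tmap rmorphM/= -raddfN; congr complex.Re.
  have -> : d * (mon w u * monc u t * ((mon w v)^*%C * (monc v t)^*%C)) =
    (mon w u * (mon w v)^*%C) * (d * (monc u t * (monc v t)^*%C)) by ring.
  by rewrite hw mulN1r.
rewrite integralN; last by apply: integrable_add_def.
have := integrable_fin_num mE ih.
rewrite -[X in (- X)%E = _ -> _]/(\int[mu]_(t in E) (h t)%:E)%E.
rewrite -[X in _ = X -> _]/(\int[mu]_(t in E) (h t)%:E)%E.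
rewrite -/(h _); case: (\int[mu]_(t in E) _)%E => [x||]//= _ [].
by move=> xx; congr EFin; lra.
Qed.

Lemma msq_fin u : msq E u \is a fin_num.
Proof.
have h := integrable_monc 1 u u.
have := integrable_fin_num mE h; congr (_ \is a fin_num).
apply: eq_integral => t _ /=; congr EFin.
by rewrite mul1r -sqr_cabsE.
Qed.

Lemma integral_sum_EFin (I : eqType) (s : seq I) (h : I -> n.-tuple RR -> R) :
  (forall i, mu.-integrable E (EFin \o h i)) ->
  (\int[mu]_(t in E) (\sum_(i <- s) h i t)%:E =
   \sum_(i <- s) \int[mu]_(t in E) (h i t)%:E)%E.
Proof.
move=> ih; elim: s => [|i s IH].
  by rewrite big_nil; under eq_integral do rewrite big_nil; exact: integral0.
under eq_integral do rewrite big_cons EFinD.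
rewrite big_cons -IH; apply: integralD => //; first exact: ih.
under eq_fun do rewrite -sumEFin.
by apply: integrable_sum => // j _; exact: ih.
Qed.

Lemma parseval_finite c (A : {fset multinom n}) :
  (\int[mu]_(t in E) (cabs (\sum_(u <- A) c u * monc u t) ^+ 2)%:E =
   \sum_(u <- A) (cabs (c u) ^+ 2)%:E * msq E u)%E.
Proof.
have E1 t : cabs (\sum_(u <- A) c u * monc u t) ^+ 2 =
    \sum_(u <- A) \sum_(v <- A) complex.Re
      ((c u * (c v)^*%C) * (monc u t * (monc v t)^*%C)).
  transitivity (complex.Re ((cabs (\sum_(u <- A) c u * monc u t) ^+ 2)%:C)) => //.
  rewrite sqr_cabsE rmorph_sum/= mulr_suml raddf_sum; apply: eq_bigr => u _.
  rewrite mulr_sumr raddf_sum; apply: eq_bigr => v _; congr complex.Re.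
  by rewrite rmorphM/=; ring.
under eq_integral do rewrite E1.
rewrite integral_sum_EFin => [|u]; last first.
  rewrite (_ : _ \o _ = (fun t => \sum_(v <- A) (complex.Re
      ((c u * (c v)^*%C) * (monc u t * (monc v t)^*%C)))%:E)%E); last first.
    by apply/funext => t; rewrite /= sumEFin.
  by apply: integrable_sum => // v _; exact: integrable_monc.
apply: eq_big_seq => u uA.
rewrite integral_sum_EFin => [|v]; last exact: integrable_monc.
rewrite (big_fsetD1 u)//= big_seq big1 ?adde0 => [|v]; last first.
  by rewrite !inE => /andP[vu _]; rewrite monc_orthogonal// eq_sym.
rewrite /msq -ge0_integralZl_EFin//=.
- apply: eq_integral => t _; rewrite -EFinM; congr EFin.
  by rewrite -!sqr_cabsE -rmorphM.
- by move=> t _; rewrite lee_fin sqr_ge0.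
- apply/measurable_EFinP; have := @measurable_monc_Re 1 u u E.
  by under eq_fun do rewrite mul1r -sqr_cabsE.
- by rewrite sqr_ge0.
Qed.

Lemma parseval_bounded c (f : n.-tuple RR -> C) (K : R) :
  measurable_fun E (fun t => cabs (f t) ^+ 2) ->
  (forall t, E t -> ccvg (fun N => \sum_(u <- box n N) c u * monc u t) (f t)) ->
  (forall t, E t -> forall N, \sum_(u <- box n N) cabs (c u * monc u t) <= K) ->
  (\int[mu]_(t in E) (cabs (f t) ^+ 2)%:E =
   \esum_(u in setT) ((cabs (c u) ^+ 2)%:E * msq E u))%E.
Proof.
move=> mf cf cK.
pose S N t := \sum_(u <- box n N) c u * monc u t.
have mS N : measurable_fun E (fun t => cabs (S N t) ^+ 2).
  have cS : cont_on setT (fun z : 'cV[C]_n =>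
      \sum_(u <- box n N) c u * mon (fun j => z j 0) u).
    by apply: differentiable_cont_on => z _; exact: differentiable_mon_sum.
  by apply: (measurable_funS (E := setT)) => //; exact: (measurable_cabs2 openT cS).
have SK N t : E t -> cabs (S N t) ^+ 2 <= K ^+ 2.
  move=> Et; have h := le_trans (cabs_sum _ _ _) (cK t Et N).
  by rewrite lerXn2r ?nnegrE ?cabs_ge0// (le_trans (cabs_ge0 (S N t))).
have iK : mu.-integrable E (EFin \o cst (K ^+ 2)).
  apply: (@bounded_integrable _ (K ^+ 2)) => [|t _]; first exact: measurable_cst.
  by rewrite ger0_norm// sqr_ge0.
have [] := @dominated_convergence _ _ R mu E mE
  (fun N t => (cabs (S N t) ^+ 2)%:E) (fun t => (cabs (f t) ^+ 2)%:E)
  (EFin \o cst (K ^+ 2)) _ _ _ iK _.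
- by move=> N; apply/measurable_EFinP; exact: mS.
- by apply/measurable_EFinP; exact: mf.
- apply: aeW => t Et; apply: cvg_EFin; first by near=> N.
  by apply: cvgM; exact: (ccvg_cabs (cf t Et)).
- apply: aeW => t N Et; rewrite gee0_abs ?lee_fin ?sqr_ge0//.
  exact: SK.
move=> _ _ cv; pose a u : R := cabs (c u) ^+ 2 * fine (msq E u).
have a0 u : 0 <= a u.
  rewrite mulr_ge0 ?sqr_ge0// fine_ge0//; apply: integral_ge0 => t _.
  by rewrite lee_fin sqr_ge0.
have aE u : ((cabs (c u) ^+ 2)%:E * msq E u)%E = (a u)%:E.
  by rewrite /a [RHS]EFinM fineK// msq_fin.
under eq_esum do rewrite aE.
have {}cv : (fun N => (\sum_(u <- box n N) a u)%:E) @ \oo -->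
    (\int[mu]_(t in E) (cabs (f t) ^+ 2)%:E)%E.
  rewrite [X in X @ _](_ : _ = (fun N => \int[mu]_(t in E) (cabs (S N t) ^+ 2)%:E)%E) //.
  apply/funext => N; rewrite (parseval_finite c (box n N)) -sumEFin.
  by apply: eq_bigr => u _; rewrite aE.
apply/eqP; rewrite eq_le; apply/andP; split.
  apply: (cvge_to_le cv); near=> N.
  exact: sum_le_esum.
apply: ge_ereal_sup => _ [X [finX _] <-]; rewrite fsbig_finite//= sumEFin.
have [N0 hN0] := exhaustion_fset (box_exhaustion n) (fset_set X).
apply: (cvge_to_ge cv); exists N0 => // N /= hN.
rewrite lee_fin; apply: psum_le => //; apply: fsubset_trans hN0 _.
exact: (box_exhaustion n).1.
Unshelve. all: by end_near. Qed.

End fixed_set.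

Section domain.
Context (D : set 'cV[C]_n) (Dr : reinhardt D) (Db : bounded_set D).

Let oD : open D. Proof. by case: Dr. Qed.

Lemma cv_torus_invariant : torus_invariant (cv @^-1` D).
Proof.
move=> w w1; have [_ hD] := Dr.
have e t j : `|cv (tmap w t) j 0| = `|cv t j 0|.
  by rewrite cvec_tmap !cabsE cabsM w1 mul1r.
by apply/seteqP; split => t /= h; apply: hD h _ => j; rewrite e.
Qed.

Lemma integral_cover (E : nat -> set (n.-tuple RR)) (h : n.-tuple RR -> \bar R) X :
  (forall K, measurable (E K)) -> (forall K L, (K <= L)%N -> E K `<=` E L) ->
  \bigcup_K E K = cv @^-1` D -> measurable_fun (cv @^-1` D) h ->
  (forall t, 0 <= h t)%E -> (forall K, \int[mu]_(t in E K) h t <= X)%E ->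
  (\int[mu]_(t in cv @^-1` D) h t <= X)%E.
Proof.
move=> mE ndE UE mh h0 hX; rewrite -UE.
have := @ge0_nondecreasing_set_cvg_integral _ _ R E h mu _ mE _ _.
move=> /(_ _ _ _) cvE; apply: (cvge_to_le (cvE _ _ _)).
- by move=> K L KL; apply/subsetPset/ndE.
- move=> K; apply: measurable_funS mh; first exact: measurable_open.
  by rewrite -UE; exact: bigcup_sup.
- by move=> *; exact: h0.
- by near=> K; exact: hX.
Unshelve. all: by end_near. Qed.

(** Parseval's identity for a power series on [D].  It holds on the sets where
    the series is absolutely bounded by a constant [K]: these are invariant under
    the torus, and they exhaust [D] as [K] grows. *)
Lemma parseval c (f : 'cV[C]_n -> C) : cont_on D f ->
  (forall z, D z -> csummable (fun u => c u * mon (fun j => z j 0) u) /\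
     f z = complex_sum (fun u => c u * mon (fun j => z j 0) u)) ->
  (\int[mu]_(t in cv @^-1` D) (cabs (f (cv t)) ^+ 2)%:E =
   \esum_(u in setT) ((cabs (c u) ^+ 2)%:E * msq (cv @^-1` D) u))%E.
Proof.
move=> cf sf; set D' := cv @^-1` D.
have mD' : measurable D' by exact: measurable_open.
have mF : measurable_fun D' (fun t => (cabs (f (cv t)) ^+ 2)%:E).
  by apply/measurable_EFinP; exact: measurable_cabs2.
pose P N t := \sum_(u <- box n N) cabs (c u * monc u t).
pose E (K : nat) := D' `&` \bigcap_N [set t | P N t <= K%:R].
have mmon u : measurable_fun D' (fun t => cabs (monc u t) ^+ 2).
  apply: (measurable_funS (E := setT)) => //.
  exact: (@measurable_cabs2 R n setT _ openT (cont_mon u)).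
have mE K : measurable (E K).
  apply: measurableI => //; apply: bigcap_measurableType => N _.
  have cP u : cont_on setT (fun z : 'cV[C]_n =>
      (cabs (c u * mon (fun j => z j 0) u))%:C).
    move=> z _ e e0.
    have c0 : 0 < cabs (c u) + 1 by rewrite ltr_wpDl ?cabs_ge0.
    have [s s0 hs] := @cont_mon u z I _ (divr_gt0 e0 c0); exists s => // h /hs hh.
    rewrite -rmorphB cabs_real.
    apply: le_trans (ler_dist_cabs _ _) _; rewrite -mulrBr cabsM.
    apply: le_trans (ler_wpM2l (cabs_ge0 _) hh) _.
    by rewrite mulrCA ger_pMr// ler_pdivrMr// mul1r lerDl.
  have mP : measurable_fun setT (P N).
    apply: measurable_sum => u.
    exact: (@measurable_Re R n setT _ openT (cP u)).
  rewrite -[X in measurable X]setTI.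
  rewrite (_ : [set t | _] = P N @^-1` `]-oo, K%:R]%classic); last first.
    by apply/seteqP; split => t /=; rewrite in_itv.
  by apply: mP => //; exact: measurable_itv.
have ndE K L : (K <= L)%N -> E K `<=` E L.
  move=> KL t [Dt h]; split => // N _ /=.
  by apply: le_trans (h N I) _; rewrite ler_nat.
have UE : \bigcup_K E K = D'.
  apply/seteqP; split => [t [K _ []//]|t Dt].
  have [/csummableP[M hM] _] := sf (cv t) Dt.
  have M0 : 0 <= M by have := hM fset0; rewrite big_seq_fset0.
  exists (Num.Def.archi_bound M) => //; split => // N _ /=.
  exact: le_trans (hM (box n N)) (ltW (archi_boundP M0)).
have tE K : torus_invariant (E K).
  move=> w w1; have e t N : P N (tmap w t) = P N t.
    by apply: eq_bigr => u _; rewrite !cabsM cabs_monc_tmap.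
  have tD := cv_torus_invariant w1.
  apply/seteqP; split => t /= [Dt h]; split.
  - by rewrite -[D']tD.
  - by move=> N _ /=; rewrite -e; exact: h.
  - by rewrite -[D']tD in Dt.
  - by move=> N _ /=; rewrite e; exact: h.
have Eoo K : (mu (E K) < +oo)%E.
  apply: le_lt_trans (bounded_finite_measure oD Db).
  by apply: le_measure; rewrite ?inE// => t [].
have [B0 B00 hB0] := bounded_vnorm Db.
pose B := Num.max 1 B0.
have B1 : 1 <= B by rewrite le_max lexx.
have EB K t : E K t -> forall j, cabs (cv t j 0) <= B.
  move=> [/hB0 h _] j; apply: le_trans (cabs_le_vnorm _ _) _.
  by rewrite le_max h orbT.
have parsK K : (\int[mu]_(t in E K) (cabs (f (cv t)) ^+ 2)%:E =
    \esum_(u in setT) ((cabs (c u) ^+ 2)%:E * msq (E K) u))%E.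
  apply: (parseval_bounded (mE K) (tE K) (Eoo K) B1 (@EB K) (K := K%:R)).
  - by apply: (measurable_funS mD') => [t []//|]; apply/measurable_EFinP.
  - move=> t [Dt _]; have [sz ->] := sf (cv t) Dt.
    exact: (csum_cvg (box_exhaustion n) sz).
  - by move=> t [_ h] N; exact: h.
have le_msq K u : (msq (E K) u <= msq D' u)%E.
  apply: ge0_subset_integral => //; first by apply/measurable_EFinP.
  - by move=> t _; rewrite lee_fin sqr_ge0.
  - by move=> t [].
have c20 u : (0 <= (cabs (c u) ^+ 2)%:E)%E by rewrite lee_fin sqr_ge0.
apply/eqP; rewrite eq_le; apply/andP; split.
  apply: (integral_cover mE ndE UE mF) => [t|K]; first by rewrite lee_fin sqr_ge0.
  by rewrite parsK; apply: le_esum => u _; exact: lee_wpmul2l.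
apply: ge_ereal_sup => _ [X [finX _] <-]; rewrite fsbig_finite//=.
have -> : (\sum_(u <- fset_set X) (cabs (c u) ^+ 2)%:E * msq D' u =
    \int[mu]_(t in D') \sum_(u <- fset_set X) (cabs (c u) ^+ 2 * cabs (monc u t) ^+ 2)%:E)%E.
  rewrite ge0_integral_sum//; last 2 first.
  - by move=> u; apply/measurable_EFinP; apply: measurable_funM => //; exact: measurable_cst.
  - by move=> u t _; rewrite lee_fin mulr_ge0 ?sqr_ge0.
  apply: eq_bigr => u _; rewrite /msq -ge0_integralZl_EFin ?sqr_ge0//.
  - by move=> t _; rewrite lee_fin sqr_ge0.
  - exact/measurable_EFinP.
have msum : measurable_fun D' (fun t =>
    \sum_(u <- fset_set X) (cabs (c u) ^+ 2 * cabs (monc u t) ^+ 2)%:E)%E.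
  apply: emeasurable_sum => u; apply/measurable_EFinP.
  by apply: measurable_funM => //; exact: measurable_cst.
apply: (integral_cover mE ndE UE msum) => [t|K].
  by apply: sume_ge0 => u _; rewrite lee_fin mulr_ge0 ?sqr_ge0.
apply: (@le_trans _ _ (\int[mu]_(t in E K) (cabs (f (cv t)) ^+ 2)%:E)%E); last first.
  apply: ge0_subset_integral => //.
  - by move=> t _; rewrite lee_fin sqr_ge0.
  - by move=> t [].
have mmonK u : measurable_fun (E K) (fun t => cabs (monc u t) ^+ 2).
  by apply: measurable_funS (mmon u) => // t [].
rewrite parsK ge0_integral_sum//; last 2 first.
- by move=> u; apply/measurable_EFinP; apply: measurable_funM => //; exact: measurable_cst.
- by move=> u t _; rewrite lee_fin mulr_ge0 ?sqr_ge0.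
apply: esum_ge; exists X => //; rewrite fsbig_finite//=; apply: lee_sum => u _.
rewrite /msq -ge0_integralZl_EFin ?sqr_ge0//.
- by move=> t _; rewrite lee_fin sqr_ge0.
- exact/measurable_EFinP.
Qed.

End domain.

End parseval.

(** * Norms of monomials and uniqueness of coefficients *)

Section monomials.
Context (R : realType) (n : nat).
Local Notation RR := (measurableTypeR R * measurableTypeR R)%type.
Local Notation C := R[i].
Local Notation mu := (lebesgueC R n).
Local Notation cv := (@cvec R n).
Implicit Types (D : set 'cV[C]_n) (u v : multinom n).

Lemma sqr_norm_cabs (x : C) : complex.Re (`|x| ^+ 2) = cabs x ^+ 2.
Proof. by rewrite cabsE -rmorphXn. Qed.

Lemma Re_mul_conj (x : C) : complex.Re (x * Num.conj x) = cabs x ^+ 2.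
Proof. by rewrite -[Num.conj x]/(x^*%C) -sqr_cabsE. Qed.

Lemma hnorm_bergman D f :
  hnorm (bergman D) f = Num.sqrt (fine (\int[mu]_(t in cv @^-1` D) (cabs (f (cv t)) ^+ 2)%:E)).
Proof.
rewrite /hnorm /= /Rintegral; congr (Num.sqrt (fine _)).
by apply: eq_integral => t _; rewrite Re_mul_conj.
Qed.

Lemma msq_ge0 E u : (0 <= @msq R n E u)%E.
Proof. by apply: integral_ge0 => t _; rewrite lee_fin sqr_ge0. Qed.

Lemma msq_fin_num D u : reinhardt D -> bounded_set D -> msq (cv @^-1` D) u \is a fin_num.
Proof.
move=> Dr Db; have [B B0 hB] := bounded_vnorm Db.
apply: (@msq_fin R n (cv @^-1` D) _ _ (Num.max 1 B)).
- by apply: measurable_open; case: Dr.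
- by apply: bounded_finite_measure => //; case: Dr.
- by rewrite le_max lexx.
- move=> t /hB h j; apply: le_trans (cabs_le_vnorm _ _) _.
  by rewrite le_max h orbT.
Qed.

Lemma sqr_monomial_norm D u : reinhardt D -> bounded_set D ->
  ((monomial_norm D u ^+ 2)%:E = msq (cv @^-1` D) u)%E.
Proof.
move=> Dr Db; have h : (\int[mu]_(t in cv @^-1` D)
    (cabs (peval (mpolyX C u) (cv t)) ^+ 2)%:E)%E = msq (cv @^-1` D) u.
  by apply: eq_integral => t _; rewrite peval_mon.
rewrite /monomial_norm hnorm_bergman h sqr_sqrtr ?fineK//; last exact: fine_ge0 (msq_ge0 _ _).
exact: msq_fin_num.
Qed.

(** Monomials are at least as large in norm as on a torus inside the domain, up
    to a factor independent of the exponent. *)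
Lemma monomial_norm_ge D (rho r : 'I_n -> R) : reinhardt D -> bounded_set D ->
  D (vec (fun j => (r j)%:C)) -> (forall j, 0 <= rho j < r j) ->
  exists2 k : R, 0 < k & forall u, k * mon rho u <= monomial_norm D u.
Proof.
move=> Dr Db Dv rr; have [B [mB BD [m m0 mE] hB]] := polyannulus Dr Dv rr.
have mD : measurable (cv @^-1` D) by apply: measurable_open; case: Dr.
have rho0 u : 0 <= mon rho u by apply: mon_ge0 => j; case/andP: (rr j).
exists (Num.sqrt m) => [|u]; first by rewrite sqrtr_gt0.
rewrite -ler_sqr ?nnegrE ?mulr_ge0 ?sqrtr_ge0// exprMn sqr_sqrtr ?(ltW m0)//.
rewrite -lee_fin sqr_monomial_norm//.
have mm : measurable_fun (cv @^-1` D) (fun t => (cabs (monc u t) ^+ 2)%:E).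
  apply/measurable_EFinP; apply: (measurable_funS (E := setT)) => //.
  exact: (@measurable_cabs2 R n setT _ openT (@cont_mon R n u)).
apply: (@le_trans _ _ (\int[mu]_(t in B) (cabs (monc u t) ^+ 2)%:E)%E); last first.
  by apply: ge0_subset_integral => // t _; rewrite lee_fin sqr_ge0.
rewrite mulrC EFinM -mE -integral_cst//; apply: ge0_le_integral => //.
- by move=> t _; rewrite lee_fin sqr_ge0.
- exact: measurable_funS mm.
- move=> t Bt; rewrite /= lee_fin lerXn2r ?nnegrE ?cabs_ge0//.
  rewrite cabs_mon; apply: ler_mon => j; rewrite hB// andbT.
  by case/andP: (rr j).
Qed.

Lemma monomial_norm_gt0 D u : reinhardt D -> bounded_set D -> D 0 ->
  0 < monomial_norm D u.
Proof.
move=> Dr Db D0; have [r [_ r0 Dv]] := reinhardt_radii Dr D0.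
have [|k k0 hk] := @monomial_norm_ge D (fun j => r j / 2) r Dr Db Dv.
  by move=> j; have := r0 j; lra.
apply: lt_le_trans (hk u); rewrite mulr_gt0// mon_gt0// => j.
by rewrite divr_gt0.
Qed.

(** Parseval's identity on a small polydisc makes the coefficients of a power
    series unique. *)
Lemma power_series_unique (c c' : multinom n -> C) (r : 'I_n -> R) (M : R) :
  (forall j, 0 < r j) -> (forall u, cabs (c u) * mon r u <= M) ->
  (forall u, cabs (c' u) * mon r u <= M) ->
  (forall z : 'cV[C]_n, (forall j, cabs (z j 0) < r j) ->
     complex_sum (fun u => c u * mon (fun j => z j 0) u) =
     complex_sum (fun u => c' u * mon (fun j => z j 0) u)) ->
  c =1 c'.
Proof.
move=> r0 cM cM' cc'.
pose P := [set z : 'cV[C]_n | forall j, cabs (z j 0) < r j].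
have Pr : reinhardt P.
  split=> [|z w Pz h j]; last first.
    by apply: le_lt_trans (Pz j); rewrite -lecR -!cabsE.
  rewrite openE => z Pz; pose m := \big[Num.min/1]_j (r j - cabs (z j 0)).
  have m0 : 0 < m by apply: lt_bigmin => // j _; rewrite subr_gt0.
  apply/nbhs_vnorm; exists m => // h hm j; rewrite mxE.
  apply: le_lt_trans (cabsD _ _) _; rewrite -ltrBrDl.
  apply: le_lt_trans (cabs_le_vnorm _ _) (lt_le_trans hm _).
  exact: bigmin_le_cond.
have Pb : bounded_set P.
  pose B := 1 + \sum_j r j.
  exists B%:C; split; first by rewrite complex_real.
  move=> x Bx z Pz; apply: le_trans (ltW Bx); rewrite vnormE lecR.
  apply/vnorm_le => [|j].
    by rewrite addr_ge0//; apply: sumr_ge0 => j _; exact: ltW.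
  apply: le_trans (ltW (Pz j)) _; rewrite /B (bigD1 j)//= addrCA lerDl.
  by rewrite addr_ge0//; apply: sumr_ge0 => k _; exact: ltW.
have P0 : P 0 by move=> j; rewrite mxE cabs0.
have sc (d : multinom n -> C) : (forall u, cabs (d u) * mon r u <= M) ->
    forall z, P z -> csummable (fun u => d u * mon (fun j => z j 0) u).
  move=> dM z Pz; apply: (csummable_exh (box_exhaustion n)).
  apply: (power_series_bound (t := fun j => cabs (z j 0)) r0 dM) => j.
  by rewrite lexx Pz.
have cdiff z : P z -> csummable (fun u => (c u - c' u) * mon (fun j => z j 0) u) /\
    (0 : C) = complex_sum (fun u => (c u - c' u) * mon (fun j => z j 0) u).
  move=> Pz; have e : (fun u => (c u - c' u) * mon (fun j => z j 0) u) =
      (fun u => c u * mon (fun j => z j 0) u + (-1) * (c' u * mon (fun j => z j 0) u)).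
    by apply/funext => u; ring.
  have s1 := sc c cM z Pz; have s2 := sc c' cM' z Pz.
  rewrite e; split; first exact: csummableD s1 (csummableZ _ s2).
  rewrite (csumD (box_exhaustion n) s1 (csummableZ _ s2)).
  by rewrite (csumZ (box_exhaustion n) _ s2) cc'// mulN1r subrr.
have c0 : cont_on P (fun=> 0 : C).
  by move=> z _ e e0; exists 1 => // h _; rewrite subrr cabs0 ltW.
have := parseval Pr Pb c0 cdiff.
rewrite integral0_eq => [|t _]; last by rewrite cabs0 expr0n.
move=> /esym h u; apply/eqP; rewrite -subr_eq0 -cabs_eq0 -sqrf_eq0; apply/eqP.
have : ((cabs (c u - c' u) ^+ 2)%:E * msq (cv @^-1` P) u <= 0)%E.
  rewrite -h; apply: esum_ge; exists [set u]; first by split.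
  by rewrite fsbig_set1.
rewrite -sqr_monomial_norm// -EFinM lee_fin.
have N0 : 0 < monomial_norm P u ^+ 2 by rewrite exprn_gt0// monomial_norm_gt0.
rewrite pmulr_lle0// => h0; apply/eqP; rewrite eq_le h0 sqr_ge0//.
Qed.

End monomials.

(** * Square-summable families *)

Section ell2.
Context (R : realType) (V : choiceType).
Local Notation C := R[i].
Implicit Types (x y : V -> C).

Definition sqsum x : \bar R := (\esum_(v in setT) (cabs (x v) ^+ 2)%:E)%E.

Lemma ell2P x : carrier (ell2 R V) x <-> (sqsum x < +oo)%E.
Proof.
rewrite -[carrier _ _]/(is_true (\esum_(v in setT) (complex.Re (`|x v| ^+ 2))%:E < +oo)%E).
rewrite [X in is_true (X < _)%E <-> _](_ : _ = sqsum x)//.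
by apply: eq_esum => v _; rewrite sqr_norm_cabs.
Qed.

Lemma sqsum_ge0 x : (0 <= sqsum x)%E.
Proof. by apply: esum_ge0 => v _; rewrite lee_fin sqr_ge0. Qed.

Lemma sqsum_fin x : carrier (ell2 R V) x -> (fine (sqsum x))%:E = sqsum x.
Proof. by move=> /ell2P h; rewrite fineK// ge0_fin_numE// sqsum_ge0. Qed.

Lemma sqsum_le x (M : R) : (forall A : {fset V}, \sum_(v <- A) cabs (x v) ^+ 2 <= M) ->
  carrier (ell2 R V) x /\ fine (sqsum x) <= M.
Proof.
move=> hM; have h : (sqsum x <= M%:E)%E by exact: esum_le.
have cx : carrier (ell2 R V) x by apply/ell2P/(le_lt_trans h)/ltry.
by split => //; rewrite -lee_fin sqsum_fin.
Qed.

Lemma sum_le_sqsum x (A : {fset V}) : carrier (ell2 R V) x ->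
  \sum_(v <- A) cabs (x v) ^+ 2 <= fine (sqsum x).
Proof.
move=> cx; rewrite -lee_fin sqsum_fin//; apply: sum_le_esum => v.
exact: sqr_ge0.
Qed.

Lemma ell2_D x y : carrier (ell2 R V) x -> carrier (ell2 R V) y ->
  carrier (ell2 R V) (x + y).
Proof.
move=> cx cy; apply: (sqsum_le (M := 2 * fine (sqsum x) + 2 * fine (sqsum y)) _).1.
move=> A; apply: (le_trans (y := \sum_(v <- A)
    (2 * cabs (x v) ^+ 2 + 2 * cabs (y v) ^+ 2))); last first.
  rewrite big_split/= -!mulr_sumr.
  by apply: lerD; rewrite ler_wpM2l// sum_le_sqsum.
apply: ler_sum => v _; have h := cabsD (x v) (y v).
have : cabs (x v + y v) ^+ 2 <= (cabs (x v) + cabs (y v)) ^+ 2.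
  by rewrite lerXn2r ?nnegrE ?addr_ge0 ?cabs_ge0.
have := sqr_ge0 (cabs (x v) - cabs (y v)); rewrite -[(x + y) v]/(x v + y v).
by move: (cabs _) (cabs _) (cabs _) => a b c; nra.
Qed.

Lemma ell2_Z c x : carrier (ell2 R V) x -> carrier (ell2 R V) (c *: x).
Proof.
move=> cx; apply: (sqsum_le (M := cabs c ^+ 2 * fine (sqsum x)) _).1 => A.
apply: le_trans (ler_wpM2l (sqr_ge0 _) (sum_le_sqsum A cx)); rewrite mulr_sumr.
by apply: ler_sum => v _; rewrite -[(c *: x) v]/(c * x v) cabsM exprMn.
Qed.

Lemma ell2_0 : carrier (ell2 R V) 0.
Proof.
apply: (sqsum_le (M := 0) _).1 => A.
by rewrite big1// => v _; rewrite cabs0 expr0n.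
Qed.

Lemma ell2_chi u : carrier (ell2 R V) (chi R u).
Proof.
apply: (sqsum_le (M := 1) _).1 => A.
have h v : cabs (chi R u v) ^+ 2 = (v == u)%:R.
  by rewrite /chi; case: eqP => _; rewrite ?cabs1 ?cabs0 ?expr1n ?expr0n.
under eq_bigr do rewrite h.
have [uA|uA] := boolP (u \in A).
  rewrite (big_fsetD1 u)//= eqxx big_seq big1 ?addr0// => v.
  by rewrite !inE => /andP[/negbTE ->].
by rewrite big_seq big1// => v vA; case: eqP vA => // ->; rewrite (negbTE uA).
Qed.

Lemma ell2_sum (I : Type) (s : seq I) (c : I -> C) (g : I -> V -> C) :
  (forall i, carrier (ell2 R V) (g i)) ->
  carrier (ell2 R V) (\sum_(i <- s) c i *: g i).
Proof.
move=> hg; elim: s => [|i s IH]; first by rewrite big_nil; exact: ell2_0.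
by rewrite big_cons; apply: ell2_D => //; exact: ell2_Z.
Qed.

Lemma cabs_le_ell2 x v : carrier (ell2 R V) x ->
  cabs (x v) <= Num.sqrt (fine (sqsum x)).
Proof.
move=> cx; rewrite -[leLHS]ger0_norm ?cabs_ge0// -sqrtr_sqr ler_sqrt.
  by have := sum_le_sqsum [fset v]%fset cx; rewrite big_seq_fset1.
by rewrite fine_ge0// sqsum_ge0.
Qed.

Context (B : nat -> {fset V}) (exB : exhaustion B).

(** Polarization reduces inner products to norms, here and in the Bergman space. *)
Lemma Re_inner_ell2 x y : carrier (ell2 R V) x -> carrier (ell2 R V) y ->
  complex.Re (inner (ell2 R V) x y) =
  (fine (sqsum (x + y)) - fine (sqsum (x - y))) / 4.
Proof.
move=> cx cy; rewrite /= -[LHS]/(real_sum _).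
have cn : carrier (ell2 R V) (x - y).
  by rewrite -scaleN1r; apply: ell2_D => //; exact: ell2_Z.
have sq (z : V -> C) : carrier (ell2 R V) z ->
    (fun N => \sum_(v <- B N) cabs (z v) ^+ 2) @ \oo --> fine (sqsum z).
  move=> /ell2P cz; apply: (esum_cvg exB) => // v; exact: sqr_ge0.
have l1 : (fun N => \sum_(v <- B N) complex.Re (x v * (y v)^*)) @ \oo -->
    real_sum (fun v => complex.Re (x v * (y v)^*)).
  apply: (real_sum_cvg exB (b := fun v => cabs (x v) ^+ 2 + cabs (y v) ^+ 2)).
    move=> v; apply: le_trans (cabs_ge_Re _) _.
    rewrite cabsM -[(y v)^*]/((y v)^*%C) cabs_conj.
    have := sqr_ge0 (cabs (x v) - cabs (y v)).
    by have := cabs_ge0 (x v); have := cabs_ge0 (y v); nra.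
  have s : (sqsum x + sqsum y < +oo)%E.
    exact: lte_add_pinfty ((ell2P x).1 cx) ((ell2P y).1 cy).
  apply: le_lt_trans s; rewrite /sqsum -esumD.
  - by apply: le_esum => v _; rewrite EFinD.
  - by move=> v _; rewrite lee_fin sqr_ge0.
  - by move=> v _; rewrite lee_fin sqr_ge0.
have e : (fun N => \sum_(v <- B N) complex.Re (x v * (y v)^*)) =
    (fun N => (\sum_(v <- B N) cabs ((x + y) v) ^+ 2
      - \sum_(v <- B N) cabs ((x - y) v) ^+ 2) * 4^-1).
  apply/funext => N; rewrite -sumrB mulr_suml; apply: eq_bigr => v _.
  rewrite -[(x + y) v]/(x v + y v) -[(x - y) v]/(x v - y v) !sqr_cabs.
  by case: (x v) (y v) => a b [a' b'] /=; field.
rewrite e in l1; apply: (cvg_unique _ l1) => //; apply: cvgM; last exact: cvg_cst.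
by apply: cvgB; apply: sq => //; exact: ell2_D.
Qed.

Lemma Im_inner_ell2 x y : complex.Im (inner (ell2 R V) x y) =
  complex.Re (inner (ell2 R V) x ('i *: y)).
Proof.
rewrite /= -[LHS]/(real_sum _) -[RHS]/(real_sum _); congr real_sum.
apply/funext => v; rewrite -[('i *: y) v]/('i * y v).
by case: (x v) (y v) => a b [a' b'] /=; ring.
Qed.

(** Finitely supported families are dense: the restriction of [x] to a finite set
    that carries almost all of its square sum is close to [x]. *)
Lemma ell2_functional0 (phi : (V -> C) -> C) (K : R) : 0 <= K ->
  (forall c x y, carrier (ell2 R V) x -> carrier (ell2 R V) y ->
     phi (c *: x + y) = c * phi x + phi y) ->
  (forall x, carrier (ell2 R V) x -> cabs (phi x) <= K * Num.sqrt (fine (sqsum x))) ->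
  (forall v, phi (chi R v) = 0) ->
  forall x, carrier (ell2 R V) x -> phi x = 0.
Proof.
move=> K0 phiL phiK phi0 x cx.
have phi00 : phi 0 = 0.
  have := phiL (-1) 0 0 ell2_0 ell2_0.
  by rewrite scaler0 addr0 mulN1r addNr.
have phi_fin (s : seq V) : phi (\sum_(v <- s) x v *: chi R v) = 0.
  elim: s => [|v s IH]; first by rewrite big_nil.
  rewrite big_cons phiL ?phi0 ?IH ?mulr0 ?addr0//; first exact: ell2_chi.
  by apply: ell2_sum => w; exact: ell2_chi.
apply/eqP; rewrite -cabs_eq0 eq_le cabs_ge0 andbT.
apply/ler_addgt0Pr => e e0; rewrite add0r.
have K1 : 0 < K + 1 by rewrite ltr_wpDl.
pose d := (e / (K + 1)) ^+ 2.
have d0 : 0 < d by rewrite exprn_gt0// divr_gt0.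
have [|A hA] := @esum_approx R V (fun v => cabs (x v) ^+ 2) (fine (sqsum x) - d).
  by rewrite EFinB sqsum_fin// lteBlDr// lteDl ?lte_fin// -sqsum_fin.
pose xA := \sum_(v <- A) x v *: chi R v.
have xAE v : xA v = if v \in A then x v else 0.
  rewrite /xA fct_sumE; case: ifPn => vA.
    rewrite (big_fsetD1 v)//= -[(x v *: chi R v) v]/(x v * chi R v v).
    rewrite /chi eqxx mulr1 big_seq big1 ?addr0// => w.
    rewrite !inE => /andP[wv _]; rewrite -[(_ *: _) v]/(x w * (v == w)%:R).
    by rewrite eq_sym (negbTE wv) mulr0.
  rewrite big_seq big1// => w wA; rewrite -[(_ *: _) v]/(x w * (v == w)%:R).
  by case: eqP vA => [->|_ _]; [rewrite wA|rewrite mulr0].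
have cA : carrier (ell2 R V) xA by apply: ell2_sum => v; exact: ell2_chi.
have [cr hr] : carrier (ell2 R V) (x - xA) /\ fine (sqsum (x - xA)) <= d.
  apply: sqsum_le => F.
  have h : \sum_(v <- F) cabs ((x - xA) v) ^+ 2 + \sum_(v <- A) cabs (x v) ^+ 2
      <= \sum_(v <- (F `|` A)%fset) cabs (x v) ^+ 2.
    rewrite [X in X + _ <= _](_ : _ =
      \sum_(v <- (F `|` A)%fset) if v \in F then cabs ((x - xA) v) ^+ 2 else 0); last first.
      rewrite -(big_fset_incl _ (fsubsetUl F A)) => [|v _ /negbTE -> //].
      by apply: eq_big_seq => v ->.
    rewrite [X in _ + X <= _](_ : _ =
      \sum_(v <- (F `|` A)%fset) if v \in A then cabs (x v) ^+ 2 else 0); last first.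
      rewrite -(big_fset_incl _ (fsubsetUr F A)) => [|v _ /negbTE -> //].
      by apply: eq_big_seq => v ->.
    rewrite -big_split/=; apply: ler_sum => v _.
    rewrite -[(x - xA) v]/(x v - xA v) xAE; case: ifP => _; case: ifP => _;
      by rewrite ?subrr ?subr0 ?cabs0 ?expr0n ?addr0 ?add0r ?sqr_ge0.
  have := sum_le_sqsum (F `|` A)%fset cx; lra.
have -> : phi x = phi (x - xA).
  have -> : x = 1 *: (x - xA) + xA by rewrite scale1r subrK.
  by rewrite phiL// phi_fin mul1r addr0 scale1r addrK.
apply: le_trans (phiK _ cr) _.
apply: (le_trans (y := K * (e / (K + 1)))); last first.
  by rewrite mulrCA ger_pMr// ler_pdivrMr// mul1r lerDl.
apply: ler_wpM2l => //; rewrite -[leRHS]ger0_norm ?divr_ge0 ?(ltW e0) ?(ltW K1)//.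
by rewrite -sqrtr_sqr ler_sqrt// ltW.
Qed.

End ell2.

(** * The unitary between square-summable families and the Bergman space *)

Section bergman.
Context (R : realType) (n : nat).
Local Notation RR := (measurableTypeR R * measurableTypeR R)%type.
Local Notation C := R[i].
Local Notation mu := (lebesgueC R n).
Local Notation cv := (@cvec R n).
Local Notation V := (multinom n).
Local Notation l2 := (ell2 R V).
Context (D : set 'cV[C]_n) (Dr : reinhardt D) (Db : bounded_set D) (D0 : D 0).
Implicit Types (x y : V -> C) (f g : 'cV[C]_n -> C).

Let exB := box_exhaustion n.
Let oD : open D. Proof. by case: Dr. Qed.
Let pn u := monomial_norm D u.
Let pn0 u : 0 < pn u. Proof. exact: monomial_norm_gt0. Qed.

Definition ecoef x u : C := x u / (monomial_norm D u)%:C.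

Definition esum_term x (z : 'cV[C]_n) u : C := ecoef x u * mon (fun j => z j 0) u.

(** The candidate unitary: it maps the basis vector of index [u] to the normalized
    monomial of exponent [u].  It is cut off outside [D], as functions of the
    Bergman space are. *)
Definition series_op x (z : 'cV[C]_n) : C :=
  if pselect (D z) is left _ then complex_sum (esum_term x z) else 0.

Lemma series_opE x z : D z -> series_op x z = complex_sum (esum_term x z).
Proof. by rewrite /series_op; case: (pselect (D z)). Qed.

Lemma series_op_out x z : ~ D z -> series_op x z = 0.
Proof. by rewrite /series_op; case: (pselect (D z)). Qed.

(** Uniform control of the coefficients by the norm of the family, since the norms
    of monomials dominate [rho ^ u]; it yields both convergence of the series and
    continuity of point evaluations. *)
Lemma ecoef_bound z : D z -> exists rho k, [/\ forall j, 0 < rho j,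
  forall j, cabs (z j 0) < rho j, 0 < k &
  forall x, carrier l2 x ->
    forall u, cabs (ecoef x u) * mon rho u <= Num.sqrt (fine (sqsum x)) / k].
Proof.
move=> Dz; have [r [zr r0 Dv]] := reinhardt_radii Dr Dz.
pose rho j := (cabs (z j 0) + r j) / 2.
have rho0 j : 0 < rho j by rewrite /rho divr_gt0// ltr_wpDl// cabs_ge0.
have rr j : 0 <= rho j < r j by rewrite ltW//= /rho; have := zr j; lra.
have [k k0 hk] := monomial_norm_ge Dr Db Dv rr.
exists rho, k; split => // [j|x cx u]; first by rewrite /rho; have := zr j; lra.
rewrite cabsM cabsV cabs_real gtr0_norm ?pn0// -mulrA.
apply: ler_pM; rewrite ?cabs_ge0 ?cabs_le_ell2//.
  by rewrite mulr_ge0 ?invr_ge0 ?(ltW (pn0 u))// ltW// mon_gt0.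
by rewrite mulrC ler_pdivrMr ?pn0// ler_pdivlMl.
Qed.

Lemma esum_term_summable x z : carrier l2 x -> D z -> csummable (esum_term x z).
Proof.
move=> cx Dz; have [rho [k [rho0 zrho k0 h]]] := ecoef_bound Dz.
apply: (csummable_exh exB).
apply: (power_series_bound (t := fun j => cabs (z j 0)) rho0 (h x cx)) => j.
by rewrite lexx zrho.
Qed.

Lemma series_op_bounded z : D z -> exists2 K : R, 0 <= K &
  forall x, carrier l2 x -> cabs (series_op x z) <= K * Num.sqrt (fine (sqsum x)).
Proof.
move=> Dz; have [rho [k [rho0 zrho k0 h]]] := ecoef_bound Dz.
exists (k^-1 * \prod_j (1 - cabs (z j 0) / rho j)^-1) => [|x cx].
  rewrite mulr_ge0 ?invr_ge0 ?(ltW k0)//; apply: prodr_ge0 => j _.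
  by rewrite invr_ge0 subr_ge0 ler_pdivrMr// mul1r ltW.
rewrite series_opE//; apply: (csum_le exB) => N.
apply: le_trans (power_series_bound (t := fun j => cabs (z j 0)) rho0 (h x cx) _ N) _.
  by move=> j; rewrite lexx zrho.
by rewrite le_eqVlt; apply/orP; left; apply/eqP; ring.
Qed.

Lemma esum_termD c x y z u :
  esum_term (c *: x + y) z u = c * esum_term x z u + esum_term y z u.
Proof.
by rewrite /esum_term /ecoef -[(c *: x + y) u]/(c * x u + y u); ring.
Qed.

Lemma series_op_linear : linear_on l2 series_op.
Proof.
move=> c x y cx cy; apply/funext => z.
rewrite -[RHS]/(c * series_op x z + series_op y z).
have [Dz|Dz] := pselect (D z); last by rewrite !series_op_out// mulr0 addr0.
have sx := esum_term_summable cx Dz; have sy := esum_term_summable cy Dz.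
rewrite !series_opE// (_ : esum_term (c *: x + y) z =
  (fun u => c * esum_term x z u + esum_term y z u)); last first.
  by apply/funext => u; exact: esum_termD.
by rewrite (csumD exB (csummableZ c sx) sy) (csumZ exB).
Qed.

Lemma series_op_differentiable x z : carrier l2 x -> D z ->
  differentiable (series_op x : 'cV[C]_n -> C) z.
Proof.
move=> cx Dz; have [rho [k [rho0 zrho k0 h]]] := ecoef_bound Dz.
have [d hd] := power_series_gradient rho0 (h x cx) zrho.
apply/differentiableP_gradient; exists d => e /hd[s s0 hs].
have : nbhs z D by exact: open_nbhs_nbhs.
move=> /nbhs_vnorm[r r0 hr]; exists (Num.min s r); first by rewrite lt_min s0.
move=> t; rewrite lt_min => /andP[/hs + /hr Dzt].
by rewrite !series_opE.
Qed.

Lemma bergman_norm x : carrier l2 x ->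
  (\int[mu]_(t in cv @^-1` D) (cabs (series_op x (cv t)) ^+ 2)%:E = sqsum x)%E.
Proof.
move=> cx; rewrite (parseval (c := ecoef x) Dr Db).
- apply: eq_esum => u _; rewrite -sqr_monomial_norm// -EFinM; congr EFin.
  rewrite -exprMn; congr (_ ^+ 2).
  by rewrite cabsM cabsV cabs_real gtr0_norm ?pn0// divfK// gt_eqF ?pn0.
- by apply: differentiable_cont_on => z; exact: series_op_differentiable.
- by move=> z Dz; split; [exact: esum_term_summable|rewrite series_opE].
Qed.

Lemma bergmanP f : carrier (bergman D) f <->
  [/\ forall z, D z -> differentiable (f : 'cV[C]_n -> C) z,
      forall z, ~ D z -> f z = 0 &
      (\int[mu]_(t in cv @^-1` D) (cabs (f (cv t)) ^+ 2)%:E < +oo)%E].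
Proof.
have E : (\int[mu]_(t in cv @^-1` D) (complex.Re (`|f (cv t)| ^+ 2))%:E =
    \int[mu]_(t in cv @^-1` D) (cabs (f (cv t)) ^+ 2)%:E)%E.
  by apply: eq_integral => t _; rewrite sqr_norm_cabs.
rewrite -E; split; exact.
Qed.

Lemma series_op_carrier x : carrier l2 x -> carrier (bergman D) (series_op x).
Proof.
move=> cx; apply/bergmanP; split => [z Dz|z Dz|].
- exact: series_op_differentiable.
- exact: series_op_out.
- rewrite bergman_norm//; exact: (ell2P x).1 cx.
Qed.

Lemma hnorm_ell2 x : hnorm l2 x = Num.sqrt (fine (sqsum x)).
Proof.
rewrite /hnorm; congr Num.sqrt.
rewrite -[LHS]/(real_sum (fun v => complex.Re (x v * (x v)^*))).
rewrite (_ : (fun v => _) = (fun v => cabs (x v) ^+ 2)); last first.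
  by apply/funext => v; exact: Re_mul_conj.
rewrite /real_sum funr_pos funr_neg [X in (_ - X)%E]esum1 => [|v _]; last first.
  by congr EFin; apply/max_idPr; rewrite oppr_le0 sqr_ge0.
rewrite sube0 /sqsum; congr fine; apply: eq_esum => v _.
by congr EFin; apply/max_idPl; rewrite sqr_ge0.
Qed.

Lemma hnorm_series_op x : carrier l2 x -> hnorm (bergman D) (series_op x) = hnorm l2 x.
Proof. by move=> cx; rewrite hnorm_bergman bergman_norm// hnorm_ell2. Qed.

Lemma series_op_inj x y : carrier l2 x -> carrier l2 y ->
  series_op x = series_op y -> x = y.
Proof.
move=> cx cy xy; have cd : carrier l2 (x - y).
  by rewrite addrC -scaleN1r; apply: ell2_D => //; exact: ell2_Z.
have : series_op (x - y) = 0.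
  rewrite addrC -scaleN1r series_op_linear// xy scaleN1r; exact: addNr.
move=> /(congr1 (fun f => \int[mu]_(t in cv @^-1` D) (cabs (f (cv t)) ^+ 2)%:E)%E).
rewrite bergman_norm// integral0_eq => [h|t _]; last by rewrite cabs0 expr0n.
apply/funext => u; apply/subr0_eq/eqP; rewrite -cabs_eq0 -sqrf_eq0 eq_le sqr_ge0 andbT.
by have := sum_le_sqsum [fset u]%fset cd; rewrite big_seq_fset1 h.
Qed.

(** Surjectivity: the power series of [f] at the origin converges to [f] on all of
    [D], since on each polydisc of [D] it has the same coefficients. *)
Lemma series_op_surj f : carrier (bergman D) f -> exists2 x, carrier l2 x & series_op x = f.
Proof.
move=> /bergmanP[fd f0 foo].
have [r [_ r0 Dv]] := reinhardt_radii Dr D0.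
have [c [[M cM] cf]] := holo_power_series Dr fd r0 Dv.
have cz z : D z -> csummable (fun u => c u * mon (fun j => z j 0) u) /\
    f z = complex_sum (fun u => c u * mon (fun j => z j 0) u).
  move=> Dz; have [r' [zr' r'0 Dv']] := reinhardt_radii Dr Dz.
  have [c' [[M' cM'] cf']] := holo_power_series Dr fd r'0 Dv'.
  pose s j := Num.min (r j) (r' j).
  have s0 j : 0 < s j by rewrite lt_min r0 r'0.
  have sle (q : 'I_n -> R) (d : V -> C) (L : R) : L <= Num.max M M' ->
      (forall j, s j <= q j) -> (forall u, cabs (d u) * mon q u <= L) ->
      forall u, cabs (d u) * mon s u <= Num.max M M'.
    move=> LM sq dL u; apply: le_trans LM; apply: le_trans (dL u).
    by rewrite ler_wpM2l ?cabs_ge0//; apply: ler_mon => j; rewrite sq ltW.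
  have sr j : s j <= r j by rewrite ge_min lexx.
  have sr' j : s j <= r' j by rewrite ge_min lexx orbT.
  have e : c =1 c'.
    apply: (@power_series_unique R n c c' s (Num.max M M') s0).
    - by apply: (sle r) cM => //; rewrite le_max lexx.
    - by apply: (sle r') cM' => //; rewrite le_max lexx orbT.
    - move=> w ws; rewrite cf => [|j]; last exact: lt_le_trans (ws j) (sr j).
      by rewrite cf' => // j; exact: lt_le_trans (ws j) (sr' j).
  rewrite (_ : c = c'); last exact/funext.
  split; last by rewrite cf'.
  apply: (csummable_exh exB).
  apply: (power_series_bound (t := fun j => cabs (z j 0)) r'0 cM') => j.
  by rewrite lexx zr'.
pose x u : C := c u * (pn u)%:C.
have xE : ecoef x = c.
  apply/funext => u; rewrite /ecoef /x mulfK// -cabs_eq0 cabs_real normr_eq0.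
  by rewrite gt_eqF ?pn0.
have cx : carrier l2 x.
  apply: (ell2P x).2; apply: le_lt_trans foo.
  rewrite (parseval (c := c) Dr Db) => //; last exact: differentiable_cont_on.
  apply: le_esum => u _; rewrite -sqr_monomial_norm// -EFinM lee_fin -exprMn.
  by rewrite /x cabsM cabs_real gtr0_norm ?pn0.
exists x => //; apply/funext => z; have [Dz|Dz] := pselect (D z); last first.
  by rewrite series_op_out// f0.
by rewrite series_opE// (cz z Dz).2 /esum_term xE.
Qed.

Lemma bergman_integrable f : carrier (bergman D) f ->
  mu.-integrable (cv @^-1` D) (EFin \o (fun t => cabs (f (cv t)) ^+ 2)).
Proof.
move=> /bergmanP[fd _ foo]; apply/integrableP; split.
  by apply/measurable_EFinP; apply: measurable_cabs2 => //; exact: differentiable_cont_on.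
apply: le_lt_trans foo; rewrite le_eqVlt; apply/orP; left; apply/eqP.
by apply: eq_integral => t _; rewrite /= ger0_norm// sqr_ge0.
Qed.

Lemma Re_inner_bergman f g : carrier (bergman D) (f + g) -> carrier (bergman D) (f - g) ->
  complex.Re (inner (bergman D) f g) =
  (fine (\int[mu]_(t in cv @^-1` D) (cabs ((f + g) (cv t)) ^+ 2)%:E)%E -
   fine (\int[mu]_(t in cv @^-1` D) (cabs ((f - g) (cv t)) ^+ 2)%:E)%E) / 4.
Proof.
move=> /bergman_integrable ip /bergman_integrable im.
have mD : measurable (cv @^-1` D) by exact: measurable_open.
rewrite -[LHS]/(\int[mu]_(t in cv @^-1` D) complex.Re (f (cv t) * (g (cv t))^*)).
rewrite (@eq_Rintegral _ _ _ mu _ (fun t =>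
  (cabs ((f + g) (cv t)) ^+ 2 - cabs ((f - g) (cv t)) ^+ 2) * 4^-1)); last first.
  move=> t _; rewrite -[(f + g) _]/(f (cv t) + g (cv t)) -[(f - g) _]/(f (cv t) - g (cv t)).
  by rewrite !sqr_cabs; case: (f _) (g _) => a b [a' b'] /=; field.
rewrite RintegralZr//; last exact: (integrableB mD ip im).
by rewrite RintegralB.
Qed.

Lemma Im_inner_bergman f g : complex.Im (inner (bergman D) f g) =
  complex.Re (inner (bergman D) f ('i *: g)).
Proof.
rewrite -[LHS]/(\int[mu]_(t in cv @^-1` D) complex.Im (f (cv t) * (g (cv t))^*)).
rewrite -[RHS]/(\int[mu]_(t in cv @^-1` D) complex.Re (f (cv t) * ('i * g (cv t))^*)).
by apply: eq_Rintegral => t _; case: (f _) (g _) => a b [a' b'] /=; ring.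
Qed.

Lemma Re_inner_series_op x y : carrier l2 x -> carrier l2 y ->
  complex.Re (inner (bergman D) (series_op x) (series_op y)) =
  complex.Re (inner l2 x y).
Proof.
move=> cx cy.
have cp : carrier l2 (x + y) by exact: ell2_D.
have cm : carrier l2 (x - y).
  by rewrite addrC -scaleN1r addrC; apply: ell2_D => //; exact: ell2_Z.
have ep : series_op x + series_op y = series_op (x + y).
  by rewrite -[x in RHS]scale1r series_op_linear// scale1r.
have em : series_op x - series_op y = series_op (x - y).
  have := series_op_linear (-1) cy cx.
  by rewrite !scaleN1r (addrC (- y)) (addrC (- series_op y)).
rewrite Re_inner_bergman ?ep ?em; try exact: series_op_carrier.
by rewrite (Re_inner_ell2 exB)// !bergman_norm.
Qed.

(** Norms are preserved by Parseval's identity, hence inner products by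
    polarization; surjectivity is the power series expansion. *)
Theorem series_op_unitary : unitary l2 (bergman D) series_op.
Proof.
split; [split|exact: series_op_linear|].
- by move=> x; exact: series_op_carrier.
- by move=> x y; rewrite !inE; exact: series_op_inj.
- by move=> f /series_op_surj[x cx <-]; exists x.
- move=> x y cx cy; have ciy : carrier l2 ('i *: y) by exact: ell2_Z.
  apply/eqP; rewrite eq_complex Re_inner_series_op// eqxx andTb.
  rewrite Im_inner_bergman Im_inner_ell2 -Re_inner_series_op//.
  apply/eqP; congr (complex.Re (inner _ _ _)).
  have c0 := @ell2_0 R V.
  have s0 : series_op 0 = 0.
    have := series_op_linear (-1) c0 c0.
    by rewrite scaler0 addr0 scaleN1r addNr.
  by have := series_op_linear 'i cy c0; rewrite s0 !addr0.
Qed.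

Lemma series_op_chi u z : D z ->
  series_op (chi R u) z = mon (fun j => z j 0) u / (pn u)%:C.
Proof.
move=> Dz; have sz := esum_term_summable (ell2_chi R u) Dz.
rewrite series_opE//; apply: ccvg_unique (csum_cvg exB sz) _.
have [N0 hN0] := exB.2 u.
apply/ccvgP => e e0; exists N0 => N hN.
have uN : u \in box n N by apply: (fsubsetP (exB.1 _ _ hN)).
rewrite (big_fsetD1 u)//= big_seq big1 ?addr0 => [|v].
  rewrite /esum_term /ecoef /chi eqxx mul1r mulrC subrr cabs0; exact: ltW.
rewrite !inE => /andP[/negbTE vu _].
by rewrite /esum_term /ecoef /chi vu !mul0r.
Qed.

End bergman.

(** * Multiplication by a polynomial *)

Section multiplication.
Context (R : realType) (n : nat).
Local Notation C := R[i].
Local Notation mu := (lebesgueC R n).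
Local Notation cv := (@cvec R n).
Local Notation V := (multinom n).
Local Notation l2 := (ell2 R V).
Implicit Types (p : mpoly n C) (s : seq V) (c : V -> C).

Lemma peval_sum s c z : peval (\sum_(u <- s) c u *: mpolyX C u) z =
  \sum_(u <- s) c u * mon (fun j => z j 0) u.
Proof.
rewrite /peval raddf_sum/=; apply: eq_bigr => u _.
by rewrite mevalZ -[meval _ _]/(peval _ z) peval_mon.
Qed.

Lemma differentiable_peval p (z : 'cV[C]_n) :
  differentiable (peval p : 'cV[C]_n -> C) z.
Proof.
rewrite (_ : peval p = fun z : 'cV[C]_n =>
  \sum_(u <- msupp p) mcoeff u p * mon (fun j => z j 0) u); last first.
  by apply/funext => x; rewrite {1}(mpolyE p) peval_sum.
exact: differentiable_mon_sum.
Qed.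

Context (D : set 'cV[C]_n) (Dr : reinhardt D) (Db : bounded_set D) (D0 : D 0).

Lemma peval_bounded p : exists2 K : R, 0 <= K &
  forall z, D z -> cabs (peval p z) <= K.
Proof.
have [B B0 hB] := bounded_vnorm Db.
exists (\sum_(u <- msupp p) cabs (mcoeff u p) * mon (fun=> B) u) => [|z Dz].
  apply: sumr_ge0 => u _; rewrite mulr_ge0 ?cabs_ge0// mon_ge0// => j; exact: ltW.
rewrite {1}(mpolyE p) peval_sum; apply: le_trans (cabs_sum _ _ _) _.
apply: ler_sum => u _; rewrite cabsM ler_wpM2l ?cabs_ge0// cabs_mon.
apply: ler_mon => j; rewrite cabs_ge0/=.
exact: le_trans (cabs_le_vnorm _ _) (hB _ Dz).
Qed.

Lemma mul_op_bounded p : exists2 K : R, 0 <= K & forall f, carrier (bergman D) f ->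
  carrier (bergman D) (mul_op p f) /\
  hnorm (bergman D) (mul_op p f) <= K * hnorm (bergman D) f.
Proof.
have [K K0 hK] := peval_bounded p; exists K => // f /bergmanP[fd f0 foo].
have oD : open D by case: Dr.
have mD : measurable (cv @^-1` D) by exact: measurable_open.
have pd z : D z -> differentiable (mul_op p f : 'cV[C]_n -> C) z.
  by move=> Dz; apply: differentiableM; [exact: differentiable_peval|exact: fd].
have mf : measurable_fun (cv @^-1` D) (fun t => (cabs (f (cv t)) ^+ 2)%:E).
  by apply/measurable_EFinP; apply: measurable_cabs2 => //; exact: differentiable_cont_on.
have ge0 (g : 'cV[C]_n -> C) : (0 <= \int[mu]_(t in cv @^-1` D) (cabs (g (cv t)) ^+ 2)%:E)%E.
  by apply: integral_ge0 => t _; rewrite lee_fin sqr_ge0.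
have le : (\int[mu]_(t in cv @^-1` D) (cabs (mul_op p f (cv t)) ^+ 2)%:E <=
    (K ^+ 2)%:E * \int[mu]_(t in cv @^-1` D) (cabs (f (cv t)) ^+ 2)%:E)%E.
  rewrite -ge0_integralZl ?lee_fin ?sqr_ge0//; last by move=> t _; rewrite lee_fin sqr_ge0.
  apply: ge0_le_integral => //.
  - by move=> t _; rewrite lee_fin sqr_ge0.
  - by apply/measurable_EFinP; apply: measurable_cabs2 => //; exact: differentiable_cont_on.
  - by apply: measurable_funeM.
  - move=> t Dt; rewrite -EFinM lee_fin -exprMn lerXn2r ?nnegrE ?mulr_ge0 ?cabs_ge0//.
    by rewrite cabsM ler_wpM2r ?cabs_ge0// hK.
have ffin : (\int[mu]_(t in cv @^-1` D) (cabs (f (cv t)) ^+ 2)%:E)%E \is a fin_num.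
  by rewrite ge0_fin_numE.
have pfin : (\int[mu]_(t in cv @^-1` D) (cabs (mul_op p f (cv t)) ^+ 2)%:E < +oo)%E.
  by apply: (le_lt_trans le); rewrite -(fineK ffin) -EFinM ltry.
split; first by apply/bergmanP => //; split=> // z Dz; rewrite /mul_op f0 ?mulr0.
rewrite !hnorm_bergman -[K in leRHS]ger0_norm// -sqrtr_sqr -sqrtrM ?sqr_ge0//.
rewrite ler_sqrt ?mulr_ge0 ?sqr_ge0 ?fine_ge0//.
by rewrite -lee_fin EFinM !fineK// ge0_fin_numE.
Qed.

Lemma mul_opD p d f g : mul_op p (d *: f + g) = d *: mul_op p f + mul_op p g.
Proof.
apply/funext => z; rewrite -[RHS]/(d * (peval p z * f z) + peval p z * g z).
by rewrite /mul_op -[(d *: f + g) z]/(d * f z + g z); ring.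
Qed.

(** The column of the multiplication operator at the basis vector of index
    [alpha], read in the orthonormal basis of normalized monomials. *)
Definition shift_column s c (alpha : V) : V -> C :=
  \sum_(u <- s) (c u * (monomial_norm D (mnm_add alpha u) / monomial_norm D alpha)%:C)
    *: chi R (mnm_add alpha u).

Lemma shift_column_carrier s c alpha : carrier l2 (shift_column s c alpha).
Proof. by apply: ell2_sum => u; exact: ell2_chi. Qed.

Let scale_fctE (d : C) (g : 'cV[C]_n -> C) z : (d *: g) z = d * g z.
Proof. by []. Qed.

Let scale_addE (d : C) (f g : 'cV[C]_n -> C) z : (d *: f + g) z = d * f z + g z.
Proof. by []. Qed.

Lemma series_op0 : series_op D 0 = 0.
Proof.
have c0 := @ell2_0 R V; have := series_op_linear Dr Db D0 (-1) c0 c0.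
by rewrite scaler0 addr0 scaleN1r addNr.
Qed.

Lemma series_op_sum s (c : V -> C) (g : V -> V -> C) : (forall i, carrier l2 (g i)) ->
  series_op D (\sum_(i <- s) c i *: g i) = \sum_(i <- s) c i *: series_op D (g i).
Proof.
move=> hg; elim: s => [|i s IH]; first by rewrite !big_nil series_op0.
by rewrite !big_cons (series_op_linear Dr Db D0) ?IH//; exact: ell2_sum.
Qed.

(** On the basis the two operators agree because
    [z ^ alpha * z ^ u = z ^ (alpha + u)]. *)
Lemma series_op_column s c alpha : series_op D (shift_column s c alpha) =
  mul_op (\sum_(u <- s) c u *: mpolyX C u) (series_op D (chi R alpha)).
Proof.
apply/funext => z; rewrite /mul_op.
have [Dz|Dz] := pselect (D z); last by rewrite !series_op_out// mulr0.
rewrite series_op_sum => [|u]; last exact: ell2_chi.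
rewrite peval_sum fct_sumE mulr_suml; apply: eq_bigr => u _.
rewrite scale_fctE !(series_op_chi Dr Db D0 _ Dz).
have nz v : (monomial_norm D v)%:C != 0 :> C.
  by rewrite -cabs_eq0 cabs_real normr_eq0 gt_eqF// monomial_norm_gt0.
have alg (x A B m m' : C) : A != 0 -> B != 0 ->
    x * (B * A^-1) * (m * m' / B) = x * m' * (m / A).
  by move=> A0 B0; field; rewrite A0 B0.
rewrite monD rmorphM/= fmorphV/=; apply: alg; exact: nz.
Qed.

(** Both sides are, at each point of [D], bounded functionals of the family, so
    agreement on the basis is enough. *)
Lemma series_op_intertwines s c (L : (V -> C) -> V -> C) : bounded_operator l2 L ->
  (forall alpha, L (chi R alpha) = shift_column s c alpha) ->
  forall x, carrier l2 x -> series_op D (L x) =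
    mul_op (\sum_(u <- s) c u *: mpolyX C u) (series_op D x).
Proof.
set p := \sum_(u <- s) _ => -[Lc Ll [M hM]] Lchi x cx; apply/funext => z.
have [Dz|Dz] := pselect (D z); last by rewrite /mul_op !series_op_out ?mulr0.
have [K K0 hK] := series_op_bounded Dr Db D0 Dz.
apply/subr0_eq; move: x cx.
apply: (@ell2_functional0 R V
  (fun x => series_op D (L x) z - mul_op p (series_op D x) z)
  (K * `|M| + cabs (peval p z) * K)).
- by rewrite addr_ge0// mulr_ge0 ?cabs_ge0.
- move=> d x y cx cy; rewrite Ll// !(series_op_linear Dr Db D0) ?mul_opD//; try exact: Lc.
  rewrite scale_addE [X in _ - X = _]scale_addE.
  by ring.
- move=> x cx; apply: le_trans (cabsB _ _) _; rewrite mulrDl; apply: lerD.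
    apply: le_trans (hK _ (Lc _ cx)) _; rewrite -mulrA ler_wpM2l// -!hnorm_ell2.
    apply: le_trans (hM _ cx) _; apply: ler_wpM2r; last exact: ler_norm.
    exact: sqrtr_ge0.
  by rewrite cabsM -mulrA ler_wpM2l ?cabs_ge0// hK.
- by move=> v; rewrite Lchi series_op_column subrr.
Qed.

(** The operator is obtained by transporting multiplication through the unitary,
    which makes it bounded; its columns are then computed on the basis. *)
Lemma shift_operator_exists s c : exists2 L : (V -> C) -> V -> C,
  bounded_operator l2 L & forall alpha, L (chi R alpha) = shift_column s c alpha.
Proof.
pose p := \sum_(u <- s) c u *: mpolyX C u.
have [K K0 hK] := mul_op_bounded p.
have [|L hL] := @choice (V -> C) (V -> C) (fun x y => carrier l2 x ->
    carrier l2 y /\ series_op D y = mul_op p (series_op D x)).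
  move=> x; have [cx|ncx] := pselect (carrier l2 x); last by exists 0.
  have [|y cy yE] := series_op_surj Dr Db D0 (f := mul_op p (series_op D x)).
    by apply: (hK _ _).1; exact: series_op_carrier.
  by exists y.
exists L.
  split=> [x /hL[]//|d x y cx cy|].
    have [cLx Lx] := hL x cx; have [cLy Ly] := hL y cy.
    have [cLxy Lxy] : carrier l2 (L (d *: x + y)) /\
        series_op D (L (d *: x + y)) = mul_op p (series_op D (d *: x + y)).
      by apply: hL; apply: ell2_D => //; exact: ell2_Z.
    apply: (series_op_inj Dr Db D0) => //.
      by apply: ell2_D => //; exact: ell2_Z.
    by rewrite Lxy !(series_op_linear Dr Db D0)// mul_opD Lx Ly.
  exists K => x cx; have [cLx Lx] := hL x cx.
  rewrite -!(hnorm_series_op Dr Db D0)// Lx; apply: (hK _ _).2.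
  exact: series_op_carrier.
move=> alpha; have [cL LE] := hL _ (ell2_chi R alpha).
apply: (series_op_inj Dr Db D0) => //; first exact: shift_column_carrier.
by rewrite LE series_op_column.
Qed.

End multiplication.

(** * The graph of exponents *)

Section graph.
Context (n : nat) (N : {fset multinom n}).
Local Notation V := (multinom n).
Local Notation E := (shift_edge N).

Lemma shift_edgeP (alpha beta : V) :
  reflect (exists2 u, u \in N & beta = mnm_add alpha u) (E alpha beta).
Proof.
by apply: (iffP (imfsetP _ _ _ _)) => -[u uN ->]; exists u.
Qed.

Context (N0 : forall u, u \in N -> (0 < mdeg u)%N).

(** Degrees grow along edges. *)
Lemma shift_no_circuit s : ~~ circuit E s.
Proof.
apply/negP => /and3P[s2 _ sc].
have lt (x y : V) : E x y -> (mdeg x < mdeg y)%N.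
  by move=> /shift_edgeP[u /N0 u0 ->]; rewrite mdegD -addn1 leq_add2l.
case: s s2 sc => [//|x s _] /=.
have pl y r : path E y r -> (mdeg y <= mdeg (last y r))%N.
  elim: r y => [//|z r IH] y /= /andP[/lt yz /IH]; exact: leq_trans (ltnW yz).
rewrite rcons_path => /andP[/pl h /lt]; by rewrite ltnNge h.
Qed.

(** Two vertices have no more common children than either has children, and those
    are translates of [N]. *)
Lemma shift_semitree : exists m, gen_directed_semitree E m.
Proof.
have [m Nm] : exists m, ([set` N] #<= `I_m)%card by exact/finite_set_leP/finite_fset.
exists m; split; first exact: shift_no_circuit.
  apply: (sub_countable (card_image_le _ _)); exact: countableP.
move=> u v _; apply: (card_le_trans _ Nm).
apply: (card_le_trans _ (card_image_le (mnm_add u) _)); apply: subset_card_le.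
by move=> w [/shift_edgeP[x xN ->] _]; exists x.
Qed.

End graph.

(** Positivity of the coefficients rules out cancellation: every exponent of [N]
    occurs in the polynomial and so has its degree. *)
Lemma mdeg_support (R : numDomainType) n d (N : {fset multinom n})
    (a : multinom n -> R) (p : mpoly n R) : p = \sum_(u <- N) a u *: mpolyX R u ->
  p \is ishomog1 d mdeg -> (forall u, u \in N -> 0 < a u) ->
  forall u, u \in N -> mdeg u = d.
Proof.
move=> pE /dhomogP pd a0 u uN; apply: pd.
rewrite mcoeff_msupp pE raddf_sum/= (big_fsetD1 u)//= big_seq big1 => [|v].
  by rewrite addr0 mcoeffZ mcoeffX eqxx mulr1 gt_eqF// a0.
by rewrite !inE => /andP[/negbTE vu _]; rewrite mcoeffZ mcoeffX vu mulr0.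
Qed.

Lemma semitree_index_exists (V : choiceType) (E : rel V) m :
  gen_directed_semitree E m -> exists c, semitree_index E c.
Proof.
move=> hm; pose P k := `[< gen_directed_semitree E k >].
have exP : exists k, P k by exists m; apply/asboolP.
exists (ex_minn exP); case: ex_minnP => c /asboolP hc cmin.
by split=> // k hk; apply: cmin; apply/asboolP.
Qed.

(** * The weighted shift and the multiplication operator *)

Unset Implicit Arguments.

Theorem proposition5p2 (R : realType) (n : nat) (G : set 'M[R[i]]_n)
    (theta : n.-tuple (mpoly n R[i])) (eta : 'I_n -> nat)
    (N : 'I_n -> {fset multinom n}) (a : 'I_n -> multinom n -> R)
    (D : set 'cV[R[i]]_n)
    (Gfin : finite_set G) (Grefl : pseudoreflection_group G)
    (Gtheta : basic_polynomials G theta)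
    (theta_homog : forall i, tnth theta i \is ishomog1 (eta i) mdeg)
    (N_deg : forall i u, u \in N i -> mdeg u = eta i)
    (a_gt0 : forall i u, u \in N i -> 0 < a i u)
    (thetaE : forall i,
      tnth theta i = \sum_(u <- N i) (a i u)%:C *: mpolyX R[i] u)
    (Ddom : complete_reinhardt_domain D) (Dbnd : bounded_set D) :
  forall i : 'I_n,
  let is_Lambda (Lambda : (multinom n -> R[i]) -> multinom n -> R[i]) :=
    (exists w, weighted_shift (shift_edge (N i)) w Lambda) /\
    (forall alpha, Lambda (chi R alpha) =
      \sum_(u <- N i)
        (a i u * (monomial_norm D (mnm_add alpha u) / monomial_norm D alpha))%:C
        *: chi R (mnm_add alpha u)) in
  [/\ exists c, semitree_index (shift_edge (N i)) c,
      exists Lambda, is_Lambda Lambda &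
      forall Lambda, is_Lambda Lambda ->
        unitarily_equivalent (ell2 R (multinom n)) (bergman D)
          Lambda (mul_op (tnth theta i))].
Proof.
case: Ddom => oD _ D0 Dr'; have Dr : reinhardt D by [].
move=> i is_Lambda.
pose c u : R[i] := (a i u)%:C.
have col alpha : \sum_(u <- N i) (a i u *
      (monomial_norm D (mnm_add alpha u) / monomial_norm D alpha))%:C
      *: chi R (mnm_add alpha u) = shift_column D (N i) c alpha.
  by apply: eq_bigr => u _; rewrite rmorphM.
have N0 u : u \in N i -> (0 < mdeg u)%N.
  case: Gtheta => /(_ i)[d d0 hd] _ _ uN.
  rewrite (mdeg_support (thetaE i) hd) => // v vN.
  by rewrite ltcR a_gt0.
split.
- by have [m hm] := shift_semitree N0; exact: semitree_index_exists hm.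
- have [L Lb Lchi] := shift_operator_exists Dr Dbnd D0 (N i) c.
  exists L; split; last by move=> alpha; rewrite Lchi col.
  (* off the edges, the columns of [L] vanish *)
  exists (fun u v => L (chi R u) v); split=> // u v.
  case: ifPn => // uv; rewrite Lchi /shift_column fct_sumE big_seq big1// => w wN.
  have : v != mnm_add u w.
    by apply: contra uv => /eqP ->; apply/shift_edgeP; exists w.
  by rewrite -[(_ *: chi _ _) v]/(_ * (v == _)%:R) => /negbTE ->; rewrite mulr0.
- move=> L [[w [Lb _]] Lchi]; exists (series_op D); first exact: series_op_unitary.
  move=> x cx; rewrite thetaE; apply: (series_op_intertwines Dr Dbnd D0 Lb) => //.
  by move=> alpha; rewrite Lchi col.
Qed.
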